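(* Let $\mathbf{k}$ be an algebraically closed field of characteristic $0$, let $F$ be a general enough homogeneous cubic in six variables, let $I=F^\perp+S_{\ge3}$, and let $V=\pi^{-1}([I])\subseteq\mathcal{B}^+$ be the negative spike at $[I]\in\mathcal{B}\subseteq\mathcal{H}=\mathrm{Hilb}^{13}_{\mathbb{A}^6/\mathbf{k}}$. Then the morphism $$\bar u:\mathrm{Spec}\left(\frac{\mathbf{k}[\beta_1,\dots,\beta_6]}{F_{\bar y}^\perp}\right)\to V$$ induced by the fractal family is an isomorphism. Moreover, for the presentation $V=\mathrm{Spec}\left(\mathbf{k}[\gamma_1,\dots,\gamma_6]/J\right)$ described in the context, $$J=F^\perp(\bar\gamma):=\{h(\gamma_1,\dots,\gamma_6)\in\mathbf{k}[\gamma_1,\dots,\gamma_6]: h(\alpha_1,\dots,\alpha_6)\in F^\perp\}.$$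
   Context: Apolarity. $S=\mathbf{k}[\alpha_1,\dots,\alpha_6]$ acts on $\mathbf{k}[x_1,\dots,x_6]$ with $\alpha_i=\frac{\partial}{\partial x_i}$; write $f\lrcorner p$, $ev_F(f)=f\lrcorner F$, $F^\perp=\{f\in S:f\lrcorner F=0\}$. A homogeneous cubic $F$ is general enough if: (1) $F,\frac{\partial F}{\partial x_1},\dots,\frac{\partial F}{\partial x_6},x_1,\dots,x_6,1$ are linearly independent (so form a basis of $\mathrm{im}(ev_F)$, and $[F^\perp]\in\mathrm{Hilb}^{14}_{\mathbb{A}^6/\mathbf{k}}$); (2) the minimal graded free resolution of $F^\perp$ starts with $0\leftarrow F^\perp\leftarrow S^{\oplus15}(-2)\leftarrow S^{\oplus35}(-3)\leftarrow\cdots$; (3) $\dim_{\mathbf{k}}\mathrm{Hom}_S(F^\perp,S/F^\perp)_{<0}=6$. Fix $g,Q_1,\dots,Q_6\in S$, $g$ of degree three and $Q_i$ of degree two, with $g\lrcorner F=1$, $Q_i\lrcorner F=x_i$. Then $I=F^\perp+S_{\ge3}=(F^\perp,g)$. Hilbert and barycenter schemes. $\mathcal{H}$ is the scheme whose $A$-points are ideals $J'\subseteq S_A=A[\alpha_1,\dots,\alpha_6]$ with $S_A/J'$ finite flat over $A$ of rank $13$. $\mathbb{G}_m$ acts via scaling on $\mathbb{A}^6$: $a\cdot[J']=\ker(S_A\to S_A\to S_A/J')$, first map $\alpha_i\mapsto a\alpha_i$. $Bar:\mathcal{H}\to\mathbb{A}^6$ is the Hilbert–Chow morphism followed by averaging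 (on a free family $R$ over $A$: $\alpha_j\mapsto\frac1{13}\mathrm{Tr}_{R/A}(\alpha_j)$); $\mathcal{B}=Bar^{-1}(0)$. Translation gives a $\mathbb{G}_m$-equivariant isomorphism $\mathbb{A}^6\times\mathcal{B}\simeq\mathcal{H}$, and $c:\mathcal{H}\to\mathcal{B}$ is the resulting projection. $\mathcal{B}^+$ represents $T\mapsto\{\mathbb{G}_m\text{-equivariant }\mathbb{A}^1\times T\to\mathcal{B}\}$ ($\mathbb{G}_m$ acts by multiplication on $\mathbb{A}^1$, trivially on $T$); $\pi:\mathcal{B}^+\to\mathcal{B}^{\mathbb{G}_m}$ is restriction to $0\times T$, and restriction to $1\times T$ is an open embedding near $[I]$, so $T_{[I]}V\subseteq T_{[I]}\mathcal{B}^+=T_{[I]}\mathcal{B}\subseteq T_{[I]}\mathcal{H}=\mathrm{Hom}_S(I,S/I)$ (where $\delta$ corresponds to the ideal generated by $f-\varepsilon\delta(f)'$, $f\in I$, $\delta(f)'$ a lift of $\delta(f)$). Fractal family. Let $\beta_i=\frac{\partial}{\partial y_i}$, $F_{\bar x}=F(\bar x)$, $F_{\bar y}=F(\bar y)$, and let $F_{\bar x}^\perp$, $F_{\bar y}^\perp$ be the corresponding annihilators in $\mathbf{k}[\bar\alpha]$, $\mathbf{k}[\bar\beta]$ (the same symbols denote the ideals they generate in larger polynomial rings). Put $$\Gamma(t)=g(\bar\alpha)+t\sum_{i=1}^6\beta_iQ_i(\bar\alpha)+t^2\sum_{i=1}^6\alpha_iQ_i(\bar\beta)+t^3g(\bar\beta),\qquad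 M=\frac{\mathbf{k}[t,\bar\alpha,\bar\beta]}{(F_{\bar x}^\perp,F_{\bar y}^\perp,\Gamma(t))}.$$ The $\mathbf{k}[t,\bar\beta]/F_{\bar y}^\perp$-algebra $M$ (the fractal family) is finite flat of rank $13$ and so defines a morphism $v:\mathbb{A}^1\times\mathrm{Spec}(\mathbf{k}[\bar\beta]/F_{\bar y}^\perp)\to\mathcal{H}$, which is $\mathbb{G}_m$-equivariant for the multiplication action on $\mathbb{A}^1$ and trivial action on the second factor. Put $u=c\circ v$. By the functorial definition of $\mathcal{B}^+$, $u$ corresponds to a morphism $\bar u:\mathrm{Spec}(\mathbf{k}[\bar\beta]/F_{\bar y}^\perp)\to\mathcal{B}^+$, and $\pi\circ\bar u$ is constant with value $[I]$, so $\bar u$ factors through $V$; the factorisation is also denoted $\bar u$. Presentation of $V$. Let $\mathfrak{x}_i\in\mathrm{Hom}_S(I,S/I)$ be the homomorphism with $(F^\perp)_2\mapsto0$, $g\mapsto Q_i$; let $\partial_i\in\mathrm{Hom}_S(I,S/I)$ be $f\mapsto\frac{\partial f}{\partial\alpha_i}$; and $\mathfrak{y}_i=\mathfrak{x}_i-\frac1{13}\partial_i$. Then $\mathfrak{y}_1,\dots,\mathfrak{y}_6$ is a basis of $T_{[I]}V$. $V=\mathrm{Spec}\,B$ is affine, and its natural $\mathbb{A}^1$-action gives a grading $B=\bigoplus_{m\ge0}B_m$ with $B_0=\mathbf{k}$; let $\mathfrak{m}=\bigoplus_{m\ge1}B_m$. Let $\mathfrak{y}_1^\vee,\dots,\mathfrak{y}_6^\vee\in\mathfrak{m}$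 be homogeneous elements whose classes form the basis of $\mathfrak{m}/\mathfrak{m}^2$ dual to $\mathfrak{y}_1,\dots,\mathfrak{y}_6$. The graded homomorphism $\mathbf{k}[\gamma_1,\dots,\gamma_6]\to B$, $\gamma_i\mapsto\mathfrak{y}_i^\vee$, is surjective and $J$ is its kernel. *)

(* Defs.v *)
From HB Require Import structures.
From mathcomp Require Import all_boot all_order all_algebra.
From mathcomp Require Import ring_quotient qpoly ssrcomplements mpoly.

Set Implicit Arguments.
Unset Strict Implicit.
Unset Printing Implicit Defensive.

Import GRing.Theory.
Local Open Scope ring_scope.
Local Open Scope quotient_scope.

(* Ideals are Prop-valued predicates, compared extensionally. *)
Definition is_ideal (P : comNzRingType) (J : P -> Prop) : Prop :=
  [/\ J 0, forall p q, J p -> J q -> J (p + q) & forall p q, J q -> J (p * q)].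

Definition ideal_gen (P : comNzRingType) (G : P -> Prop) (p : P) : Prop :=
  exists (r : nat) (c h : 'I_r -> P),
    (forall i, G (h i)) /\ p = \sum_i c i * h i.

Definition eq_ideal (P : Type) (J J' : P -> Prop) : Prop :=
  forall p, J p <-> J' p.

(* The same type {mpoly k[6]} serves for k[alpha], k[beta], k[gamma] and for
   k[x]; in [hook f p] the operator is f and the polynomial acted on is p. *)
Definition hook (k : fieldType) (f p : {mpoly k[6]}) : {mpoly k[6]} :=
  \sum_(m <- msupp f) f@_m *: p^`M[m].

Definition perp (k : fieldType) (F f : {mpoly k[6]}) : Prop := hook f F = 0.

Section HookModule.
Variable k : fieldType.
Implicit Types f h p : {mpoly k[6]}.

Lemma hook_widen d f p : (msize f <= d)%N ->
  hook f p = \sum_(m : 'X_{1..6 < d}) f@_m *: p^`M[m].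
Proof.
move=> lfd; rewrite /hook.
pose I : subFinType _ := 'X_{1..6 < d}; rewrite (big_mksub I) ?msupp_uniq //=; first last.
  by move=> m /msize_mdeg_lt /leq_trans; apply.
rewrite big_rmcond //= => m /memN_msupp_eq0 ->.
by rewrite scale0r.
Qed.

Lemma hookDl f h p : hook (f + h) p = hook f p + hook h p.
Proof.
pose d := maxn (msize (f + h)) (maxn (msize f) (msize h)).
rewrite !(@hook_widen d) ?leq_max ?leqnn ?orbT //.
by rewrite -big_split /=; apply: eq_bigr => m _; rewrite mcoeffD scalerDl.
Qed.

Lemma hookZl c f p : hook (c *: f) p = c *: hook f p.
Proof.
pose d := maxn (msize (c *: f)) (msize f).
rewrite !(@hook_widen d) ?leq_max ?leqnn ?orbT // scaler_sumr.
by apply: eq_bigr => m _; rewrite mcoeffZ scalerA.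
Qed.

Lemma hook0l p : hook 0 p = 0.
Proof. by rewrite /hook msupp0 big_nil. Qed.

Lemma hook_suml (T : Type) (s : seq T) (G : T -> {mpoly k[6]}) p :
  hook (\sum_(i <- s) G i) p = \sum_(i <- s) hook (G i) p.
Proof.
elim: s => [|x s ih]; first by rewrite !big_nil hook0l.
by rewrite !big_cons hookDl ih.
Qed.

Lemma hookX m p : hook 'X_[m] p = p^`M[m].
Proof. by rewrite /hook msuppX big_seq1 mcoeffX eqxx scale1r. Qed.

Lemma hook1 p : hook 1 p = p.
Proof. by rewrite -mpolyX0 hookX mderivm0m. Qed.

Lemma hook0r f : hook f 0 = 0.
Proof. by rewrite /hook big1 // => m _; rewrite linear0 scaler0. Qed.

Lemma hookM f h p : hook (f * h) p = hook f (hook h p).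
Proof.
rewrite {1}[f]mpolyE mulr_suml hook_suml [RHS]/hook.
apply: eq_bigr => m _; rewrite -scalerAl hookZl; congr (_ *: _).
rewrite {1}[h]mpolyE mulr_sumr hook_suml [hook h p]/hook linear_sum.
apply: eq_bigr => m' _ /=.
by rewrite -scalerAr hookZl -mpolyXD hookX linearZ /= -!mderivmDm addmC.
Qed.

End HookModule.

Definition perp_pred (k : fieldType) (F : {mpoly k[6]}) (hF : F != 0) :
  pred {mpoly k[6]} := fun f => hook f F == 0.

Fact perp_idealr (k : fieldType) (F : {mpoly k[6]}) (hF : F != 0) :
  idealr_closed (perp_pred hF).
Proof.
split; rewrite ?inE ?unfold_in /perp_pred ?hook0l ?hook1 // => a u v.
rewrite !unfold_in => /eqP u0 /eqP v0.
by rewrite hookDl hookM u0 v0 hook0r addr0.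
Qed.

HB.instance Definition _ (k : fieldType) (F : {mpoly k[6]}) (hF : F != 0) :=
  isIdealr.Build {mpoly k[6]} (perp_pred hF) (perp_idealr hF).

Definition apolar_algebra (k : fieldType) (F : {mpoly k[6]}) (hF : F != 0) :
  Type := {ideal_quot (perp_pred hF : idealr {mpoly k[6]})}.

Section ApolarAlgebra.
Variables (k : fieldType) (F : {mpoly k[6]}) (hF : F != 0).
Local Notation Q := (apolar_algebra hF).
Local Notation I0 := (perp_pred hF : idealr {mpoly k[6]}).

HB.instance Definition _ := GRing.ComNzRing.copy Q {ideal_quot I0}.

Definition apolar_pi : {mpoly k[6]} -> Q := \pi_({ideal_quot I0}).

Fact apolar_pi_zmod : zmod_morphism apolar_pi.
Proof. exact: (rmorphB (\pi_({ideal_quot I0}))). Qed.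

Fact apolar_pi_monoid : monoid_morphism apolar_pi.
Proof.
by split; [exact: (rmorph1 (\pi_({ideal_quot I0})))
         | exact: (rmorphM (\pi_({ideal_quot I0})))].
Qed.

HB.instance Definition _ :=
  GRing.isZmodMorphism.Build {mpoly k[6]} Q apolar_pi apolar_pi_zmod.
HB.instance Definition _ :=
  GRing.isMonoidMorphism.Build {mpoly k[6]} Q apolar_pi apolar_pi_monoid.

Definition apolar_scale (c : k) (x : Q) : Q := apolar_pi c%:MP * x.

Fact apolar_scaleA a b v :
  apolar_scale a (apolar_scale b v) = apolar_scale (a * b) v.
Proof. by rewrite /apolar_scale mulrA -rmorphM -mpolyCM. Qed.
Fact apolar_scale1 : left_id 1 apolar_scale.
Proof. by move=> v; rewrite /apolar_scale rmorph1 mul1r. Qed.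
Fact apolar_scaleDr : right_distributive apolar_scale +%R.
Proof. by move=> a u v; rewrite /apolar_scale mulrDr. Qed.
Fact apolar_scaleDl v : {morph apolar_scale^~ v : a b / a + b}.
Proof. by move=> a b; rewrite /apolar_scale mpolyCD rmorphD mulrDl. Qed.

HB.instance Definition _ := GRing.Zmodule_isLmodule.Build k Q
  apolar_scaleA apolar_scale1 apolar_scaleDr apolar_scaleDl.

Fact apolar_scaleAl (a : k) (u v : Q) : a *: (u * v) = (a *: u) * v.
Proof. exact: mulrA. Qed.
HB.instance Definition _ := GRing.Lmodule_isLalgebra.Build k Q apolar_scaleAl.
HB.instance Definition _ := GRing.Lalgebra_isComAlgebra.Build k Q.

End ApolarAlgebra.

(* An S-linear map a -> S/b is represented by a function on S choosing lifts
   of its values; only its values on a, modulo b, matter. *)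
Definition is_hom (k : fieldType) (a b : {mpoly k[6]} -> Prop)
    (phi : {mpoly k[6]} -> {mpoly k[6]}) : Prop :=
  (forall f h, a f -> a h -> b (phi (f + h) - (phi f + phi h))) /\
  (forall s f, a f -> b (phi (s * f) - s * phi f)).

Definition eq_hom (k : fieldType) (a b : {mpoly k[6]} -> Prop)
    (phi psi : {mpoly k[6]} -> {mpoly k[6]}) : Prop :=
  forall f, a f -> b (phi f - psi f).

Definition hom_neg_degree (k : fieldType) (a b : {mpoly k[6]} -> Prop)
    (e : nat) (phi : {mpoly k[6]} -> {mpoly k[6]}) : Prop :=
  is_hom a b phi /\
  forall d f, a f -> f \is d.-homog ->
    exists2 r, b (phi f - r) &
      if (e <= d)%N then r \is (d - e).-homog else r == 0.

Definition hom_neg (k : fieldType) (a b : {mpoly k[6]} -> Prop)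
    (phi : {mpoly k[6]} -> {mpoly k[6]}) : Prop :=
  exists (N : nat) (theta : 'I_N -> {mpoly k[6]} -> {mpoly k[6]}),
    (forall e : 'I_N, hom_neg_degree a b e.+1 (theta e)) /\
    eq_hom a b phi (fun f => \sum_e theta e f).

Definition hom_neg_dim (k : fieldType) (a b : {mpoly k[6]} -> Prop)
    (d : nat) : Prop :=
  exists theta : 'I_d -> {mpoly k[6]} -> {mpoly k[6]},
    [/\ forall i, hom_neg a b (theta i),
        forall phi, hom_neg a b phi ->
          exists c : 'I_d -> k, eq_hom a b phi (fun f => \sum_i c i *: theta i f)
      & forall c : 'I_d -> k,
          eq_hom a b (fun=> 0) (fun f => \sum_i c i *: theta i f) ->
          forall i, c i = 0].

(* The minimal graded free resolution
     0 <- a <- (+)_(j < n 0) S(- d 0 j) <- (+)_(j < n 1) S(- d 1 j) <- ...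
   Elements of the free modules are row vectors; the i-th differential is
   v |-> v *m D i and the augmentation onto a is v |-> v *m eps. *)
Definition is_min_resolution (k : fieldType) (a : {mpoly k[6]} -> Prop)
    (n : nat -> nat) (d : forall i, 'I_(n i) -> nat)
    (eps : 'cV[{mpoly k[6]}]_(n 0%N))
    (D : forall i, 'M[{mpoly k[6]}]_(n i.+1, n i)) : Prop :=
  [/\ (forall j, eps j 0 \is (d 0%N j).-homog) /\
      (forall i r c, if (d i c <= d i.+1 r)%N
                     then D i r c \is (d i.+1 r - d i c).-homog
                     else D i r c == 0),
      forall f, a f <-> exists v : 'rV_(n 0%N), f = (v *m eps) 0 0,
      forall v : 'rV_(n 0%N), v *m eps = 0 <-> exists w, v = w *m D 0%N,
      forall i (v : 'rV_(n i.+1)), v *m D i = 0 <-> exists w, v = w *m D i.+1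
    & forall i r c, (D i r c)@_0 = 0].

Definition general_enough (k : fieldType) (F : {mpoly k[6]}) : Prop :=
  [/\ forall (c e : k) (a b : 'I_6 -> k),
        c *: F + \sum_i a i *: F^`M(i) + \sum_i b i *: 'X_i + e%:MP = 0 ->
        [/\ c = 0, forall i, a i = 0, forall i, b i = 0 & e = 0],
      exists n d eps D,
        [/\ @is_min_resolution k (perp F) n d eps D,
            n 0%N = 15%N /\ (forall j, d 0%N j = 2%N)
          & n 1%N = 35%N /\ (forall j, d 1%N j = 3%N)]
    & hom_neg_dim (perp F) (perp F) 6].

Lemma general_enough_neq0 (k : fieldType) (F : {mpoly k[6]}) :
  general_enough F -> F != 0.
Proof.
case=> indep _ _; apply/eqP => F0; have := indep 1 0 (fun=> 0) (fun=> 0).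
rewrite !big1 => [|i _|i _]; rewrite ?scale0r // F0 scaler0 !add0r mpolyC0.
by case=> // /eqP; rewrite oner_eq0.
Qed.

Definition trunc_ideal (k : fieldType) (F f : {mpoly k[6]}) : Prop :=
  exists f1 f2, [/\ perp F f1, forall m, m \in msupp f2 -> (3 <= mdeg m)%N
                  & f = f1 + f2].

(* Pullback of an R-point of H along Spec R' -> Spec R. *)
Definition base_change (R R' : comNzRingType) (rho : R -> R')
    (J : {mpoly R[6]} -> Prop) : {mpoly R'[6]} -> Prop :=
  ideal_gen (fun p => exists2 f, J f & p = map_mpoly rho f).

(* The images of b_0, ..., b_12 form a basis of the R_s-module
   (R[alpha] / J)_s. *)
Definition local_basis (R : comNzRingType) (J : {mpoly R[6]} -> Prop) (s : R)
    (b : 'I_13 -> {mpoly R[6]}) : Prop :=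
  (forall p, exists (n : nat) (c : 'I_13 -> R),
     J (s ^+ n *: p - \sum_i c i *: b i)) /\
  (forall c : 'I_13 -> R, J (\sum_i c i *: b i) ->
     exists n : nat, forall i, s ^+ n * c i = 0).

(* "Finite flat of rank 13" in the sense of Hilbert schemes: R[alpha] / J is
   free of rank 13 on each member of a finite cover of Spec R by principal
   opens. *)
Definition hilb13 (R : comNzRingType) (J : {mpoly R[6]} -> Prop) : Prop :=
  is_ideal J /\
  exists (r : nat) (w s : 'I_r -> R),
    \sum_i w i * s i = 1 /\ forall i, exists b, local_basis J (s i) b.

(* [a] is Bar(J): 13 a_j is the trace of multiplication by alpha_j on
   R[alpha] / J. Over a principal open D(s) where b is a basis, the matrix of
   this multiplication is T / s^n. Over Q-algebras, a is unique. *)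
Definition is_bar (R : comNzRingType) (J : {mpoly R[6]} -> Prop)
    (a : 'I_6 -> R) : Prop :=
  forall (s : R) b, local_basis J s b ->
  forall (j : 'I_6) (n : nat) (T : 'M[R]_13),
    (forall i, J (s ^+ n *: ('X_j * b i) - \sum_l T i l *: b l)) ->
    exists N : nat, s ^+ N * (\tr T - s ^+ n * (13%:R * a j)) = 0.

Definition bar_zero (R : comNzRingType) (J : {mpoly R[6]} -> Prop) : Prop :=
  hilb13 J /\ is_bar J (fun=> 0).

Definition translate (R : comNzRingType) (a : 'I_6 -> R)
    (J : {mpoly R[6]} -> Prop) (f : {mpoly R[6]}) : Prop :=
  J (f \mPo [tuple 'X_i + (a i)%:MP | i < 6]).

(* a . [J]: the kernel of S_R -> S_R -> S_R / J, alpha_i |-> a alpha_i. *)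
Definition scale (R : comNzRingType) (a : R)
    (J : {mpoly R[6]} -> Prop) (f : {mpoly R[6]}) : Prop :=
  J (f \mPo [tuple a *: 'X_i | i < 6]).

(* c(J) = J0 for c : H -> B the second projection of H ~ A^6 x B. *)
Definition is_centering (R : comNzRingType)
    (J J0 : {mpoly R[6]} -> Prop) : Prop :=
  bar_zero J0 /\ exists a, eq_ideal J (translate a J0).

(* A morphism A^1 x Spec A -> H is a point of H over A[t]; its value at the
   point (s, rho) of A^1 x Spec A with values in a k-algebra C is obtained by
   base change along A[t] -> C, t |-> s. *)
Definition value_at (A C : comNzRingType) (rho : A -> C) (s : C)
    (psi : {mpoly {poly A}[6]} -> Prop) : {mpoly C[6]} -> Prop :=
  base_change (fun p : {poly A} => (map_poly rho p).[s]) psi.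

Definition equivariant (k : fieldType) (A : comAlgType k)
    (psi : {mpoly {poly A}[6]} -> Prop) : Prop :=
  forall (C : comAlgType k) (rho : {lrmorphism A -> C}) (a a' s : C),
    a * a' = 1 ->
    eq_ideal (value_at rho (a * s) psi) (scale a (value_at rho s psi)).

(* Elements of V(A): G_m-equivariant morphisms A^1 x Spec A -> B whose
   restriction to 0 x Spec A is constant, equal to [I]. *)
Definition spike (k : fieldType) (F : {mpoly k[6]}) (A : comAlgType k)
    (psi : {mpoly {poly A}[6]} -> Prop) : Prop :=
  [/\ bar_zero psi, equivariant psi
    & eq_ideal (value_at idfun 0 psi)
               (base_change (in_alg A) (trunc_ideal F))].

Definition spike_map (A A' : comNzRingType) (phi : A -> A')
    (psi : {mpoly {poly A}[6]} -> Prop) : {mpoly {poly A'}[6]} -> Prop :=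
  base_change (map_poly phi) psi.

(* The morphism Spec B -> V given by xi in V(B) is an isomorphism, i.e. it is
   bijective on A-points for every k-algebra A. (The zero ring, excluded by
   comAlgType, imposes no condition.) *)
Definition spike_iso (k : fieldType) (F : {mpoly k[6]}) (B : comAlgType k)
    (xi : {mpoly {poly B}[6]} -> Prop) : Prop :=
  spike F xi /\
  forall (A : comAlgType k) (psi : {mpoly {poly A}[6]} -> Prop), spike F psi ->
    (exists phi : {lrmorphism B -> A}, eq_ideal (spike_map phi xi) psi) /\
    (forall phi phi' : {lrmorphism B -> A},
       eq_ideal (spike_map phi xi) psi ->
       eq_ideal (spike_map phi' xi) psi -> phi =1 phi').

Section Fractal.
Variables (k : fieldType) (F : {mpoly k[6]}) (hF : F != 0).
Variables (g : {mpoly k[6]}) (Q : 'I_6 -> {mpoly k[6]}).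
Local Notation R0 := (apolar_algebra hF).

Definition in_alpha (f : {mpoly k[6]}) : {mpoly {poly R0}[6]} :=
  map_mpoly (fun c => (in_alg R0 c)%:P) f.

Definition in_beta (f : {mpoly k[6]}) : {mpoly {poly R0}[6]} :=
  (apolar_pi hF f)%:P%:MP.

Definition Gamma : {mpoly {poly R0}[6]} :=
  let t : {mpoly {poly R0}[6]} := 'X%:MP in
    in_alpha g
  + t * \sum_i in_beta 'X_i * in_alpha (Q i)
  + t ^+ 2 * \sum_i in_alpha 'X_i * in_beta (Q i)
  + t ^+ 3 * in_beta g.

(* The fractal family is M = R0[t][alpha] / fractal_ideal, with R0 = k[beta] / F_y^perp. *)
Definition fractal_ideal : {mpoly {poly R0}[6]} -> Prop :=
  ideal_gen (fun p => (exists2 f, perp F f & p = in_alpha f) \/ p = Gamma).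

End Fractal.

Arguments fractal_ideal {k F} hF g Q.

Section Presentation.
Variables (k : fieldType) (F : {mpoly k[6]}) (B : comAlgType k).
Variable xi : {mpoly {poly B}[6]} -> Prop.

(* b lies in B_m: b(l . v) = l^m b(v) for every A-point v of V and l in A,
   where A^1 acts on V by (l . psi)(t) = psi(l t), and the points v, l . v are
   given by chi, chi' : B -> A. *)
Definition in_weight (m : nat) (b : B) : Prop :=
  forall (A : comAlgType k) (chi chi' : {lrmorphism B -> A}) (l : A),
    eq_ideal (spike_map chi' xi)
             (base_change (comp_poly (l *: 'X)) (spike_map chi xi)) ->
    chi' b = l ^+ m * chi b.

Definition max_ideal (b : B) : Prop :=
  exists (r : nat) (d : 'I_r -> nat) (c : 'I_r -> B),
    (forall i, (0 < d i)%N /\ in_weight (d i) (c i)) /\ b = \sum_i c i.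

Definition max_ideal_sq (b : B) : Prop :=
  exists (r : nat) (c c' : 'I_r -> B),
    (forall i, max_ideal (c i) /\ max_ideal (c' i)) /\ b = \sum_i c i * c' i.

(* k[eps] with eps^2 = 0 is {poly %/ 'X^2}, and eps is 'qX. *)
Definition tangent_ideal (delta : {mpoly k[6]} -> {mpoly k[6]}) :
    {mpoly {poly %/ 'X^2 : {poly k}}[6]} -> Prop :=
  let toD := map_mpoly (in_alg {poly %/ 'X^2 : {poly k}}) in
  ideal_gen (fun p => exists2 f, trunc_ideal F f &
    p = toD f - ('qX : {poly %/ 'X^2 : {poly k}}) *: toD (delta f)).

(* chi : B -> k[eps] is the tangent vector of V at [I] whose image in
   T_[I] H = Hom_S(I, S/I), under restriction to t = 1, is delta. *)
Definition is_tangent (chi : {lrmorphism B -> {poly %/ 'X^2 : {poly k}}})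
    (delta : {mpoly k[6]} -> {mpoly k[6]}) : Prop :=
  eq_ideal (value_at idfun 1 (spike_map chi xi)) (tangent_ideal delta).

(* frakx represents the homomorphism I -> S/I with (F^perp)_2 |-> 0 and
   g |-> q. *)
Definition is_frakx (g q : {mpoly k[6]})
    (frakx : {mpoly k[6]} -> {mpoly k[6]}) : Prop :=
  [/\ is_hom (trunc_ideal F) (trunc_ideal F) frakx,
      forall f, perp F f -> f \is 2.-homog -> trunc_ideal F (frakx f)
    & trunc_ideal F (frakx g - q)].

Definition fraky (frakx : 'I_6 -> {mpoly k[6]} -> {mpoly k[6]}) (i : 'I_6)
    (f : {mpoly k[6]}) : {mpoly k[6]} :=
  frakx i f - 13%:R^-1 *: f^`M(i).

(* The y_i are homogeneous elements of the ideal m whose classes form the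
   basis of m/m^2 dual to delta_0, ..., delta_5. *)
Definition dual_coordinates (delta : 'I_6 -> {mpoly k[6]} -> {mpoly k[6]})
    (y : 'I_6 -> B) : Prop :=
  [/\ forall i, max_ideal (y i) /\ exists d, in_weight d (y i),
      forall b, max_ideal b ->
        exists c : 'I_6 -> k, max_ideal_sq (b - \sum_i c i *: y i),
      forall c : 'I_6 -> k, max_ideal_sq (\sum_i c i *: y i) ->
        forall i, c i = 0
    & forall j (chi : {lrmorphism B -> {poly %/ 'X^2 : {poly k}}}),
        is_tangent chi (delta j) ->
        forall i, chi (y i) = (if i == j then 'qX else 0)].

End Presentation.

Definition presentation_kernel (k : fieldType) (B : comAlgType k)
    (y : 'I_6 -> B) (h : {mpoly k[6]}) : Prop :=
  mmap (in_alg B) y h = 0.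

(* Main.v *)
Require Import Defs.
From HB Require Import structures.
From mathcomp Require Import all_boot all_order all_algebra.
From mathcomp Require Import ring_quotient qpoly ssrcomplements mpoly ring.

Set Implicit Arguments.
Unset Strict Implicit.
Unset Printing Implicit Defensive.

Import GRing.Theory.
Local Open Scope ring_scope.

(** The apolar algebra [R0 = k[beta] / perp F] has the basis [1], [beta_i],
    [Q_i(beta)], [g(beta)], so a morphism from [R0] to a [k]-algebra [A] is a
    triple [(b, c, d)] of images of [beta_i], [Q_i], [g] that satisfies the
    multiplication table of this basis ([apolar_point]). The same equations say
    that [perp F] and [g + b.Q + c.alpha + d] generate an ideal whose quotient
    is free of rank thirteen with basis [1], [alpha_i], [Q_i]
    ([deformed_ideal_ideal], [deformed_gen], [deformed_free]). Multiplication by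
    [alpha_j] on this quotient has trace [- b_j] ([deformed_trace]), so a
    translation by [b / 13] centers it. With [(t b, t^2 c, t^3 d)] in place of
    [(b, c, d)] this gives a spike over [A] ([family_spike]); the universal
    triple gives the centering of the fractal family ([fractal_centering]).

    It remains to see that every spike [J] over [A] arises from exactly one
    triple. Equivariance makes [J] homogeneous for the grading in which [t] and
    the [alpha_i] have degree one ([weight_part_mem]), flatness makes it free of
    [t]-torsion ([hilb13_torsion_free]), and its fibre at [t = 0] is [[I]].
    Hence a quadric [q] of [perp F] lifts to an element [q + t l + t^2 c] of
    [J], with [l] linear and [c] constant. Linear syzygies between the quadrics
    generate all their syzygies, and dividing the induced relations by [t] shows
    that the parts [l] define a homomorphism of degree [-1] from [perp F] to its
    quotient ring. The homomorphisms of negative degree form a space of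
    dimension six, which is spanned by the partial derivatives, because no
    constant vector field kills all the quadrics ([no_invariant_direction]). So
    after a translation by multiples of [t] all the [l] vanish. The [c] then
    define a homomorphism of degree [-2], which is zero, and the translated
    ideal contains [perp F] ([fd_translate_perp]). It also contains a homogeneous
    lift [g + t b.Q + t^2 c.alpha + t^3 d] of [g], and the multiples of this
    element by the [alpha_j] give the equations of [apolar_point] ([fd_point]).
    The condition on the barycenter determines the translation
    ([spike_is_family]). The triple is unique because the ideal of a spike
    remembers the translation of the quadrics ([family_inj]). Therefore the
    centered fractal family is universal ([universal_spike_iso]).

    For the presentation of [V], the coordinate ring [B] embeds into [R0]. The
    tangent vector [fraky_j], as a first order deformation of [I], is the family
    of the morphism [beta_i |-> - delta_ij eps] ([tangent_centered]). Thus the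
    homogeneous dual coordinates [y_i] are the elements [- beta_i]
    ([coordinate_value]), and a relation between them is a polynomial [h] with
    [h(- alpha)] in [perp F]. As [perp F] is homogeneous, this means that [h] is
    in [perp F]. *)

(** * Ideals, ring extensions and affine substitutions *)

Lemma ideal_mull (P : comNzRingType) (J : P -> Prop) p q :
  is_ideal J -> J q -> J (p * q).
Proof. by case=> _ _; apply. Qed.

Lemma ideal_add (P : comNzRingType) (J : P -> Prop) p q :
  is_ideal J -> J p -> J q -> J (p + q).
Proof. by case=> _ + _; apply. Qed.

Lemma ideal_opp (P : comNzRingType) (J : P -> Prop) p :
  is_ideal J -> J p -> J (- p).
Proof. by move=> iJ Jp; rewrite -mulN1r; apply: ideal_mull. Qed.

Lemma ideal_sub (P : comNzRingType) (J : P -> Prop) p q :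
  is_ideal J -> J p -> J q -> J (p - q).
Proof. by move=> iJ Jp Jq; apply: ideal_add => //; apply: ideal_opp. Qed.

Lemma ideal_sum (P : comNzRingType) (J : P -> Prop) (I : Type) (s : seq I)
    (G : I -> P) :
  is_ideal J -> (forall i, J (G i)) -> J (\sum_(i <- s) G i).
Proof.
move=> iJ JG; elim/big_rec: _ => [|i p _ Jp]; first by case: iJ.
exact: ideal_add.
Qed.

Lemma ideal_scale (R : comNzRingType) (J : {mpoly R[6]} -> Prop) c p :
  is_ideal J -> J p -> J (c *: p).
Proof. by move=> iJ Jp; rewrite -mul_mpolyC; apply: ideal_mull. Qed.

Lemma ideal_genP (P : comNzRingType) (G : P -> Prop) : is_ideal (ideal_gen G).
Proof.
split=> [|p q [r [c [h [Gh ->]]]] [r' [c' [h' [Gh' ->]]]]|p q].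
- exists 0%N, (fun=> 0), (fun=> 0); split=> [[]//|]; by rewrite big_ord0.
- exists (r + r')%N, (fun i => match split i with inl i => c i | inr i => c' i end),
    (fun i => match split i with inl i => h i | inr i => h' i end).
  split=> [i|]; first by case: (split i).
  rewrite big_split_ord /=; congr (_ + _); apply: eq_bigr => i _.
    by rewrite (unsplitK (inl i)).
  by rewrite (unsplitK (inr i)).
case=> r [c [h [Gh ->]]]; exists r, (fun i => p * c i), h; split=> //.
by rewrite mulr_sumr; apply: eq_bigr => i _; rewrite mulrA.
Qed.

Lemma mem_ideal_gen (P : comNzRingType) (G : P -> Prop) p : G p -> ideal_gen G p.
Proof.
by move=> Gp; exists 1%N, (fun=> 1), (fun=> p); rewrite big_ord1 mul1r.
Qed.

Lemma ideal_gen_sub (P : comNzRingType) (G J : P -> Prop) :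
  is_ideal J -> (forall p, G p -> J p) -> forall p, ideal_gen G p -> J p.
Proof.
move=> iJ GJ p [r [c [h [Gh ->]]]]; apply: ideal_sum => // i.
by apply: ideal_mull => //; apply: GJ.
Qed.

Lemma eq_ideal_sym (P : Type) (J J' : P -> Prop) : eq_ideal J J' -> eq_ideal J' J.
Proof. by move=> e p; split=> /e. Qed.

Lemma eq_ideal_trans (P : Type) (J2 J1 J3 : P -> Prop) :
  eq_ideal J1 J2 -> eq_ideal J2 J3 -> eq_ideal J1 J3.
Proof. by move=> e e' p; split=> [/e /e'|/e' /e]. Qed.

Lemma base_change_ideal (R R' : comNzRingType) (rho : R -> R') J :
  is_ideal (base_change rho J).
Proof. exact: ideal_genP. Qed.

Lemma mem_base_change (R R' : comNzRingType) (rho : R -> R')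
    (J : {mpoly R[6]} -> Prop) f : J f -> base_change rho J (map_mpoly rho f).
Proof. by move=> Jf; apply: mem_ideal_gen; exists f. Qed.

Lemma base_change_sub (R R' : comNzRingType) (rho : R -> R') J J' :
  is_ideal J' -> (forall f, J f -> J' (map_mpoly rho f)) ->
  forall p, base_change rho J p -> J' p.
Proof. by move=> iJ' h; apply: ideal_gen_sub => // p [f Jf ->]; apply: h. Qed.

Lemma eq_base_change (R R' : comNzRingType) (rho rho' : R -> R') J J' :
  rho =1 rho' -> eq_ideal J J' ->
  eq_ideal (base_change rho J) (base_change rho' J').
Proof.
move=> er eJ.
have em f : map_mpoly rho f = map_mpoly rho' f.
  by rewrite /map_mpoly /mmap; apply: eq_bigr => m _ /=; rewrite er.
move=> p; split; apply: base_change_sub => [|f]; try exact: base_change_ideal.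
  by move=> /eJ; rewrite em; apply: mem_base_change.
by move=> /eJ; rewrite -em; apply: mem_base_change.
Qed.

Lemma map_mpoly_compE (R S T : comNzRingType) (rho : {rmorphism R -> S})
    (rho' : {rmorphism S -> T}) (sigma : {rmorphism R -> T}) (p : {mpoly R[6]}) :
  sigma =1 rho' \o rho -> map_mpoly sigma p = map_mpoly rho' (map_mpoly rho p).
Proof.
by move=> e; apply/mpolyP => m; rewrite !mcoeff_map_mpoly [LHS]e.
Qed.

Lemma base_change_comp (R R' R'' : comNzRingType) (rho : {rmorphism R -> R'})
    (rho' : {rmorphism R' -> R''}) J :
  eq_ideal (base_change rho' (base_change rho J)) (base_change (rho' \o rho) J).
Proof.
have em f : map_mpoly rho' (map_mpoly rho f) = map_mpoly (rho' \o rho) f.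
  by apply/mpolyP => m; rewrite !mcoeff_map_mpoly.
move=> p; split; apply: base_change_sub => [|f]; try exact: base_change_ideal.
- move=> [r [c [h [Jh ->]]]]; rewrite rmorph_sum; apply: ideal_sum => [|i].
    exact: base_change_ideal.
  rewrite rmorphM; apply: ideal_mull; first exact: base_change_ideal.
  by have [f' Jf' ->] := Jh i; rewrite /= em; apply: mem_base_change.
- by move=> Jf; rewrite -em; do 2! apply: mem_base_change.
Qed.

Lemma base_change_id (R : comNzRingType) (rho : R -> R) J :
  rho =1 id -> is_ideal J -> eq_ideal (base_change rho J) J.
Proof.
move=> er iJ; apply: (eq_ideal_trans (J2 := base_change idfun J)).
  by apply: eq_base_change.
have em f : map_mpoly idfun f = f :> {mpoly R[6]}.
  by apply/mpolyP => m; rewrite mcoeff_map_mpoly.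
move=> p; split; last by rewrite -{2}[p]em; apply: mem_base_change.
by apply: base_change_sub => // f; rewrite em.
Qed.

Lemma mpoly_rmorph_ext (n : nat) (R S : comNzRingType)
    (f h : {rmorphism {mpoly R[n]} -> S}) :
  (forall c, f c%:MP = h c%:MP) -> (forall i, f 'X_i = h 'X_i) -> f =1 h.
Proof.
move=> eC eX p; rewrite [p]mpolyE !rmorph_sum; apply: eq_bigr => m _.
rewrite -mul_mpolyC !rmorphM eC; congr (_ * _).
rewrite mpolyXE_id !rmorph_prod; apply: eq_bigr => i _.
by rewrite !rmorphXn eX.
Qed.

(** A common generalisation of the substitutions of [translate] and [scale],
    which is closed under composition. *)
HB.lock Definition affine (R : comNzRingType) (a : R) (h : 'I_6 -> R)
    (p : {mpoly R[6]}) : {mpoly R[6]} :=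
  p \mPo [tuple a *: 'X_i + (h i)%:MP | i < 6].

Section Affine.
Variable R : comNzRingType.
Implicit Types (a b : R) (h : 'I_6 -> R) (p : {mpoly R[6]}).

Fact affine_zmod a h : zmod_morphism (affine a h).
Proof. by rewrite affine.unlock; apply: rmorphB. Qed.
Fact affine_monoid a h : monoid_morphism (affine a h).
Proof. by rewrite affine.unlock; split; [apply: rmorph1 | apply: rmorphM]. Qed.
HB.instance Definition _ a h :=
  GRing.isZmodMorphism.Build {mpoly R[6]} {mpoly R[6]} (affine a h) (affine_zmod a h).
HB.instance Definition _ a h :=
  GRing.isMonoidMorphism.Build {mpoly R[6]} {mpoly R[6]} (affine a h) (affine_monoid a h).

Lemma affineC a h c : affine a h c%:MP = c%:MP.
Proof. by rewrite affine.unlock comp_mpolyC. Qed.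

Lemma affineX a h i : affine a h 'X_i = a *: 'X_i + (h i)%:MP.
Proof. by rewrite affine.unlock comp_mpolyXU -tnth_nth tnth_mktuple. Qed.

Lemma affineZ a h c p : affine a h (c *: p) = c *: affine a h p.
Proof. by rewrite affine.unlock comp_mpolyZ. Qed.

Lemma eq_affine a h h' : h =1 h' -> affine a h =1 affine a h'.
Proof.
move=> e; apply: mpoly_rmorph_ext => [c|i]; first by rewrite /= !affineC.
by rewrite /= !affineX e.
Qed.

Lemma affine_comp a h b h' p :
  affine a h (affine b h' p) = affine (a * b) (fun i => b * h i + h' i) p.
Proof.
rewrite -[LHS]/((affine a h \o affine b h') p); apply: mpoly_rmorph_ext p.
  by move=> c; rewrite /= !affineC.
move=> i /=; rewrite !affineX rmorphD /= affineC affineZ affineX scalerDr scalerA.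
by rewrite mulrC -addrA; congr (_ + _); rewrite -mul_mpolyC mpolyCD mpolyCM.
Qed.

Lemma affine_id p : affine 1 (fun=> 0) p = p.
Proof.
rewrite -[RHS]/(idfun p); apply: mpoly_rmorph_ext p => [c|i] /=.
  by rewrite affineC.
by rewrite affineX scale1r mpolyC0 addr0.
Qed.

Lemma translateE h (J : {mpoly R[6]} -> Prop) p :
  translate h J p = J (affine 1 h p).
Proof.
rewrite /translate affine.unlock; congr (J (_ \mPo _)).
by apply: eq_from_tnth => i; rewrite !tnth_mktuple scale1r.
Qed.

Lemma scaleE a (J : {mpoly R[6]} -> Prop) p :
  scale a J p = J (affine a (fun=> 0) p).
Proof.
rewrite /scale affine.unlock; congr (J (_ \mPo _)).
by apply: eq_from_tnth => i; rewrite !tnth_mktuple mpolyC0 addr0.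
Qed.

Lemma translate_ideal h (J : {mpoly R[6]} -> Prop) :
  is_ideal J -> is_ideal (translate h J).
Proof.
move=> iJ; split=> [|p q|p q]; rewrite !translateE.
- by rewrite rmorph0; case: iJ.
- by move=> Jp Jq; rewrite rmorphD; apply: ideal_add.
- by move=> Jq; rewrite rmorphM; apply: ideal_mull.
Qed.

End Affine.

Lemma map_affine (R S : comNzRingType) (rho : {rmorphism R -> S}) a h p :
  map_mpoly rho (affine a h p) = affine (rho a) (rho \o h) (map_mpoly rho p).
Proof.
rewrite -[LHS]/((map_mpoly rho \o affine a h) p).
rewrite -[RHS]/((affine (rho a) (rho \o h) \o map_mpoly rho) p).
apply: mpoly_rmorph_ext p => [c|i] /=.
  by rewrite affineC map_mpolyC affineC.
by rewrite map_mpolyX !affineX rmorphD /= map_mpolyZ map_mpolyX map_mpolyC.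
Qed.

Lemma map_affine1 (R S : comNzRingType) (rho : {rmorphism R -> S}) h p :
  map_mpoly rho (affine 1 h p) = affine 1 (rho \o h) (map_mpoly rho p).
Proof. by rewrite map_affine (rmorph1 rho). Qed.

Lemma map_affine_scale (R : comNzRingType) (rho : {rmorphism R -> R}) a h p :
  (forall i, rho (h i) = a * h i) ->
  affine a (fun=> 0) (map_mpoly rho (affine 1 h p)) =
  affine 1 h (affine a (fun=> 0) (map_mpoly rho p)).
Proof.
move=> e; rewrite map_affine1 !affine_comp mulr1 !mul1r; apply: eq_affine => i.
by rewrite add0r addr0 /= e.
Qed.

Lemma base_change_translate (R S : comNzRingType) (rho : {rmorphism R -> S}) h J :
  eq_ideal (base_change rho (translate h J)) (translate (rho \o h) (base_change rho J)).
Proof.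
move=> p; split; last first.
  rewrite translateE => Jp.
  have -> : p = affine 1 (fun i => - rho (h i)) (affine 1 (rho \o h) p).
    rewrite affine_comp mulr1 -[LHS]affine_id; apply: eq_affine => i /=.
    by rewrite mul1r addNr.
  have [r [c [f [Jf ->]]]] := Jp.
  rewrite rmorph_sum; apply: ideal_sum => [|i]; first exact: base_change_ideal.
  rewrite rmorphM; apply: ideal_mull; first exact: base_change_ideal.
  have [f' Jf' ->] := Jf i.
  rewrite /= (eq_affine _ (h' := rho \o (fun i => - h i))).
    rewrite -map_affine1; apply: mem_base_change; rewrite translateE affine_comp mulr1.
    rewrite (eq_affine _ (h' := fun=> 0)) ?affine_id // => j.
    by rewrite mul1r addrN.
  by move=> j; rewrite /= rmorphN.
apply: base_change_sub => [|f]; first exact/translate_ideal/base_change_ideal.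
rewrite !translateE -map_affine1.
exact: mem_base_change.
Qed.

Lemma eq_translate (R : comNzRingType) (h h' : 'I_6 -> R) J J' :
  h =1 h' -> eq_ideal J J' -> eq_ideal (translate h J) (translate h' J').
Proof. by move=> e eJ p; rewrite !translateE (eq_affine _ e). Qed.

Lemma translate_comp (R : comNzRingType) (h h' : 'I_6 -> R) J :
  eq_ideal (translate h (translate h' J)) (translate (fun i => h i + h' i) J).
Proof.
move=> p; rewrite !translateE affine_comp mulr1.
by rewrite (eq_affine _ (h' := fun i => h i + h' i)) // => i; rewrite ?mul1r addrC.
Qed.

Lemma translate0 (R : comNzRingType) (J : {mpoly R[6]} -> Prop) :
  eq_ideal (translate (fun=> 0) J) J.
Proof. by move=> p; rewrite translateE affine_id. Qed.

(** * Functionals on polynomials obtained by extension of scalars *)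

(** The [R]-linear functional on [R[alpha]] that extends the [k]-linear
    functional taking the values [w m] on the monomials. *)
HB.lock Definition extend (k R : comNzRingType) (kappa : k -> R) (w : 'X_{1..6} -> k)
    (p : {mpoly R[6]}) : R :=
  \sum_(m <- msupp p) p@_m * kappa (w m).

Section Extend.
Variables (k R : comNzRingType) (kappa : {rmorphism k -> R}).
Implicit Types (w : 'X_{1..6} -> k) (p q : {mpoly R[6]}).

Lemma extend_widen w d p : (msize p <= d)%N ->
  extend kappa w p = \sum_(m : 'X_{1..6 < d}) p@_m * kappa (w m).
Proof.
move=> lpd; rewrite extend.unlock.
pose I : subFinType _ := 'X_{1..6 < d}.
rewrite (big_mksub I) ?msupp_uniq //=; first last.
  by move=> m /msize_mdeg_lt /leq_trans; apply.
rewrite big_rmcond //= => m /memN_msupp_eq0 ->.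
by rewrite mul0r.
Qed.

Lemma extend_is_linear w : linear_for *%R (extend kappa w).
Proof.
move=> c p q; pose d := maxn (msize (c *: p + q)) (maxn (msize p) (msize q)).
rewrite !(@extend_widen w d) ?leq_max ?leqnn ?orbT // mulr_sumr -big_split /=.
by apply: eq_bigr => m _; rewrite mcoeffD mcoeffZ mulrDl mulrA.
Qed.

HB.instance Definition _ w :=
  GRing.isLinear.Build R {mpoly R[6]} R *%R (extend kappa w) (extend_is_linear w).

Lemma extendZ w c p : extend kappa w (c *: p) = c * extend kappa w p.
Proof. exact: linearZ. Qed.

Lemma extend0 w : extend kappa w 0 = 0.
Proof. exact: raddf0. Qed.

Lemma extendD w p q : extend kappa w (p + q) = extend kappa w p + extend kappa w q.
Proof. exact: raddfD. Qed.

Lemma extendB w p q : extend kappa w (p - q) = extend kappa w p - extend kappa w q.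
Proof. exact: raddfB. Qed.

Lemma extend_mon w m : extend kappa w 'X_[m] = kappa (w m).
Proof. by rewrite extend.unlock msuppX big_seq1 mcoeffX eqxx mul1r. Qed.

Lemma extend_mulX w m p :
  extend kappa w ('X_[m] * p) = extend kappa (fun m' => w (m + m')%MM) p.
Proof.
rewrite {1}[p]mpolyE mulr_sumr raddf_sum [in RHS]extend.unlock.
apply: eq_bigr => m' _ /=; by rewrite -scalerAr -mpolyXD extendZ extend_mon.
Qed.

Lemma eq_extend w w' p : w =1 w' -> extend kappa w p = extend kappa w' p.
Proof. by move=> e; rewrite extend.unlock; apply: eq_bigr => m _; rewrite e. Qed.

Lemma extend_eq0 w p :
  {in msupp p, forall m, w m = 0} -> extend kappa w p = 0.
Proof.
by move=> w0; rewrite extend.unlock big_seq big1 // => m /w0 ->; rewrite rmorph0 mulr0.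
Qed.

Lemma extend_suml (I : finType) (c : I -> k) (w : I -> 'X_{1..6} -> k) p :
  extend kappa (fun m => \sum_l c l * w l m) p =
  \sum_l kappa (c l) * extend kappa (w l) p.
Proof.
rewrite extend.unlock; under eq_bigr do rewrite rmorph_sum mulr_sumr.
rewrite exchange_big /=; apply: eq_bigr => l _; rewrite mulr_sumr.
by apply: eq_bigr => m _; rewrite rmorphM mulrCA.
Qed.

Lemma extend_scalel c w p :
  extend kappa (fun m => c * w m) p = kappa c * extend kappa w p.
Proof.
rewrite extend.unlock mulr_sumr; apply: eq_bigr => m _.
by rewrite rmorphM mulrCA.
Qed.

Lemma extend_coef m p : extend kappa (fun m' => (m' == m)%:R) p = p@_m.
Proof.
rewrite extend.unlock [p in RHS]mpolyE raddf_sum; apply: eq_bigr => m' _ /=.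
by rewrite mcoeffZ mcoeffX rmorph_nat.
Qed.

End Extend.

Lemma extend_map (k R S : comNzRingType) (kappa : {rmorphism k -> R})
    (rho : {rmorphism R -> S}) (kappa' : {rmorphism k -> S}) w p :
  kappa' =1 rho \o kappa ->
  extend kappa' w (map_mpoly rho p) = rho (extend kappa w p).
Proof.
move=> e; rewrite {1}[p]mpolyE (raddf_sum (map_mpoly rho)) raddf_sum [in RHS]extend.unlock rmorph_sum.
apply: eq_bigr => m _ /=.
by rewrite map_mpolyZ map_mpolyX extendZ extend_mon e rmorphM.
Qed.

(** Homotheties act on a functional supported in degree [d] through the
    character [a ^ d]. *)
Lemma extend_homothety (k R : comNzRingType) (kappa : {rmorphism k -> R}) w d a p :
  (forall m, mdeg m != d -> w m = 0) ->
  extend kappa w (affine a (fun=> 0) p) = a ^+ d * extend kappa w p.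
Proof.
move=> wd; rewrite {1}[p]mpolyE (raddf_sum (affine a _)) raddf_sum [in RHS]extend.unlock mulr_sumr.
apply: eq_bigr => m _ /=.
rewrite affineZ extendZ mulrCA; congr (_ * _).
have -> : affine a (fun=> 0) 'X_[m] = a ^+ mdeg m *: 'X_[m].
  rewrite mpolyXE_id rmorph_prod mdegE.
  elim/big_rec3: _ => [|i x y z _ ->]; first by rewrite expr0 scale1r.
  rewrite rmorphXn /= affineX mpolyC0 addr0 exprZn exprD.
  by rewrite -scalerAl -scalerAr scalerA.
rewrite extendZ extend_mon.
by have [->//|/wd ->] := eqVneq (mdeg m) d; rewrite rmorph0 !mulr0.
Qed.

(** * Coordinates in the apolar algebra *)

Definition apolar_frame (k : fieldType) (F g : {mpoly k[6]})
    (Q : 'I_6 -> {mpoly k[6]}) : Prop :=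
  [/\ F \is 3.-homog, g \is 3.-homog, forall i, Q i \is 2.-homog,
      hook g F = 1 & forall i, hook (Q i) F = 'X_i].

(** The values on the monomials of the functionals that compute the
    coordinates, modulo [perp F], on [1], [alpha_i], [Q_i] and [g]. The last two
    evaluate [hook f F], because [hook g F = 1] and [hook (Q_i) F = x_i]. *)
HB.lock Definition wt1 (k : fieldType) (m : 'X_{1..6}) : k := (m == 0%MM)%:R.
HB.lock Definition wtX (k : fieldType) (i : 'I_6) (m : 'X_{1..6}) : k := (m == U_(i)%MM)%:R.
HB.lock Definition wtQ (k : fieldType) (F : {mpoly k[6]}) (i : 'I_6) (m : 'X_{1..6}) : k :=
  (F^`M[m])@_U_(i).
HB.lock Definition wtg (k : fieldType) (F : {mpoly k[6]}) (m : 'X_{1..6}) : k := (F^`M[m])@_0.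

(** The third partial derivatives of [F], which are the structure constants of
    the multiplication [S_1 * S_1 -> S_2] modulo [perp F]. *)
Definition cubic_form (k : fieldType) (F : {mpoly k[6]}) (i j l : 'I_6) : k :=
  wtQ F i (U_(j) + U_(l))%MM.

Section Coordinates.
Variables (k : fieldType) (F g : {mpoly k[6]}) (Q : 'I_6 -> {mpoly k[6]}).
Hypothesis frame : apolar_frame F g Q.

Lemma wtQE i m : wtQ F i m = wtg F (m + U_(i))%MM.
Proof.
rewrite wtQ.unlock wtg.unlock [in RHS]mderivmDm mderivmU1m mcoeff_mderiv add0m.
by rewrite mnm0E mulr1n.
Qed.

Lemma cubic_form_sym i j l : cubic_form F i j l = cubic_form F l j i.
Proof. by rewrite /cubic_form !wtQE -!addmA [(U_(l) + _)%MM]addmC. Qed.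

Lemma mcoeff_hook f n : (hook f F)@_n = extend idfun (fun m => (F^`M[m])@_n) f.
Proof. by rewrite extend.unlock raddf_sum; apply: eq_bigr => m _ /=; rewrite mcoeffZ. Qed.

Lemma cQ_hook i f : extend idfun (wtQ F i) f = (hook f F)@_U_(i).
Proof. by rewrite mcoeff_hook wtQ.unlock. Qed.

Lemma cg_hook f : extend idfun (wtg F) f = (hook f F)@_0.
Proof. by rewrite mcoeff_hook wtg.unlock. Qed.

Lemma wt1_supp m : mdeg m != 0%N -> wt1 k m = 0.
Proof. by rewrite wt1.unlock mdeg_eq0 => /negPf ->. Qed.

Lemma wtX_supp i m : mdeg m != 1%N -> wtX k i m = 0.
Proof. by rewrite wtX.unlock; have [->|//] := eqVneq m U_(i)%MM; rewrite mdeg1. Qed.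

Lemma wt1_0 : wt1 k 0%MM = 1.
Proof. by rewrite wt1.unlock eqxx. Qed.

Lemma wtX_U i j : wtX k i U_(j) = (j == i)%:R.
Proof. by rewrite wtX.unlock eq_mnm1. Qed.

Lemma mcoeff_partial m n : (mdeg m + mdeg n)%N != 3%N -> (F^`M[m])@_n = 0.
Proof.
case: frame => hF _ _ _ _ ne.
by rewrite mcoeff_mderivm (dhomog_nemf_coeff hF) ?mul0rn //= mdegD.
Qed.

Lemma wtQ_supp i m : mdeg m != 2%N -> wtQ F i m = 0.
Proof.
by move=> ne; rewrite wtQ.unlock; apply: mcoeff_partial; rewrite mdeg1 addn1 eqSS.
Qed.

Lemma wtg_supp m : mdeg m != 3%N -> wtg F m = 0.
Proof.
by move=> ne; rewrite wtg.unlock; apply: mcoeff_partial; rewrite mdeg0 addn0.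
Qed.

Section Ring.
Variables (R : comNzRingType) (kappa : {rmorphism k -> R}).
Implicit Types p : {mpoly R[6]}.

Local Notation c1 := (extend kappa (@wt1 k)).
Local Notation cX i := (extend kappa (@wtX k i)).
Local Notation cQ i := (extend kappa (wtQ F i)).
Local Notation cg := (extend kappa (wtg F)).

Lemma c1E p : c1 p = p@_0.
Proof. by rewrite wt1.unlock extend_coef. Qed.

Lemma cXE i p : cX i p = p@_U_(i).
Proof. by rewrite wtX.unlock extend_coef. Qed.

Lemma c1_mulX j p : c1 ('X_j * p) = 0.
Proof.
rewrite extend_mulX extend_eq0 // => m _.
by rewrite wt1_supp // mdegD mdeg1.
Qed.

Lemma cX_mulX i j p : cX i ('X_j * p) = (j == i)%:R * c1 p.
Proof.
rewrite extend_mulX -(rmorph_nat kappa) -extend_scalel; apply: eq_extend => m.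
rewrite wtX.unlock wt1.unlock; have [->|ne] := eqVneq m 0%MM.
  by rewrite addm0 eq_mnm1 mulr1.
rewrite mulr0; case: eqP => // e; case/eqP: ne; apply/eqP; rewrite -mdeg_eq0.
by rewrite -(eqn_add2l 1) -{1}(mdeg1 j) -mdegD e mdeg1.
Qed.

Lemma cQ_mulX i j p : cQ i ('X_j * p) = \sum_l kappa (cubic_form F i j l) * cX l p.
Proof.
rewrite extend_mulX -extend_suml; apply: eq_extend => m.
have [/mdeg1P[l /eqP ->]|ne] := boolP (mdeg m == 1%N).
  rewrite (bigD1 l) //= big1 ?addr0 => [|l' nl].
    by rewrite wtX_U eqxx mulr1.
  by rewrite wtX_U eq_sym (negPf nl) mulr0.
rewrite wtQ_supp ?mdegD ?mdeg1 ?eqSS // big1 // => l _.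
by rewrite wtX_supp ?mulr0.
Qed.

Lemma cg_mulX j p : cg ('X_j * p) = cQ j p.
Proof.
rewrite extend_mulX; apply: eq_extend => m.
by rewrite wtQE addmC.
Qed.

Definition combination (a : R) (b c : 'I_6 -> R) (d : R) : {mpoly R[6]} :=
  a%:MP + \sum_i b i *: 'X_i + \sum_i c i *: map_mpoly kappa (Q i)
  + d *: map_mpoly kappa g.

Lemma extend_homog w e d f :
  f \is d.-homog -> d != e -> (forall m, mdeg m != e -> w m = 0) ->
  extend kappa w (map_mpoly kappa f) = 0.
Proof.
move=> hf de we; rewrite (extend_map (kappa := idfun)) // extend_eq0 ?rmorph0 //.
by move=> m /(dhomog_mf hf) /= md; apply: we; rewrite md.
Qed.

Lemma cQ_Q i j : cQ i (map_mpoly kappa (Q j)) = (j == i)%:R.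
Proof.
case: frame => _ _ _ _ hQ; rewrite (extend_map (kappa := idfun)) //.
by rewrite cQ_hook hQ mcoeffXU rmorph_nat.
Qed.

Lemma cg_g : cg (map_mpoly kappa g) = 1.
Proof.
case: frame => _ _ _ hg _; rewrite (extend_map (kappa := idfun)) //.
by rewrite cg_hook hg mcoeff1 eqxx rmorph1.
Qed.

Lemma extend_combination w a b c d :
  extend kappa w (combination a b c d) =
  a * kappa (w 0%MM) + \sum_i b i * kappa (w U_(i)%MM)
  + \sum_i c i * extend kappa w (map_mpoly kappa (Q i))
  + d * extend kappa w (map_mpoly kappa g).
Proof.
rewrite /combination !extendD !extendZ; congr (_ + _ + _ + _).
- by rewrite -[a%:MP]mulr1 mul_mpolyC extendZ -mpolyX0 extend_mon.
- by rewrite raddf_sum; apply: eq_bigr => i _ /=; rewrite extendZ extend_mon.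
- by rewrite raddf_sum; apply: eq_bigr => i _ /=; rewrite extendZ.
Qed.

Lemma sum_delta (b : 'I_6 -> R) (e : 'I_6 -> R) i :
  (forall j, e j = (j == i)%:R) -> \sum_j b j * e j = b i.
Proof.
move=> ee; rewrite (bigD1 i) //= ee eqxx mulr1 big1 ?addr0 // => j /negPf ji.
by rewrite ee ji mulr0.
Qed.

Lemma sum_mul0 (b e : 'I_6 -> R) : (forall j, e j = 0) -> \sum_j b j * e j = 0.
Proof. by move=> e0; rewrite big1 // => j _; rewrite e0 mulr0. Qed.

Lemma c1_combination a b c d : c1 (combination a b c d) = a.
Proof.
case: frame => _ hg hQ _ _; rewrite extend_combination wt1_0 rmorph1 mulr1.
rewrite sum_mul0 => [|j]; last by rewrite wt1_supp ?mdeg1 ?rmorph0.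
rewrite sum_mul0 => [|j]; last exact: extend_homog (hQ j) _ wt1_supp.
by rewrite (extend_homog hg _ wt1_supp) // mulr0 !addr0.
Qed.

Lemma cX_combination i a b c d : cX i (combination a b c d) = b i.
Proof.
case: frame => _ hg hQ _ _; rewrite extend_combination.
rewrite wtX_supp ?mdeg0 // rmorph0 mulr0 add0r.
rewrite (sum_delta _ (i := i)) => [|j]; last by rewrite wtX_U rmorph_nat.
rewrite sum_mul0 => [|j]; last exact: extend_homog (hQ j) _ (wtX_supp i).
by rewrite (extend_homog hg _ (wtX_supp i)) // mulr0 !addr0.
Qed.

Lemma cQ_combination i a b c d : cQ i (combination a b c d) = c i.
Proof.
case: frame => _ hg hQ _ _; rewrite extend_combination wtQ_supp ?mdeg0 //.
rewrite sum_mul0 => [|j]; last by rewrite wtQ_supp ?mdeg1 ?rmorph0.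
rewrite (sum_delta _ (i := i)) => [|j]; last by rewrite cQ_Q.
by rewrite (extend_homog hg _ (wtQ_supp i)) // rmorph0 !mulr0 !add0r addr0.
Qed.

Lemma cg_combination a b c d : cg (combination a b c d) = d.
Proof.
case: frame => _ hg hQ _ _; rewrite extend_combination wtg_supp ?mdeg0 //.
rewrite sum_mul0 => [|j]; last by rewrite wtg_supp ?mdeg1 ?rmorph0.
rewrite sum_mul0 => [|j]; last exact: extend_homog (hQ j) _ wtg_supp.
by rewrite cg_g rmorph0 mulr0 mulr1 !add0r.
Qed.

Definition coordsE := (c1_combination, cX_combination, cQ_combination, cg_combination).

Definition normal_form p : {mpoly R[6]} :=
  combination (c1 p) (fun i => cX i p) (fun i => cQ i p) (cg p).

Definition apolar_over p : Prop :=
  [/\ c1 p = 0, forall i, cX i p = 0, forall i, cQ i p = 0 & cg p = 0].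

(** Multiplication by the variables is all that has to be checked, since the
    monomials generate. *)
Lemma mulX_ideal (J : {mpoly R[6]} -> Prop) :
  J 0 -> (forall p q, J p -> J q -> J (p + q)) -> (forall c p, J p -> J (c *: p)) ->
  (forall j p, J p -> J ('X_j * p)) -> is_ideal J.
Proof.
move=> J0 JD JZ JX; split=> // p q Jq.
rewrite [p]mpolyE mulr_suml; elim/big_rec: _ => [//|m x _ Jx].
apply: JD => //; rewrite -scalerAl; apply: JZ.
rewrite mpolyXE_id; elim/big_rec: _ => [|i y _ Jy]; first by rewrite mul1r.
by rewrite -mulrA; elim: (m i) => [|n ih]; rewrite ?mul1r // exprS -mulrA; apply: JX.
Qed.

Lemma apolar_over_ideal : is_ideal apolar_over.
Proof.
apply: mulX_ideal => [|p q [p1 pX pQ pg] [q1 qX qQ qg]|c p [p1 pX pQ pg]|j p [p1 pX pQ pg]].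
- by split=> [|i|i|]; rewrite extend0.
- by split=> [|i|i|]; rewrite extendD ?p1 ?q1 ?pX ?qX ?pQ ?qQ ?pg ?qg addr0.
- by split=> [|i|i|]; rewrite extendZ ?p1 ?pX ?pQ ?pg mulr0.
split=> [|i|i|].
- exact: c1_mulX.
- by rewrite cX_mulX p1 mulr0.
- by rewrite cQ_mulX sum_mul0.
- by rewrite cg_mulX.
Qed.

End Ring.

Lemma hook_1r (f : {mpoly k[6]}) : (hook f 1)@_0 = f@_0.
Proof.
rewrite raddf_sum [f in RHS]mpolyE raddf_sum; apply: eq_bigr => m _ /=.
rewrite !mcoeffZ mcoeffX mcoeff_mderivm mcoeff1 addm0.
have [->|] := eqVneq m 0%MM; last by rewrite mul0rn.
by rewrite big1 // => i _; rewrite mnm0E ffactn0.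
Qed.

Lemma hook_Xr (f : {mpoly k[6]}) i : (hook f 'X_i)@_0 = f@_U_(i).
Proof.
rewrite raddf_sum [f in RHS]mpolyE raddf_sum; apply: eq_bigr => m _ /=.
rewrite !mcoeffZ mcoeffX mcoeff_mderivm mcoeffX addm0 eq_sym.
have [->|] := eqVneq m U_(i)%MM; last by rewrite mul0rn.
by rewrite big1 // => j _; rewrite mnm1E; case: eqP => _; rewrite ffactnn.
Qed.

(** The polynomial [hook f F] determines all the coordinates of [f]: those on
    [1] and [alpha_i] are the constant terms of [hook (g f) F] and
    [hook (Q_i f) F]. Conversely its coefficients of degree at least two only
    involve the coefficients of [f] of degree at most one. *)
Lemma perpE f : perp F f <-> apolar_over (idfun : k -> k) f.
Proof.
case: frame => hF _ _ hg hQ; split=> [pf|[p1 pX pQ pg]].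
  split=> [|i|i|].
  - by rewrite c1E -hook_1r -hg -hookM mulrC hookM pf hook0r mcoeff0.
  - by rewrite cXE -hook_Xr -hQ -hookM mulrC hookM pf hook0r mcoeff0.
  - by rewrite cQ_hook pf mcoeff0.
  - by rewrite cg_hook pf mcoeff0.
apply/mpolyP => n; rewrite mcoeff0.
have [|n0] := eqVneq (mdeg n) 0%N.
  by move/eqP; rewrite mdeg_eq0 => /eqP ->; rewrite -cg_hook.
have [/eqP/mdeg1P[i /eqP ->]|n1] := eqVneq (mdeg n) 1%N; first by rewrite -cQ_hook.
rewrite mcoeff_hook extend_eq0 // => m mf; apply: mcoeff_partial.
have m0 : mdeg m != 0%N.
  by apply: contraTneq mf => /eqP; rewrite mdeg_eq0 mcoeff_msupp negbK => /eqP ->;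
     rewrite -p1 c1E.
have m1 : mdeg m != 1%N.
  apply: contraTneq mf => /eqP /mdeg1P[i /eqP ->]; rewrite mcoeff_msupp negbK.
  by rewrite -(pX i) cXE.
by case: (mdeg m) (mdeg n) m0 m1 n0 n1 => [|[|?]] [|[|?]] //; rewrite !addSn !addnS.
Qed.

Lemma map_combination (R S : comNzRingType) (kappa : {rmorphism k -> R})
    (rho : {rmorphism R -> S}) (kappa' : {rmorphism k -> S}) a b c d :
  kappa' =1 rho \o kappa ->
  map_mpoly rho (combination kappa a b c d) =
  combination kappa' (rho a) (rho \o b) (rho \o c) (rho d).
Proof.
move=> e.
have em f : map_mpoly rho (map_mpoly kappa f) = map_mpoly kappa' f.
  by apply/mpolyP => m; rewrite !mcoeff_map_mpoly [RHS]e.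
rewrite /combination !rmorphD /= map_mpolyC map_mpolyZ em !rmorph_sum.
congr (_ + _ + _ + _); apply: eq_bigr => i _ /=; rewrite map_mpolyZ ?em //.
by rewrite map_mpolyX.
Qed.

Section Generators.
Variables (R : comNzRingType) (kappa : {rmorphism k -> R}).
Implicit Types p : {mpoly R[6]}.

Lemma perp_apolar_over f : perp F f -> apolar_over kappa (map_mpoly kappa f).
Proof.
case/perpE=> f1 fX fQ fg; split=> [|i|i|]; rewrite (extend_map (kappa := idfun)) //.
- by rewrite f1 rmorph0.
- by rewrite fX rmorph0.
- by rewrite fQ rmorph0.
- by rewrite fg rmorph0.
Qed.

Lemma sub_normal_form_perp (f : {mpoly k[6]}) :
  perp F (f - normal_form (idfun : k -> k) f).
Proof.
by apply/perpE; split=> [|i|i|]; rewrite extendB coordsE subrr.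
Qed.

Lemma combination_lin c a1 b1 c1 d1 a2 b2 c2 d2 :
  combination kappa (c * a1 + a2) (fun i => c * b1 i + b2 i)
    (fun i => c * c1 i + c2 i) (c * d1 + d2) =
  c *: combination kappa a1 b1 c1 d1 + combination kappa a2 b2 c2 d2.
Proof.
have S (x y : 'I_6 -> R) (z : 'I_6 -> {mpoly R[6]}) :
    \sum_i (c * x i + y i) *: z i = c *: (\sum_i x i *: z i) + \sum_i y i *: z i.
  rewrite scaler_sumr -big_split; apply: eq_bigr => i _.
  by rewrite scalerDl scalerA.
rewrite /combination !S mpolyCD mpolyCM mul_mpolyC !scalerDr !scalerDl !scalerA.
by ring.
Qed.

Lemma eq_combination a b b' c c' d : b =1 b' -> c =1 c' ->
  combination kappa a b c d = combination kappa a b' c' d.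
Proof.
move=> eb ec; rewrite /combination.
by congr (_ + _ + _ + _); apply: eq_bigr => i _; rewrite ?eb ?ec.
Qed.

Lemma normal_form_lin c p q :
  normal_form kappa (c *: p + q) = c *: normal_form kappa p + normal_form kappa q.
Proof.
rewrite -combination_lin /normal_form !extendD !extendZ.
by apply: eq_combination => i; rewrite extendD extendZ.
Qed.

(** Both sides are linear in [p], so it suffices to treat monomials, which are
    defined over the ground field. *)
Lemma sub_normal_form p :
  base_change kappa (perp F) (p - normal_form kappa p).
Proof.
have iJ := @base_change_ideal _ _ kappa (perp F).
elim/mpolyind: p => [|c m p _ _ ih].
  have -> : normal_form kappa 0 = 0.
    rewrite /normal_form /combination !big1 => [|i _|i _]; last 2 first.
    - by rewrite raddf0 scale0r.
    - by rewrite raddf0 scale0r.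
    by rewrite !raddf0 scale0r !addr0.
  by rewrite subrr; case: iJ.
rewrite normal_form_lin opprD addrACA -scalerBr; apply: ideal_add => //.
apply: ideal_scale => //.
have -> : 'X_[m] - normal_form kappa 'X_[m] =
    map_mpoly kappa ('X_[m] - normal_form (idfun : k -> k) 'X_[m]).
  rewrite raddfB /= map_mpolyX /normal_form.
  rewrite (map_combination (kappa := idfun) (kappa' := kappa)) //.
  rewrite !extend_mon; congr (_ - _); apply: eq_combination => i /=;
  by rewrite !extend_mon.
exact/mem_base_change/sub_normal_form_perp.
Qed.

Lemma base_change_perpE p : base_change kappa (perp F) p <-> apolar_over kappa p.
Proof.
split; first exact: (base_change_sub (apolar_over_ideal kappa) perp_apolar_over).
case=> p1 pX pQ pg.
have -> : p = p - normal_form kappa p; last exact: sub_normal_form.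
rewrite /normal_form /combination p1 pg mpolyC0 scale0r !big1 ?addr0 ?subr0 //.
  by move=> i _; rewrite pQ scale0r.
by move=> i _; rewrite pX scale0r.
Qed.

End Generators.
End Coordinates.

(** * The barycenter of a free family *)

Section Barycenter.
Variables (R : comNzRingType) (J : {mpoly R[6]} -> Prop).
Hypothesis iJ : is_ideal J.
Implicit Types (b e : 'I_13 -> {mpoly R[6]}) (M N : 'M[R]_13).

Let eqJ p q := J (p - q).

Let eqJ_sym p q : eqJ p q -> eqJ q p.
Proof. by move=> h; rewrite /eqJ -opprB; apply: ideal_opp. Qed.

Let eqJ_trans q p r : eqJ p q -> eqJ q r -> eqJ p r.
Proof. by move=> h h'; rewrite /eqJ -(subrKA q); apply: ideal_add. Qed.

Let eqJ_scale c p q : eqJ p q -> eqJ (c *: p) (c *: q).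
Proof. by move=> h; rewrite /eqJ -scalerBr; apply: ideal_scale. Qed.

Definition row_comb M b (i : 'I_13) : {mpoly R[6]} := \sum_l M i l *: b l.

Lemma row_combM M N b i : row_comb (M *m N) b i = row_comb M (row_comb N b) i.
Proof.
rewrite /row_comb; under [RHS]eq_bigr do rewrite scaler_sumr.
rewrite exchange_big /=; apply: eq_bigr => l _; rewrite mxE scaler_suml.
by apply: eq_bigr => l' _; rewrite scalerA.
Qed.

Lemma row_combZ a M b i : row_comb (a *: M) b i = a *: row_comb M b i.
Proof.
by rewrite scaler_sumr; apply: eq_bigr => l _; rewrite mxE scalerA.
Qed.

Lemma row_combB M N b i : row_comb (M - N) b i = row_comb M b i - row_comb N b i.
Proof. by rewrite -sumrB; apply: eq_bigr => l _; rewrite !mxE scalerBl. Qed.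

Lemma row_comb1 a b i : row_comb a%:M b i = a *: b i.
Proof.
rewrite /row_comb (bigD1 i) //= mxE eqxx mulr1n big1 ?addr0 // => l li.
by rewrite mxE eq_sym (negPf li) scale0r.
Qed.

Lemma row_comb_mulX j M b i : 'X_j * row_comb M b i = row_comb M (fun l => 'X_j * b l) i.
Proof. by rewrite mulr_sumr; apply: eq_bigr => l _; rewrite -scalerAr. Qed.

Lemma row_combZr a M b i : row_comb M (fun l => a *: b l) i = a *: row_comb M b i.
Proof.
by rewrite scaler_sumr; apply: eq_bigr => l _; rewrite !scalerA [in RHS]mulrC.
Qed.

Let eqJ_comb M b b' i : (forall l, eqJ (b l) (b' l)) ->
  eqJ (row_comb M b i) (row_comb M b' i).
Proof.
move=> h; rewrite /eqJ -sumrB; apply: ideal_sum => // l.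
by rewrite -scalerBr; apply: ideal_scale => //; apply: h.
Qed.

Lemma common_exponent (P : 'I_13 -> nat -> Prop) :
  (forall i n m, P i n -> P i (n + m)%N) -> (forall i, exists n, P i n) ->
  exists n, forall i, P i n.
Proof.
move=> mono /fin_all_exists[f Pf]; exists (\sum_i f i)%N => i.
by rewrite (bigD1 i) //=; apply/mono/Pf.
Qed.

(** Over a localisation [R_s] two bases are related by mutually inverse
    matrices, so the trace of multiplication by [alpha_j] can be computed in
    any global basis. *)
Lemma is_bar_basis e (a : 'I_6 -> R) :
  (forall p, exists c : 'I_13 -> R, J (p - \sum_i c i *: e i)) ->
  (forall c : 'I_13 -> R, J (\sum_i c i *: e i) -> forall i, c i = 0) ->
  (forall j, exists T : 'M[R]_13, (forall i, J ('X_j * e i - \sum_l T i l *: e l)) /\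
     \tr T = 13%:R * a j) ->
  is_bar J a.
Proof.
move=> gen free mulX s b [bgen bfree] j n T hT.
have [T0 [hT0 trT0]] := mulX j.
have [c hc] := fin_all_exists (fun i => gen (b i)).
pose P := \matrix_(i, l) c i l.
have hP i : eqJ (b i) (row_comb P e i).
  by rewrite /row_comb; under eq_bigr do rewrite mxE; apply: hc.
have [m /fin_all_exists[c' hc']] : exists m, forall i, exists c : 'I_13 -> R,
    J (s ^+ m *: e i - \sum_l c l *: b l).
  apply: common_exponent => [i m m' [c' h]|i]; last exact: bgen.
  exists (fun l => s ^+ m' * c' l).
  have -> : s ^+ (m + m') *: e i - \sum_l (s ^+ m' * c' l) *: b l =
      s ^+ m' *: (s ^+ m *: e i - \sum_l c' l *: b l).
    rewrite scalerBr scalerA -exprD addnC scaler_sumr; congr (_ - _).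
    by apply: eq_bigr => l _; rewrite scalerA.
  exact: ideal_scale.
pose N := \matrix_(i, l) c' i l.
have hN i : eqJ (s ^+ m *: e i) (row_comb N b i).
  by rewrite /row_comb; under eq_bigr do rewrite mxE; apply: hc'.
have freeM M : (forall i, J (row_comb M e i)) -> M = 0.
  by move=> h; apply/matrixP => i l; rewrite mxE; apply: (free (M i) (h i)).
have NP : N *m P = (s ^+ m)%:M.
  apply/eqP; rewrite -subr_eq0; apply/eqP/freeM => i.
  rewrite row_combB row_comb1 row_combM -/(eqJ _ _).
  apply: eqJ_trans (eqJ_sym (hN i)).
  by apply: eqJ_comb => l; apply: eqJ_sym.
have TP : T *m P = s ^+ n *: (P *m T0).
  apply/eqP; rewrite -subr_eq0; apply/eqP/freeM => i.
  rewrite row_combB row_combZ !row_combM -/(eqJ _ _).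
  apply: (eqJ_trans (q := row_comb T b i)).
    by apply: eqJ_comb => l; apply: eqJ_sym.
  apply: (eqJ_trans (q := s ^+ n *: ('X_j * b i))); first exact: eqJ_sym.
  apply: eqJ_scale; apply: (eqJ_trans (q := 'X_j * row_comb P e i)).
    by rewrite /eqJ -mulrBr; apply: ideal_mull => //; apply: hP.
  by rewrite row_comb_mulX; apply: eqJ_comb.
have [n0 hn0] : exists n0, forall i, forall l, s ^+ n0 * (P *m N - (s ^+ m)%:M) i l = 0.
  apply: common_exponent => [i m1 m2 h l|i].
    by rewrite addnC exprD -mulrA h mulr0.
  apply: bfree; rewrite -/(row_comb _ b i) row_combB row_comb1 row_combM -/(eqJ _ _).
  apply: (eqJ_trans (q := s ^+ m *: row_comb P e i)); last first.
    by apply/eqJ_scale/eqJ_sym.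
  by rewrite -row_combZr; apply: eqJ_comb => l; apply: eqJ_sym.
have PN : s ^+ n0 *: (P *m N) = (s ^+ (n0 + m))%:M.
  apply/eqP; rewrite exprD -scale_scalar_mx -subr_eq0 -scalerBr.
  by apply/eqP/matrixP => i l; rewrite mxE hn0 mxE.
exists (n0 + m)%N; rewrite mulrBr -mxtraceZ -trT0.
have -> : s ^+ (n0 + m) *: T = s ^+ n0 *: ((s ^+ n *: (P *m T0)) *m N).
  by rewrite -TP -mulmxA scalemxAr PN mul_mx_scalar.
rewrite -scalemxAl !mxtraceZ mxtrace_mulC mulmxA NP mul_scalar_mx mxtraceZ exprD.
by apply/eqP; rewrite subr_eq0; apply/eqP; ring.
Qed.

Lemma basis_local_basis e :
  (forall p, exists c : 'I_13 -> R, J (p - \sum_i c i *: e i)) ->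
  (forall c : 'I_13 -> R, J (\sum_i c i *: e i) -> forall i, c i = 0) ->
  local_basis J 1 e.
Proof.
move=> gen free; split=> [p|c /free c0].
  by have [c hc] := gen p; exists 0%N, c; rewrite scale1r.
by exists 0%N => i; rewrite c0 mulr0.
Qed.

Lemma basis_hilb13 e : local_basis J 1 e -> hilb13 J.
Proof.
move=> be; split=> //; exists 1%N, (fun=> 1), (fun=> 1).
by rewrite big_ord1 mulr1; split=> // _; exists e.
Qed.

End Barycenter.

(** * Rank-thirteen quotients of the apolar algebra *)

Section Deformed.
Variables (k : fieldType) (F g : {mpoly k[6]}) (Q : 'I_6 -> {mpoly k[6]}).
Hypothesis frame : apolar_frame F g Q.

Section Ring.
Variables (R : comNzRingType) (kappa : {rmorphism k -> R}).
Implicit Types (B C h : 'I_6 -> R) (D : R) (p : {mpoly R[6]}).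

Local Notation c1 := (extend kappa (@wt1 k)).
Local Notation cX i := (extend kappa (@wtX k i)).
Local Notation cQ i := (extend kappa (wtQ F i)).
Local Notation cg := (extend kappa (wtg F)).

(** The multiplication table of the apolar algebra on the basis
    [1, beta_i, Q_i(beta), g(beta)]: a solution [(B, C, D)] is a morphism from
    this algebra to [R]. *)
Definition apolar_point B C D : Prop :=
  [/\ forall i j, B j * B i = \sum_l kappa (cubic_form F i j l) * C l,
      forall i j, B j * C i = (j == i)%:R * D & forall j, B j * D = 0].

(** The ideal generated by [perp F] and [g + B.Q + C.alpha + D], in
    coordinates. *)
Definition deformed_ideal B C D p : Prop :=
  [/\ c1 p = cg p * D, forall i, cX i p = cg p * C i & forall i, cQ i p = cg p * B i].

Lemma deformed_ideal_ideal B C D :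
  apolar_point B C D -> is_ideal (deformed_ideal B C D).
Proof.
case=> BB BC BD; apply: mulX_ideal => [|p q [p1 pX pQ] [q1 qX qQ]|c p [p1 pX pQ]|j p [p1 pX pQ]].
- by split=> [|i|i]; rewrite !extend0 mul0r.
- by split=> [|i|i]; rewrite !extendD mulrDl ?p1 ?pX ?pQ ?q1 ?qX ?qQ.
- by split=> [|i|i]; rewrite !extendZ -mulrA ?p1 ?pX ?pQ.
split=> [|i|i]; rewrite cg_mulX pQ.
- by rewrite c1_mulX -mulrA BD mulr0.
- by rewrite cX_mulX p1 -mulrA BC mulrCA.
rewrite (cQ_mulX frame) -mulrA BB mulr_sumr; apply: eq_bigr => l _.
by rewrite pX mulrCA.
Qed.

Lemma apolar_over_deformed B C D p :
  apolar_over F kappa p -> deformed_ideal B C D p.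
Proof. by case=> p1 pX pQ pg; split=> [|i|i]; rewrite pg mul0r. Qed.

Lemma deformed_idealE B C D : apolar_point B C D ->
  eq_ideal (ideal_gen (fun p => (exists2 f, perp F f & p = map_mpoly kappa f) \/
                                p = combination g Q kappa D C B 1))
           (deformed_ideal B C D).
Proof.
move=> pt p; split.
  apply: ideal_gen_sub p; first exact: deformed_ideal_ideal.
  move=> p [[f pf ->]|->].
    exact: apolar_over_deformed (perp_apolar_over frame _ pf).
  by split=> [|i|i]; rewrite !(coordsE frame) mul1r.
case=> p1 pX pQ; set G := fun _ => _ \/ _; have iJ := ideal_genP G.
rewrite -[p](subrK (cg p *: combination g Q kappa D C B 1)).
apply: (ideal_add iJ); last by apply: (ideal_scale _ iJ); apply: mem_ideal_gen; right.
apply: (@base_change_sub _ _ kappa (perp F)) => [//|f pf|].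
  by apply: mem_ideal_gen; left; exists f.
apply/(base_change_perpE frame); split=> [|i|i|]; rewrite extendB extendZ;
  rewrite !(coordsE frame) ?p1 ?pX ?pQ ?mulr1 subrr //.
Qed.

Definition idx1 : 'I_13 := @lshift 1 (6 + 6) ord0.
Definition idxX (a : 'I_6) : 'I_13 := @rshift 1 (6 + 6) (lshift 6 a).
Definition idxQ (b : 'I_6) : 'I_13 := @rshift 1 (6 + 6) (rshift 6 b).

Definition basis13 (i : 'I_13) : {mpoly R[6]} :=
  match split (i : 'I_(1 + (6 + 6))) with
  | inl _ => 1
  | inr i' => match split i' with inl a => 'X_a | inr b => map_mpoly kappa (Q b) end
  end.

Lemma sum13 (V : zmodType) (G : 'I_13 -> V) :
  \sum_i G i = G idx1 + \sum_a G (idxX a)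
               + \sum_b G (idxQ b).
Proof.
transitivity (\sum_(i < 1 + (6 + 6)) G i); first by [].
rewrite big_split_ord big_ord1 -addrA; congr (_ + _).
transitivity (\sum_(i < 6 + 6) G (rshift 1 i)); first by [].
by rewrite big_split_ord.
Qed.

Lemma basis13_1 : basis13 idx1 = 1.
Proof. by rewrite /basis13 (unsplitK (inl (ord0 : 'I_1))). Qed.

Lemma basis13_X a : basis13 (idxX a) = 'X_a.
Proof. by rewrite /basis13 (unsplitK (inr (lshift 6 a))) (unsplitK (inl a)). Qed.

Lemma basis13_Q b : basis13 (idxQ b) = map_mpoly kappa (Q b).
Proof. by rewrite /basis13 (unsplitK (inr (rshift 6 b))) (unsplitK (inr b)). Qed.

Lemma sum_basis13 (c : 'I_13 -> R) :
  \sum_i c i *: basis13 i =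
  combination g Q kappa (c idx1) (fun a => c (idxX a))
    (fun b => c (idxQ b)) 0.
Proof.
rewrite sum13 /combination basis13_1 scale0r addr0 -mul_mpolyC mulr1.
congr (_ + _ + _); apply: eq_bigr => i _; first by rewrite basis13_X.
by rewrite basis13_Q.
Qed.

Definition coords13 B C D p (i : 'I_13) : R :=
  match split (i : 'I_(1 + (6 + 6))) with
  | inl _ => c1 p - cg p * D
  | inr i' => match split i' with
              | inl a => cX a p - cg p * C a
              | inr b => cQ b p - cg p * B b
              end
  end.

Lemma coords13_1 B C D p : coords13 B C D p idx1 = c1 p - cg p * D.
Proof. by rewrite /coords13 (unsplitK (inl (ord0 : 'I_1))). Qed.

Lemma coords13_X B C D p a :
  coords13 B C D p (idxX a) = cX a p - cg p * C a.
Proof. by rewrite /coords13 (unsplitK (inr (lshift 6 a))) (unsplitK (inl a)). Qed.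

Lemma coords13_Q B C D p b :
  coords13 B C D p (idxQ b) = cQ b p - cg p * B b.
Proof. by rewrite /coords13 (unsplitK (inr (rshift 6 b))) (unsplitK (inr b)). Qed.

Lemma deformed_gen B C D p :
  deformed_ideal B C D (p - \sum_i coords13 B C D p i *: basis13 i).
Proof.
rewrite sum_basis13; split=> [|i|i]; rewrite !extendB !(coordsE frame) subr0.
- by rewrite coords13_1 subKr.
- by rewrite coords13_X subKr.
- by rewrite coords13_Q subKr.
Qed.

Lemma deformed_free B C D (c : 'I_13 -> R) :
  deformed_ideal B C D (\sum_i c i *: basis13 i) -> forall i, c i = 0.
Proof.
rewrite sum_basis13 => -[]; rewrite !(coordsE frame) mul0r => h1 hX hQ i.
rewrite -[i](splitK (m := 1) (n := 6 + 6)).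
case: (split _) => [z|i'] /=; first by rewrite (ord1 z) -[LHS]/(c idx1) h1.
rewrite -[i'](splitK (m := 6) (n := 6)); case: (split _) => [a|b] /=.
  by have := hX a; rewrite (coordsE frame) mul0r.
by have := hQ b; rewrite (coordsE frame) mul0r.
Qed.

(** Only the diagonal entries [alpha_j Q_j = g = - B_j Q_j + ...] contribute to
    the trace. *)
Lemma deformed_trace B C D j :
  \sum_i coords13 B C D ('X_j * basis13 i) i = - B j.
Proof.
case: (frame) => _ _ hQ _ _.
have c1X a : c1 'X_a = 0 by rewrite extend_mon wt1_supp ?mdeg1 ?rmorph0.
have cQX b a : cQ b 'X_a = 0 by rewrite extend_mon (wtQ_supp frame) ?mdeg1 ?rmorph0.
rewrite sum13 basis13_1 coords13_1 c1_mulX cg_mulX.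
rewrite -{1}mpolyX0 extend_mon (wtQ_supp frame) ?mdeg0 // rmorph0 mul0r subr0 add0r.
rewrite big1 ?add0r => [|a _]; last first.
  by rewrite basis13_X coords13_X cX_mulX c1X cg_mulX cQX mul0r mulr0 subr0.
rewrite (bigD1 j) //= big1 ?addr0 => [|b bj].
  rewrite basis13_Q coords13_Q (cQ_mulX frame) cg_mulX (cQ_Q frame) eqxx mul1r.
  rewrite sum_mul0 ?sub0r // => l; apply: (extend_homog (e := 1%N) _ (hQ j)) => // m; exact: wtX_supp.
rewrite basis13_Q coords13_Q (cQ_mulX frame) cg_mulX (cQ_Q frame).
rewrite (negPf bj) mul0r subr0.
by rewrite sum_mul0 // => l; apply: (extend_homog (e := 1%N) _ (hQ b)) => // m; exact: wtX_supp.
Qed.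

Section Translated.
Variables (B C h : 'I_6 -> R) (D : R).
Hypothesis pt : apolar_point B C D.

Definition translated_basis (i : 'I_13) : {mpoly R[6]} :=
  affine 1 (fun j => - h j) (basis13 i).

Lemma translated_basisK i : affine 1 h (translated_basis i) = basis13 i.
Proof.
rewrite affine_comp mulr1 -[RHS]affine_id; apply: eq_affine => j.
by rewrite mul1r subrr.
Qed.

Lemma affine_sum_basis (c : 'I_13 -> R) :
  affine 1 h (\sum_i c i *: translated_basis i) = \sum_i c i *: basis13 i.
Proof.
rewrite raddf_sum; apply: eq_bigr => i _.
by rewrite /= affineZ translated_basisK.
Qed.

Lemma translated_gen p : exists c : 'I_13 -> R,
  translate h (deformed_ideal B C D) (p - \sum_i c i *: translated_basis i).
Proof.
exists (coords13 B C D (affine 1 h p)).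
by rewrite translateE raddfB /= affine_sum_basis; apply: deformed_gen.
Qed.

Lemma translated_free (c : 'I_13 -> R) :
  translate h (deformed_ideal B C D) (\sum_i c i *: translated_basis i) ->
  forall i, c i = 0.
Proof. by rewrite translateE affine_sum_basis; apply: deformed_free. Qed.

Lemma translated_local_basis :
  local_basis (translate h (deformed_ideal B C D)) 1 translated_basis.
Proof.
apply: basis_local_basis; [exact: translated_gen | exact: translated_free].
Qed.

Lemma translated_mulX j : exists T : 'M[R]_13,
  (forall i, translate h (deformed_ideal B C D)
     ('X_j * translated_basis i - \sum_l T i l *: translated_basis l)) /\
  \tr T = 13%:R * h j - B j.
Proof.
exists (\matrix_(i, l) coords13 B C D ('X_j * basis13 i) l + (h j)%:M); split=> [i|].
  rewrite translateE rmorphB rmorphM /= affineX scale1r translated_basisK.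
  rewrite affine_sum_basis mulrDl.
  under eq_bigr do rewrite !mxE scalerDl.
  have -> : \sum_l (coords13 B C D ('X_j * basis13 i) l *: basis13 l +
      (h j *+ (i == l)) *: basis13 l) =
      \sum_l coords13 B C D ('X_j * basis13 i) l *: basis13 l + h j *: basis13 i.
    rewrite big_split /=; congr (_ + _); rewrite (bigD1 i) //= eqxx mulr1n.
    rewrite big1 ?addr0 // => l li.
    by rewrite eq_sym (negPf li) scale0r.
  by rewrite mul_mpolyC opprD addrACA subrr addr0; apply: deformed_gen.
rewrite mxtraceD mxtrace_scalar [RHS]addrC [in RHS]mulr_natl; congr (_ + _).
by rewrite -(deformed_trace B C D j); apply: eq_bigr => i _; rewrite mxE.
Qed.

End Translated.

Definition centered_ideal B C D : {mpoly R[6]} -> Prop :=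
  translate (fun i => kappa 13%:R^-1 * B i) (deformed_ideal B C D).

Lemma centered_ideal_ideal B C D :
  apolar_point B C D -> is_ideal (centered_ideal B C D).
Proof. by move=> pt; apply/translate_ideal/deformed_ideal_ideal. Qed.

Lemma centered_bar_zero B C D :
  13%:R != 0 :> k -> apolar_point B C D -> bar_zero (centered_ideal B C D).
Proof.
move=> k13 pt; have iJ := centered_ideal_ideal pt; split.
  by apply: basis_hilb13 => //; apply: translated_local_basis.
apply: (is_bar_basis iJ (@translated_gen _ _ _ _) (@translated_free _ _ _ _)) => j.
have [T [hT trT]] := translated_mulX B C (fun i => kappa 13%:R^-1 * B i) D j.
exists T; split=> //; rewrite trT mulr0 mulrA -(rmorph_nat kappa) -rmorphM.
by rewrite mulfV // rmorph1 mul1r subrr.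
Qed.

End Ring.
End Deformed.

(** * Functoriality of the centered families *)

Section Functoriality.
Variables (k : fieldType) (F g : {mpoly k[6]}) (Q : 'I_6 -> {mpoly k[6]}).
Hypothesis frame : apolar_frame F g Q.

Lemma trunc_idealE f : trunc_ideal F f <->
  [/\ f@_0 = 0, forall i, f@_U_(i) = 0 & forall i, extend idfun (wtQ F i) f = 0].
Proof.
split=> [[f1 [f2 [/(perpE frame)[p1 pX pQ _] f2d ->]]]|[f1 fX fQ]].
  have low m : (mdeg m < 3)%N -> f2@_m = 0.
    by rewrite ltnNge => h; apply/memN_msupp_eq0; apply: contra h; apply: f2d.
  split=> [|i|i]; first by rewrite mcoeffD low ?mdeg0 // addr0 -(c1E idfun).
    by rewrite mcoeffD low ?mdeg1 // addr0 -(cXE idfun).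
  rewrite raddfD /= pQ add0r extend_eq0 // => m /f2d d3.
  by rewrite (wtQ_supp frame) // gtn_eqF.
case: (frame) => _ hg _ _ _.
exists (f - extend idfun (wtg F) f *: g), (extend idfun (wtg F) f *: g).
split; last by rewrite subrK.
  apply/(perpE frame); have gE : g = map_mpoly idfun g.
    by apply/mpolyP => m; rewrite mcoeff_map_mpoly.
  have g0 e w : 3%N != e -> (forall m, mdeg m != e -> w m = 0) ->
      extend (idfun : k -> k) w g = 0.
    by move=> ne we; rewrite gE; apply: (extend_homog _ hg ne).
  split=> [|i|i|]; rewrite extendB extendZ.
  - by rewrite (g0 0%N) //; [rewrite mulr0 subr0 c1E | exact: wt1_supp].
  - by rewrite (g0 1%N) //; [rewrite mulr0 subr0 cXE | exact: wtX_supp].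
  - by rewrite (g0 2%N) //; [rewrite mulr0 subr0 | exact: (wtQ_supp frame)].
  - by rewrite [X in _ * extend _ _ X]gE (cg_g frame) mulr1 subrr.
by move=> m /msuppZ_le /(dhomog_mf hg) /= ->.
Qed.

Section OneRing.
Variables (R : comNzRingType) (kappa : {rmorphism k -> R}).
Implicit Types (B C : 'I_6 -> R) (D : R).

Lemma eq_deformed_ideal B B' C C' D D' : B =1 B' -> C =1 C' -> D = D' ->
  eq_ideal (deformed_ideal F kappa B C D) (deformed_ideal F kappa B' C' D').
Proof.
move=> eB eC <- p; split=> -[p1 pX pQ]; split=> // i.
- by rewrite pX eC.
- by rewrite pQ eB.
- by rewrite pX eC.
- by rewrite pQ eB.
Qed.

Lemma eq_centered_ideal B B' C C' D D' : B =1 B' -> C =1 C' -> D = D' ->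
  eq_ideal (centered_ideal F kappa B C D) (centered_ideal F kappa B' C' D').
Proof.
move=> eB eC eD; apply: eq_translate; last exact: eq_deformed_ideal.
by move=> i; rewrite /= eB.
Qed.

Lemma apolar_point_scale a B C D : apolar_point F kappa B C D ->
  apolar_point F kappa (fun i => a * B i) (fun i => a ^+ 2 * C i) (a ^+ 3 * D).
Proof.
case=> BB BC BD; split=> [i j|i j|j].
- rewrite mulrACA BB mulr_sumr; apply: eq_bigr => l _; by rewrite expr2 mulrCA.
- by rewrite mulrACA BC -exprS mulrCA.
- by rewrite mulrACA BD mulr0.
Qed.

(** The [G_m]-action on [alpha] scales the coefficients [B], [C], [D] of the
    generator with weights [1], [2], [3]. *)
Lemma centered_scale a a' B C D : a * a' = 1 ->
  eq_ideal (scale a (centered_ideal F kappa B C D))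
    (centered_ideal F kappa (fun i => a * B i) (fun i => a ^+ 2 * C i) (a ^+ 3 * D)).
Proof.
move=> aa' p; rewrite scaleE /centered_ideal !translateE affine_comp mul1r.
set q := affine 1 _ p.
have -> : affine a (fun i => a * (kappa 13%:R^-1 * B i) + 0) p = affine a (fun=> 0) q.
  rewrite affine_comp mulr1; apply: eq_affine => i.
  by rewrite mul1r add0r addr0 mulrCA.
have reg n x y : (a ^+ n * x = a ^+ n * y) -> x = y.
  move=> /(congr1 (fun z => a' ^+ n * z)); rewrite !mulrA -exprMn.
  by rewrite [a' * a]mulrC aa' expr1n !mul1r.
have h1 := extend_homothety kappa a q (@wt1_supp k).
have hg := extend_homothety kappa a q (wtg_supp frame).
have hX i := extend_homothety kappa a q (@wtX_supp k i).
have hQ i := extend_homothety kappa a q (wtQ_supp frame i).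
rewrite /deformed_ideal h1 hg mul1r.
split=> -[p1 pX pQ]; split=> [|i|i].
- by rewrite p1; ring.
- by apply: (reg 1%N); rewrite -hX pX; ring.
- by apply: (reg 2%N); rewrite -hQ pQ; ring.
- by rewrite p1; ring.
- by rewrite hX pX; ring.
- by rewrite hQ pQ; ring.
Qed.

Lemma apolar_point0 : apolar_point F kappa (fun=> 0) (fun=> 0) 0.
Proof.
split=> [i j|i j|j]; rewrite ?mulr0 // big1 // => l _.
by rewrite mulr0.
Qed.

Lemma deformed_ideal0 :
  eq_ideal (deformed_ideal F kappa (fun=> 0) (fun=> 0) 0)
           (base_change kappa (trunc_ideal F)).
Proof.
have pt := apolar_point0; move=> p; split.
  move/(deformed_idealE frame pt); apply: ideal_gen_sub.
    exact: base_change_ideal.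
  move=> {}p [[f pf ->]|->].
    apply: mem_base_change; exists f, 0; rewrite addr0; split=> // m.
    by rewrite mcoeff_msupp mcoeff0 eqxx.
  have -> : combination g Q kappa 0 (fun=> 0) (fun=> 0) 1 = map_mpoly kappa g.
    by rewrite /combination !big1 => [|i _|i _]; rewrite ?scale0r // scale1r !add0r.
  apply: mem_base_change; exists 0, g; case: frame => _ hg _ _ _.
  by split; rewrite ?add0r /perp ?hook0l // => m /(dhomog_mf hg) /= ->.
apply: base_change_sub; first exact (deformed_ideal_ideal frame pt).
move=> f /trunc_idealE[f1 fX fQ].
split=> [|i|i]; rewrite mulr0.
- by rewrite c1E mcoeff_map_mpoly f1 raddf0.
- by rewrite cXE mcoeff_map_mpoly fX raddf0.
- by rewrite (extend_map (kappa := idfun)) // fQ rmorph0.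
Qed.

Lemma centered_ideal0 :
  eq_ideal (centered_ideal F kappa (fun=> 0) (fun=> 0) 0)
           (base_change kappa (trunc_ideal F)).
Proof.
apply: eq_ideal_trans deformed_ideal0.
apply: (eq_ideal_trans _ (translate0 _)); apply: eq_translate => // i.
by rewrite mulr0.
Qed.

(** Evaluation at a point of the apolar algebra only sees the coordinates. *)
Lemma apolar_eval B C D f : apolar_point F kappa B C D ->
  mmap kappa B f =
  extend kappa (@wt1 k) (map_mpoly kappa f)
  + \sum_i extend kappa (@wtX k i) (map_mpoly kappa f) * B i
  + \sum_i extend kappa (wtQ F i) (map_mpoly kappa f) * C i
  + extend kappa (wtg F) (map_mpoly kappa f) * D.
Proof.
case=> BB BC BD.
pose L p := extend kappa (@wt1 k) p
  + \sum_i extend kappa (@wtX k i) p * B i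
  + \sum_i extend kappa (wtQ F i) p * C i + extend kappa (wtg F) p * D.
rewrite -[RHS]/(L (map_mpoly kappa f)).
have LD p q : L (p + q) = L p + L q.
  rewrite /L !extendD mulrDl.
  under [\sum_i _ in LHS]eq_bigr do rewrite extendD mulrDl.
  under [X in _ + _ + X + _]eq_bigr do rewrite extendD mulrDl.
  by rewrite !big_split /=; ring.
have LZ c p : L (c *: p) = c * L p.
  rewrite /L !extendZ !mulrDr !mulr_sumr; congr (_ + _ + _ + _).
- by apply: eq_bigr => i _; rewrite extendZ mulrA.
  - by apply: eq_bigr => i _; rewrite extendZ mulrA.
  - by rewrite mulrA.
have LX j p : L ('X_j * p) = B j * L p.
  have -> : L p = extend kappa (@wt1 k) p + \sum_i extend kappa (@wtX k i) p * B i
    + \sum_i extend kappa (wtQ F i) p * C i + extend kappa (wtg F) p * D by [].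
  have eX : B j * (\sum_i extend kappa (@wtX k i) p * B i) =
      \sum_i extend kappa (wtQ F i) ('X_j * p) * C i.
    under [RHS]eq_bigr do rewrite (cQ_mulX frame) mulr_suml.
    rewrite exchange_big mulr_sumr /=; apply: eq_bigr => l _.
    rewrite mulrCA BB mulr_sumr; apply: eq_bigr => i _.
    by rewrite (cubic_form_sym F) mulrA [_ * kappa _]mulrC.
  have eQ : B j * (\sum_i extend kappa (wtQ F i) p * C i) = extend kappa (wtQ F j) p * D.
    rewrite mulr_sumr (bigD1 j) //= mulrCA BC eqxx mul1r big1 ?addr0 // => i ij.
    by rewrite mulrCA BC eq_sym (negPf ij) mul0r mulr0.
  rewrite !mulrDr eX eQ mulrCA BD mulr0 addr0 /L c1_mulX cg_mulX add0r.
  congr (_ + _ + _); rewrite (bigD1 j) //= cX_mulX eqxx mul1r big1 => [|i ij].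
    by rewrite addr0 mulrC.
  by rewrite cX_mulX eq_sym (negPf ij) !mul0r.
have L1 : L 1 = 1.
  rewrite /L -mpolyX0 !extend_mon wt1_0 rmorph1 (wtg_supp frame) ?mdeg0 //.
  rewrite rmorph0 mul0r addr0 !big1 ?addr0 // => i _; rewrite extend_mon.
    by rewrite (wtQ_supp frame) ?mdeg0 // rmorph0 mul0r.
  by rewrite wtX_supp ?mdeg0 // rmorph0 mul0r.
rewrite [f in RHS]mpolyE (raddf_sum (map_mpoly kappa)).
have -> : mmap kappa B f = \sum_(m <- msupp f) kappa f@_m * mmap1 B m by [].
have L0 : L 0 = 0 by rewrite -(scale0r 0) LZ mul0r.
rewrite (big_morph L LD L0); apply: eq_bigr => m _ /=.
rewrite map_mpolyZ LZ map_mpolyX; congr (_ * _).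
rewrite mpolyXE_id /mmap1 -[\prod_(i < 6) 'X_i ^+ m i]mulr1.
elim/big_rec2: _ => [|i x p _ ->]; first by rewrite mul1r L1.
rewrite -!mulrA; elim: (m i) => [|n ih]; first by rewrite !mul1r.
by rewrite !exprS -!mulrA LX ih.
Qed.

End OneRing.

Section BaseChange.
Variables (R S : comNzRingType) (kappa : {rmorphism k -> R}) (rho : {rmorphism R -> S}).
Variable kappa' : {rmorphism k -> S}.
Hypothesis e : kappa' =1 rho \o kappa.
Implicit Types (B C : 'I_6 -> R) (D : R).

Lemma apolar_point_map B C D : apolar_point F kappa B C D ->
  apolar_point F kappa' (rho \o B) (rho \o C) (rho D).
Proof.
case=> BB BC BD; split=> [i j|i j|j] /=.
- by rewrite -rmorphM BB rmorph_sum; apply: eq_bigr => l _; rewrite rmorphM e.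
- by rewrite -rmorphM BC rmorphM rmorph_nat.
- by rewrite -rmorphM BD rmorph0.
Qed.

Lemma deformed_base_change B C D : apolar_point F kappa B C D ->
  eq_ideal (base_change rho (deformed_ideal F kappa B C D))
           (deformed_ideal F kappa' (rho \o B) (rho \o C) (rho D)).
Proof.
move=> pt; have pt' := apolar_point_map pt.
have em f : map_mpoly kappa' f = map_mpoly rho (map_mpoly kappa f).
  by apply/mpolyP => m; rewrite !mcoeff_map_mpoly [LHS]e.
move=> p; split.
  apply: base_change_sub; first exact (deformed_ideal_ideal frame pt').
  by move=> f [f1 fX fQ]; split=> [|i|i]; rewrite !(extend_map _ _ e) -rmorphM ?f1 ?fX ?fQ.
move/(deformed_idealE frame pt'); apply: ideal_gen_sub.
  exact: base_change_ideal.
move=> {}p [[f pf ->]|->].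
  by rewrite em; apply/mem_base_change/(deformed_idealE frame pt)/mem_ideal_gen; left; exists f.
rewrite -(rmorph1 rho) -(map_combination _ _ _ _ _ _ e).
by apply/mem_base_change/(deformed_idealE frame pt)/mem_ideal_gen; right.
Qed.

Lemma centered_base_change B C D : apolar_point F kappa B C D ->
  eq_ideal (base_change rho (centered_ideal F kappa B C D))
           (centered_ideal F kappa' (rho \o B) (rho \o C) (rho D)).
Proof.
move=> pt; apply: eq_ideal_trans (base_change_translate _ _ _) _.
apply: eq_translate; last exact: deformed_base_change.
by move=> i; rewrite /= rmorphM e.
Qed.

End BaseChange.
End Functoriality.

(** * Morphisms out of the apolar algebra *)

Lemma rmorph_mmap (k : fieldType) (A : comAlgType k)
    (phi : {rmorphism {mpoly k[6]} -> A}) f :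
  (forall c, phi c%:MP = in_alg A c) -> phi f = mmap (in_alg A) (fun i => phi 'X_i) f.
Proof.
move=> phiC; apply: mpoly_rmorph_ext f => [c|i] /=.
  by rewrite phiC mmapC.
by rewrite mmapX mmap1U.
Qed.

Section ApolarAlgebra.
Variables (k : fieldType) (F g : {mpoly k[6]}) (Q : 'I_6 -> {mpoly k[6]}).
Hypothesis frame : apolar_frame F g Q.
Variable F0 : F != 0.
Local Notation R0 := (apolar_algebra F0).
Local Notation pi := (apolar_pi F0).

Lemma apolar_pi_eq0 f : pi f = 0 <-> perp F f.
Proof.
rewrite -[0](rmorph0 pi); split=> [/eqP|pf].
  by rewrite -Quotient.idealrBE subr0 => /eqP.
by apply/eqP; rewrite -Quotient.idealrBE subr0; apply/eqP.
Qed.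

Lemma in_alg_apolar c : in_alg R0 c = pi c%:MP.
Proof. exact: mulr1. Qed.

Lemma apolar_piP (x : R0) : exists f, x = pi f.
Proof. by exists (repr x); rewrite /apolar_pi reprK. Qed.

Lemma apolar_lrmorph_mmap (A : comAlgType k) (phi : {lrmorphism R0 -> A}) f :
  phi (pi f) = mmap (in_alg A) (fun i => phi (pi 'X_i)) f.
Proof.
apply: (rmorph_mmap (phi := phi \o pi)) => c.
by rewrite /= -in_alg_apolar linearZ /= rmorph1.
Qed.

(** The tautological point of the apolar algebra: its equations hold because
    both sides have the same coordinates. *)
Lemma universal_point :
  apolar_point F (in_alg R0) (fun i => pi 'X_i) (fun i => pi (Q i)) (pi g).
Proof.
have z f h : perp F (f - h) -> pi f = pi h.
  by move/apolar_pi_eq0; rewrite rmorphB => /eqP; rewrite subr_eq0 => /eqP.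
case: (frame) => _ hg hQ _ _.
have e0 e d f w : f \is d.-homog -> d != e -> (forall m, mdeg m != e -> w m = 0) ->
    extend (idfun : k -> k) w f = 0.
  move=> hf de we; rewrite -[f](_ : map_mpoly idfun f = f).
    exact: extend_homog hf de we.
  by apply/mpolyP => m; rewrite mcoeff_map_mpoly.
have eQ i j : extend (idfun : k -> k) (wtQ F i) (Q j) = (j == i)%:R.
  by case: (frame) => _ _ _ _ h; rewrite cQ_hook h mcoeffXU.
have eg : extend (idfun : k -> k) (wtg F) g = 1.
  by case: (frame) => _ _ _ h _; rewrite cg_hook h mcoeff1 eqxx.
split=> [i j|i j|j].
- rewrite -rmorphM; rewrite (eq_bigr (fun l => pi ((cubic_form F i j l)%:MP * Q l))).
    2: by move=> l _; rewrite rmorphM; congr (_ * _); exact: in_alg_apolar.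
  rewrite -rmorph_sum; apply: z; apply/(perpE frame).
  have h w : extend (idfun : k -> k) w (\sum_l (cubic_form F i j l)%:MP * Q l) =
      \sum_l cubic_form F i j l * extend idfun w (Q l).
    by rewrite raddf_sum; apply: eq_bigr => l _; rewrite mul_mpolyC /= extendZ.
  split=> [|a|a|]; rewrite extendB h.
  + rewrite c1_mulX big1 ?subr0 // => l _.
    by rewrite (e0 0%N _ _ _ (hQ l)) ?mulr0 //; apply: wt1_supp.
  + rewrite cX_mulX extend_mon wt1_supp ?mdeg1 // mulr0 big1 ?subr0 // => l _.
    by rewrite (e0 1%N _ _ _ (hQ l)) ?mulr0 //; apply: wtX_supp.
  + rewrite (cQ_mulX frame) (bigD1 i) //= extend_mon wtX_U eqxx mulr1 big1 => [|l li].
      rewrite addr0 (bigD1 a) //= eQ eqxx mulr1 big1 => [|l la].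
        by rewrite addr0 (cubic_form_sym F) -(cubic_form_sym F) /cubic_form !wtQE
          -!addmA [(U_(i) + _)%MM]addmC subrr.
      by rewrite eQ (negPf la) mulr0.
    by rewrite extend_mon wtX_U eq_sym (negPf li) mulr0.
  + rewrite cg_mulX extend_mon (wtQ_supp frame) ?mdeg1 // sub0r big1 ?oppr0 // => l _.
    by rewrite (e0 3%N _ _ _ (hQ l)) ?mulr0 //; apply: (wtg_supp frame).
- rewrite -(rmorph_nat pi) -!rmorphM; apply: z; apply/(perpE frame).
  rewrite mulr_natl; split=> [|a|a|]; rewrite extendB raddfMn /=.
  + by rewrite c1_mulX (e0 0%N _ _ _ hg) ?mul0rn ?subr0 //; apply: wt1_supp.
  + rewrite cX_mulX (e0 0%N _ _ _ (hQ i)) //; last exact: wt1_supp.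
    by rewrite (e0 1%N _ _ _ hg) ?mul0rn ?subr0 ?mulr0 //; apply: wtX_supp.
  + rewrite (cQ_mulX frame) (e0 2%N _ _ _ hg) //; last exact: (wtQ_supp frame).
    rewrite mul0rn subr0 sum_mul0 // => l.
    by apply: (e0 1%N _ _ _ (hQ i)) => //; apply: wtX_supp.
  + by rewrite cg_mulX eQ eg eq_sym subrr.
rewrite -rmorphM -(rmorph0 pi); apply: z; rewrite subr0; apply/(perpE frame).
split=> [|a|a|].
+ exact: c1_mulX.
+ by rewrite cX_mulX (e0 0%N _ _ _ hg) ?mulr0 //; apply: wt1_supp.
+ rewrite (cQ_mulX frame) sum_mul0 // => l.
  by apply: (e0 1%N _ _ _ hg) => //; apply: wtX_supp.
by rewrite cg_mulX (e0 2%N _ _ _ hg) //; apply: (wtQ_supp frame).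
Qed.

Section Evaluation.
Variables (A : comAlgType k) (b c : 'I_6 -> A) (d : A).
Hypothesis pt : apolar_point F (in_alg A) b c d.

Lemma mmap_perp f : perp F f -> mmap (in_alg A) b f = 0.
Proof.
move=> /(perp_apolar_over frame (in_alg A)) [f1 fX fQ fg].
rewrite (apolar_eval frame _ pt) f1 fg mul0r !big1 ?addr0 // => i _.
  by rewrite fQ mul0r.
by rewrite fX mul0r.
Qed.

Definition apolar_lift (_ : apolar_point F (in_alg A) b c d) (x : R0) : A :=
  mmap (in_alg A) b (repr x).

Local Notation lift := (apolar_lift pt).

Lemma apolar_liftE f : lift (pi f) = mmap (in_alg A) b f.
Proof.
apply/eqP; rewrite -subr_eq0 -rmorphB; apply/eqP/mmap_perp/apolar_pi_eq0.
by rewrite rmorphB /= /apolar_pi reprK subrr.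
Qed.

Fact apolar_lift_zmod : zmod_morphism lift.
Proof.
move=> x y; have [f ->] := apolar_piP x; have [h ->] := apolar_piP y.
by rewrite -rmorphB !apolar_liftE rmorphB.
Qed.

Fact apolar_lift_monoid : monoid_morphism lift.
Proof.
split=> [|x y]; first by rewrite -(rmorph1 pi) apolar_liftE rmorph1.
have [f ->] := apolar_piP x; have [h ->] := apolar_piP y.
by rewrite -rmorphM !apolar_liftE rmorphM.
Qed.

Fact apolar_lift_scalable : scalable lift.
Proof.
move=> a x; have [f ->] := apolar_piP x.
rewrite -[a *: pi f]/(pi a%:MP * pi f) -rmorphM !apolar_liftE mul_mpolyC mmapZ.
by rewrite /= mulr_algl.
Qed.

HB.instance Definition _ := GRing.isZmodMorphism.Build R0 A lift apolar_lift_zmod.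
HB.instance Definition _ := GRing.isMonoidMorphism.Build R0 A lift apolar_lift_monoid.
HB.instance Definition _ := GRing.isScalable.Build k R0 A *:%R lift apolar_lift_scalable.

(** Morphisms from the apolar algebra to [A] are the solutions of the equations
    of [apolar_point]: a polynomial of [perp F] vanishes at such a solution by
    [apolar_eval]. *)
Lemma apolar_lift_exists : exists phi : {lrmorphism R0 -> A},
  [/\ forall i, phi (pi 'X_i) = b i, forall i, phi (pi (Q i)) = c i & phi (pi g) = d].
Proof.
exists lift; case: (frame) => _ hg hQ _ _; split=> [i|i|] /=; rewrite apolar_liftE.
- by rewrite mmapX mmap1U.
- rewrite (apolar_eval frame _ pt).
  rewrite (extend_homog (e := 0%N) _ (hQ i)) //; last exact: wt1_supp.
  rewrite (extend_homog (e := 3%N) _ (hQ i)) //; last exact: (wtg_supp frame).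
  rewrite mul0r addr0 add0r big1 ?add0r => [|j _]; last first.
    by rewrite (extend_homog (e := 1%N) _ (hQ i)) ?mul0r //; apply: wtX_supp.
  rewrite (bigD1 i) //= (cQ_Q frame) eqxx mul1r big1 ?addr0 // => j ji.
  by rewrite (cQ_Q frame) eq_sym (negPf ji) mul0r.
rewrite (apolar_eval frame _ pt) (cg_g frame) mul1r.
rewrite (extend_homog (e := 0%N) _ hg) //; last exact: wt1_supp.
rewrite !big1 ?add0r // => i _.
  by rewrite (extend_homog (e := 2%N) _ hg) ?mul0r //; apply: (wtQ_supp frame).
by rewrite (extend_homog (e := 1%N) _ hg) ?mul0r //; apply: wtX_supp.
Qed.

End Evaluation.

Lemma apolar_lrmorph_ext (A : comAlgType k) (phi phi' : {lrmorphism R0 -> A}) :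
  (forall i, phi (pi 'X_i) = phi' (pi 'X_i)) -> phi =1 phi'.
Proof.
move=> e x; have [f ->] := apolar_piP x; rewrite !apolar_lrmorph_mmap.
by apply: eq_bigr => m _; congr (_ * _); apply: mmap1_eq.
Qed.

End ApolarAlgebra.

(** * The spikes attached to the points of the apolar algebra *)

Definition polyC_alg (k : fieldType) (A : comAlgType k) : {rmorphism k -> {poly A}} :=
  polyC \o in_alg A.

(** The point [(b, c, d)] is moved by [t] with weights [1], [2], [3], and the
    resulting quotient of rank thirteen is translated to have barycenter zero. *)
Definition spike_family (k : fieldType) (F : {mpoly k[6]}) (A : comAlgType k)
    (b c : 'I_6 -> A) (d : A) : {mpoly {poly A}[6]} -> Prop :=
  centered_ideal F (polyC_alg A) (fun i => 'X * (b i)%:P) (fun i => 'X^2 * (c i)%:P)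
    ('X^3 * d%:P).

Section Family.
Variables (k : fieldType) (F g : {mpoly k[6]}) (Q : 'I_6 -> {mpoly k[6]}).
Hypothesis frame : apolar_frame F g Q.

Lemma family_point (A : comAlgType k) b c (d : A) :
  apolar_point F (in_alg A) b c d ->
  apolar_point F (polyC_alg A) (fun i => 'X * (b i)%:P) (fun i => 'X^2 * (c i)%:P)
    ('X^3 * d%:P).
Proof.
move=> pt; apply: apolar_point_scale.
by apply: (apolar_point_map (kappa := in_alg A) (rho := polyC)).
Qed.

Lemma eq_family (A : comAlgType k) b b' c c' (d d' : A) :
  b =1 b' -> c =1 c' -> d = d' ->
  eq_ideal (spike_family F b c d) (spike_family F b' c' d').
Proof.
move=> eb ec ed; apply: eq_centered_ideal => [i|i|]; by rewrite ?eb ?ec ?ed.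
Qed.

Lemma family_base_change (A : comAlgType k) (S : comNzRingType)
    (rho : {rmorphism {poly A} -> S}) (kappa : {rmorphism k -> S}) s b b' c c' d d' :
  apolar_point F (in_alg A) b c d ->
  (forall x, kappa x = rho (in_alg A x)%:P) -> rho 'X = s ->
  (forall i, rho (b i)%:P = b' i) -> (forall i, rho (c i)%:P = c' i) -> rho d%:P = d' ->
  eq_ideal (base_change rho (spike_family F b c d))
    (centered_ideal F kappa (fun i => s * b' i) (fun i => s ^+ 2 * c' i) (s ^+ 3 * d')).
Proof.
move=> pt ek es eb ec ed.
apply: eq_ideal_trans (centered_base_change frame (kappa' := kappa) _ (family_point pt)) _.
  by move=> x; rewrite ek.
apply: eq_centered_ideal => [i|i|] /=.
- by rewrite rmorphM es eb.
- by rewrite rmorphM rmorphXn /= es ec.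
- by rewrite rmorphM rmorphXn /= es ed.
Qed.

Lemma spike_map_family (A A' : comAlgType k) (phi : {lrmorphism A -> A'}) b c d :
  apolar_point F (in_alg A) b c d ->
  eq_ideal (spike_map phi (spike_family F b c d)) (spike_family F (phi \o b) (phi \o c) (phi d)).
Proof.
move=> pt.
apply: (eq_ideal_trans (family_base_change (rho := map_poly phi)
  (kappa := polyC_alg A') (s := 'X) (b' := fun i => (phi (b i))%:P)
  (c' := fun i => (phi (c i))%:P) (d' := (phi d)%:P) pt _ _ _ _ _)) => //=.
- by move=> x; rewrite map_polyC /= linearZ /= rmorph1.
- by rewrite map_polyX.
- by move=> i; rewrite map_polyC.
- by move=> i; rewrite map_polyC.
- by rewrite map_polyC.
Qed.

Lemma value_at_family (A C : comAlgType k) (rho : {lrmorphism A -> C}) s b c d :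
  apolar_point F (in_alg A) b c d ->
  eq_ideal (value_at rho s (spike_family F b c d))
    (centered_ideal F (in_alg C) (fun i => s * rho (b i))
       (fun i => s ^+ 2 * rho (c i)) (s ^+ 3 * rho d)).
Proof.
move=> pt; pose ev : {rmorphism {poly A} -> C} := horner_eval s \o map_poly rho.
apply: (family_base_change (rho := ev) pt) => //= [x||i|i|];
  rewrite ?map_polyX ?map_polyC /horner_eval ?hornerX ?hornerC //=.
by rewrite linearZ /= rmorph1.
Qed.

Lemma rescale_family (A : comAlgType k) (l : A) b c d :
  apolar_point F (in_alg A) b c d ->
  eq_ideal (base_change (comp_poly (l *: 'X)) (spike_family F b c d))
    (spike_family F (fun i => l * b i) (fun i => l ^+ 2 * c i) (l ^+ 3 * d)).
Proof.
move=> pt.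
apply: (eq_ideal_trans (family_base_change (rho := comp_poly (l *: 'X))
  (kappa := polyC_alg A) (s := l *: 'X) (b' := fun i => (b i)%:P)
  (c' := fun i => (c i)%:P) (d' := d%:P) pt _ _ _ _ _)) => //=.
- by move=> x; rewrite comp_polyC.
- by rewrite comp_polyX.
- by move=> i; rewrite comp_polyC.
- by move=> i; rewrite comp_polyC.
- by rewrite comp_polyC.
apply: eq_centered_ideal => [i|i|]; rewrite -mul_polyC ?exprMn polyCM ?polyCX;
  rewrite ?rmorphXn /=; ring.
Qed.

Lemma family_spike (A : comAlgType k) b c (d : A) :
  13%:R != 0 :> k -> apolar_point F (in_alg A) b c d -> spike F (spike_family F b c d).
Proof.
move=> k13 pt; split.
- by apply: (centered_bar_zero frame) => //; apply: family_point.
- move=> C rho a a' s aa'.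
  apply: eq_ideal_trans (value_at_family _ _ pt) _; apply: eq_ideal_sym.
  have h : eq_ideal (scale a (value_at rho s (spike_family F b c d)))
      (scale a (centered_ideal F (in_alg C) (fun i => s * rho (b i))
         (fun i => s ^+ 2 * rho (c i)) (s ^+ 3 * rho d))).
    by move=> p; rewrite !scaleE; apply: value_at_family.
  apply: eq_ideal_trans h _; apply: eq_ideal_trans (centered_scale frame _ _ _ _ aa') _.
  by apply: eq_centered_ideal => [i|i|]; rewrite mulrA -?exprMn.
apply: eq_ideal_trans (value_at_family idfun _ pt) _.
apply: eq_ideal_trans (centered_ideal0 frame _).
by apply: eq_centered_ideal => [i|i|]; rewrite ?expr0n mul0r.
Qed.

(** Multiplication by [alpha_j] on the uncentered family has trace [- t b_j], so
    its barycenter is moved to zero by the translation by [t b_j / 13]. *)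
Lemma family_centering (A : comAlgType k) b c (d : A) :
  13%:R != 0 :> k -> apolar_point F (in_alg A) b c d ->
  let t : {mpoly {poly A}[6]} := 'X%:MP in
  let incl (f : {mpoly k[6]}) : {mpoly {poly A}[6]} := map_mpoly (polyC_alg A) f in
  is_centering
    (ideal_gen (fun p => (exists2 f, perp F f & p = incl f) \/
       p = incl g + t * (\sum_i (b i)%:P%:MP * incl (Q i))
         + t ^+ 2 * (\sum_i incl 'X_i * (c i)%:P%:MP) + t ^+ 3 * d%:P%:MP))
    (spike_family F b c d).
Proof.
move=> k13 pt t incl; have [bz _ _] := family_spike k13 pt; split; first exact: bz.
exists (fun i => - (polyC_alg A 13%:R^-1 * ('X * (b i)%:P))).
apply: (eq_ideal_trans (J2 := deformed_ideal F (polyC_alg A) (fun i => 'X * (b i)%:P)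
    (fun i => 'X^2 * (c i)%:P) ('X^3 * d%:P))); last first.
  apply: eq_ideal_sym; apply: eq_ideal_trans (translate_comp _ _ _) _.
  apply: eq_ideal_trans (translate0 _); apply: eq_translate => // i.
  by rewrite addNr.
apply: eq_ideal_trans (deformed_idealE frame (family_point pt)).
have -> : incl g + t * (\sum_i (b i)%:P%:MP * incl (Q i))
    + t ^+ 2 * (\sum_i incl 'X_i * (c i)%:P%:MP) + t ^+ 3 * d%:P%:MP =
    combination g Q (polyC_alg A) ('X^3 * d%:P) (fun i => 'X^2 * (c i)%:P)
      (fun i => 'X * (b i)%:P) 1.
  rewrite /combination scale1r.
  have -> : \sum_i ('X^2 * (c i)%:P) *: 'X_i =
      t ^+ 2 * (\sum_i incl 'X_i * (c i)%:P%:MP).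
    rewrite mulr_sumr; apply: eq_bigr => i _.
    by rewrite -mul_mpolyC mpolyCM rmorphXn /incl map_mpolyX -mulrA [_ * 'X_i]mulrC.
  have -> : \sum_i ('X * (b i)%:P) *: map_mpoly (polyC_alg A) (Q i) =
      t * (\sum_i (b i)%:P%:MP * incl (Q i)).
    rewrite mulr_sumr; apply: eq_bigr => i _.
    by rewrite -mul_mpolyC mpolyCM -mulrA.
  by rewrite mpolyCM rmorphXn; ring.
move=> p; split; apply: ideal_gen_sub; try exact: ideal_genP; move=> {}p [pf|->];
  apply: mem_ideal_gen; by [left | right].
Qed.

Lemma fractal_centering (F0 : F != 0) :
  13%:R != 0 :> k ->
  is_centering (fractal_ideal F0 g Q)
    (spike_family F (fun i => apolar_pi F0 'X_i) (fun i => apolar_pi F0 (Q i))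
       (apolar_pi F0 g)).
Proof. by move=> k13; apply: family_centering k13 (universal_point frame F0). Qed.

End Family.

(** * Linear systems over a field, after extension of scalars *)

(** A [k]-linear parametrisation of the solutions remains one over every
    [k]-algebra, since the kernel of a matrix over a field is the image of an
    idempotent matrix. *)
Lemma kernel_transfer (k : fieldType) (R : comNzRingType) (kappa : {rmorphism k -> R})
    (I J L : finType) (K : I -> J -> k) (P : L -> I -> k) :
  (forall v : I -> k, (forall j, \sum_i v i * K i j = 0) ->
     exists a : L -> k, forall i, v i = \sum_l a l * P l i) ->
  forall v : I -> R, (forall j, \sum_i v i * kappa (K i j) = 0) ->
    exists a : L -> R, forall i, v i = \sum_l a l * kappa (P l i).
Proof.
move=> ker v hv.
pose MK : 'M[k]_(#|I|, #|J|) := \matrix_(i, j) K (enum_val i) (enum_val j).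
pose MP : 'M[k]_(#|L|, #|I|) := \matrix_(l, i) P (enum_val l) (enum_val i).
(* [E] maps into the kernel of [MK] and is the identity on it. *)
pose E := 1%:M - MK *m pinvmx MK.
have EK : E *m MK = 0 by rewrite mulmxBl mul1mx mulmxKpV ?submx_refl // subrr.
have sumI (V : nmodType) (G : I -> V) : \sum_i G i = \sum_(i' < #|I|) G (enum_val i').
  by rewrite -[RHS](big_enum_val G); apply: eq_bigl.
have sumL (V : nmodType) (G : L -> V) : \sum_l G l = \sum_(l' < #|L|) G (enum_val l').
  by rewrite -[RHS](big_enum_val G); apply: eq_bigl.
have [W hW] : exists W, E = W *m MP.
  have [c hc] : exists c : 'I_#|I| -> L -> k, forall i' i,
      E i' (enum_rank i) = \sum_l c i' l * P l i.
    apply: (fin_all_exists (P := fun i' (c : L -> k) => forall i,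
        E i' (enum_rank i) = \sum_l c l * P l i)) => i'.
    apply: ker => j.
    move/matrixP: EK => /(_ i' (enum_rank j)); rewrite !mxE sumI => e.
    by rewrite -[RHS]e; apply: eq_bigr => i'' _; rewrite [MK _ _]mxE enum_rankK enum_valK.
  exists (\matrix_(i, l) c i (enum_val l)); apply/matrixP => i' i''.
  rewrite -[i'']enum_valK hc mxE sumL; apply: eq_bigr => l _.
  by rewrite !mxE enum_valK.
pose V : 'rV[R]_#|I| := \row_i v (enum_val i).
have VK : V *m map_mx kappa MK = 0.
  apply/matrixP => z j'; rewrite !mxE -[RHS](hv (enum_val j')) sumI.
  by apply: eq_bigr => i' _; rewrite !mxE.
pose a := V *m map_mx kappa W.
exists (fun l => a 0 (enum_rank l)) => i.
have -> : v i = V 0 (enum_rank i) by rewrite mxE enum_rankK.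
have -> : V = a *m map_mx kappa MP.
  rewrite -mulmxA -map_mxM -hW map_mxB map_mx1 mulmxBr mulmx1 map_mxM mulmxA.
  by rewrite VK mul0mx subr0.
rewrite mxE sumL; apply: eq_bigr => l _.
by rewrite !mxE enum_valK enum_rankK.
Qed.

Lemma injective_transfer (k : fieldType) (R : comNzRingType) (kappa : {rmorphism k -> R})
    (I J : finType) (K : I -> J -> k) :
  (forall v : I -> k, (forall j, \sum_i v i * K i j = 0) -> forall i, v i = 0) ->
  forall v : I -> R, (forall j, \sum_i v i * kappa (K i j) = 0) -> forall i, v i = 0.
Proof.
move=> inj v hv i; have void0 (V : nmodType) (G : void -> V) : \sum_l G l = 0.
  by rewrite big1 // => -[].
have [v' /inj v0|a ->] := @kernel_transfer _ _ kappa I J void K (fun l _ => 0) _ v hv.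
  by exists (fun=> 0) => i'; rewrite v0 void0.
by rewrite void0.
Qed.

(** * Homomorphisms of negative degree *)

Lemma euler_homog (k : comNzRingType) d (p : {mpoly k[6]}) :
  p \is d.-homog -> \sum_i 'X_i * p^`M(i) = p *+ d.
Proof.
move=> hp; rewrite {1}[p]mpolyE [p in RHS]mpolyE -sumrMnl.
under eq_bigr do rewrite raddf_sum mulr_sumr.
rewrite exchange_big /= big_seq [RHS]big_seq; apply: eq_bigr => m /(dhomog_mf hp) /= <-.
rewrite mdegE -sumrMnr; apply: eq_bigr => i _.
rewrite mderivZ mderivX -!scalerAr scalerMnr; congr (_ *: _).
case: (posnP (m i)) => [->|mi]; first by rewrite scale0r mulr0n.
rewrite -mpolyXD addmC submK; first by rewrite scaler_nat.
by apply/mnm_lepP => j; rewrite mnm1E; case: eqP => [<-|].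
Qed.

Lemma pihomog_mulr (k : comNzRingType) d e (p q : {mpoly k[6]}) :
  q \is e.-homog -> pihomog mdeg (d + e) (p * q) = pihomog mdeg d p * q.
Proof.
move=> hq; rewrite [p]mpolyE mulr_suml !raddf_sum mulr_suml; apply: eq_bigr => m _ /=.
rewrite -scalerAl !linearZ /= -scalerAl; congr (_ *: _).
have hm : 'X_[m] * q \is (mdeg m + e).-homog.
  by apply: dhomogM => //; rewrite dhomogX.
rewrite pihomogX; have [<-|ne] := eqVneq (mdeg m) d; first exact: pihomog_dE.
by rewrite mul0r; apply: pihomog_ne0 hm; rewrite eqn_add2r.
Qed.

Section NegativeHoms.
Variables (k : fieldType) (F g : {mpoly k[6]}) (Q : 'I_6 -> {mpoly k[6]}).
Hypothesis frame : apolar_frame F g Q.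

Definition linear_presentation (n m : nat) (q : 'I_n -> {mpoly k[6]})
    (D : 'I_m -> 'I_n -> {mpoly k[6]}) : Prop :=
  [/\ forall j, q j \is 2.-homog, forall r j, D r j \is 1.-homog,
      forall f, perp F f <-> exists v : 'I_n -> {mpoly k[6]}, f = \sum_j v j * q j
    & forall v : 'I_n -> {mpoly k[6]}, \sum_j v j * q j = 0 <->
        exists w : 'I_m -> {mpoly k[6]}, forall j, v j = \sum_r w r * D r j].

Lemma general_enough_presentation : general_enough F ->
  exists n m q D, @linear_presentation n m q D.
Proof.
case=> _ [n [d [eps [D [[[heps hD] gen syz _ _] [_ d0] [_ d1]]]]]] _.
have E (v : 'rV_(n 0%N)) : (v *m eps) 0 0 = \sum_j v 0 j * eps j 0 by rewrite mxE.
exists (n 0%N), (n 1%N), (fun j => eps j 0), (fun r j => D 0%N r j); split.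
- by move=> j; have := heps j; rewrite d0.
- by move=> r j; have := hD 0%N r j; rewrite d0 d1.
- move=> f; split=> [/gen[v ->]|[v ->]]; first by exists (v 0); rewrite E.
  by apply/gen; exists (\row_j v j); rewrite E; apply: eq_bigr => j _; rewrite mxE.
move=> v; split=> [e|[w hw]].
  have /syz[w hw] : (\row_j v j) *m eps = 0.
    apply/matrixP => i j; rewrite !ord1 E [RHS]mxE -[RHS]e.
    by apply: eq_bigr => l _; rewrite mxE.
  by exists (w 0) => j; move/matrixP: hw => /(_ 0 j); rewrite !mxE.
have /syz/matrixP/(_ 0 0) : exists w, \row_j v j = w *m D 0%N.
  exists (\row_r w r); apply/matrixP => i j; rewrite !mxE hw.
  by apply: eq_bigr => r _; rewrite mxE.
by rewrite E mxE => {2}<-; apply: eq_bigr => j _; rewrite mxE.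
Qed.

Lemma perp_ideal : is_ideal (perp F).
Proof.
split=> [|p h pp ph|p h ph]; rewrite /perp.
- exact: hook0l.
- by rewrite hookDl pp ph addr0.
- by rewrite hookM ph hook0r.
Qed.

(** [perp F] starts in degree two. *)
Lemma perp_low f : perp F f -> (forall m, (1 < mdeg m)%N -> f@_m = 0) -> f = 0.
Proof.
case/(perpE frame) => f1 fX _ _ low; apply/mpolyP => m; rewrite mcoeff0.
case: (ltngtP (mdeg m) 1%N) => [|/low //|].
  by rewrite ltnS leqn0 mdeg_eq0 => /eqP ->; rewrite -(c1E idfun).
by move=> /eqP/mdeg1P[i /eqP ->]; rewrite -(cXE idfun).
Qed.

Lemma X4_perp i : perp F ('X_i ^+ 4).
Proof.
rewrite mpolyXn; apply/(perpE frame).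
have d4 : mdeg (U_(i) *+ 4)%MM = 4%N by rewrite mdegMn mdeg1.
split=> [|j|j|]; rewrite extend_mon.
- by rewrite wt1_supp ?d4.
- by rewrite wtX_supp ?d4.
- by rewrite (wtQ_supp frame) ?d4.
- by rewrite (wtg_supp frame) ?d4.
Qed.

Lemma hom_neg_of_degree e phi :
  hom_neg_degree (perp F) (perp F) e.+1 phi -> hom_neg (perp F) (perp F) phi.
Proof.
have iJ := perp_ideal; have J0 : perp F 0 by case: iJ.
move=> hphi; exists e.+1, (fun i : 'I_e.+1 => if i == ord_max then phi else fun=> 0).
split=> [i|f pf].
  case: eqP => [->//|_]; split; first split=> *; rewrite ?mulr0 ?addr0 ?oppr0 ?addr0 //.
  move=> d f _ _; exists 0; first by rewrite subr0.
  by case: ifP => // _; apply: rpred0.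
by rewrite (bigD1 ord_max) //= eqxx big1 ?addr0 ?subrr // => i /negPf ->.
Qed.

Lemma mderiv_hom_neg i : hom_neg (perp F) (perp F) (mderiv i).
Proof.
have iJ := perp_ideal; have J0 : perp F 0 by case: iJ.
apply: (@hom_neg_of_degree 0); split; first split=> [f h _ _|s f pf].
- by rewrite mderivD subrr.
- by rewrite mderivM addrK; apply: ideal_mull.
move=> d f _ hf; exists (f^`M(i)); first by rewrite subrr.
have coef m : f^`M(i)@_m = f@_(m + U_(i)) *+ (m i).+1 by apply: mcoeff_deriv.
case: d hf => [|d] hf /=.
  apply/eqP/mpolyP => m; rewrite coef mcoeff0 (dhomog_nemf_coeff hf) ?mul0rn //=.
  by rewrite mdegD mdeg1 addn1.
apply/dhomogP => m; rewrite mcoeff_msupp coef subn1 /= => nz; apply/eqP.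
apply: contraNT nz => ne; rewrite (dhomog_nemf_coeff hf) ?mul0rn //=.
by rewrite mdegD mdeg1 addn1 eqSS.
Qed.

Section Presented.
Variables (n m : nat) (q : 'I_n -> {mpoly k[6]}) (D : 'I_m -> 'I_n -> {mpoly k[6]}).
Hypothesis pres : linear_presentation q D.

Lemma q_perp j : perp F (q j).
Proof.
case: pres => _ _ gen _; apply/gen; exists (fun l => (l == j)%:R).
rewrite (bigD1 j) //= eqxx mul1r big1 ?addr0 // => l /negPf ->.
by rewrite mul0r.
Qed.

(** A constant vector field [h] killing the quadrics of [perp F] gives, by
    Euler's formula, a common zero [h] of [perp F], which contains all the
    [alpha_i ^ 4]. *)
Lemma no_invariant_direction (h : 'I_6 -> k) : 2%:R != 0 :> k ->
  (forall j, \sum_i h i *: (q j)^`M(i) = 0) -> forall i, h i = 0.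
Proof.
case: pres => hq _ gen _ k2 inv.
have qh j : (q j).@[h] = 0.
  have := congr1 (meval h) (euler_homog (hq j)); rewrite raddf_sum raddfMn /=.
  under eq_bigr do rewrite mevalM mevalXU -mevalZ.
  rewrite -raddf_sum inv raddf0 -mulr_natl => /esym/eqP.
  by rewrite mulf_eq0 (negPf k2) => /eqP.
move=> i; have [v hv] := (gen _).1 (X4_perp i).
apply/eqP; have := congr1 (meval h) hv; rewrite rmorphXn /= mevalXU raddf_sum big1.
  by move/eqP; rewrite expf_eq0.
by move=> j _; rewrite /= mevalM qh mulr0.
Qed.

(** The six-dimensional space of homomorphisms of negative degree is spanned
    by the partial derivatives, so a family [w_j] compatible with the syzygies
    is a derivative of the family [q_j]. *)
Lemma syzygy_compatible e (w : 'I_n -> {mpoly k[6]}) : 2%:R != 0 :> k ->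
  hom_neg_dim (perp F) (perp F) 6 ->
  (e < 2)%N -> (forall j, w j \is (1 - e).-homog) ->
  (forall r, perp F (\sum_j D r j * w j)) ->
  exists a : 'I_6 -> k, forall j, w j = \sum_i a i *: (q j)^`M(i).
Proof.
case: pres => hq hD gen syz k2 [theta [_ span _]] e2 hw comp.
have iJ := perp_ideal; have J0 : perp F 0 by case: iJ.
have hv f : exists v : {ffun 'I_n -> {mpoly k[6]}},
    (hook f F == 0) ==> (f == \sum_j v j * q j).
  case: eqP => [/gen[v ->]|_]; last by exists 0.
  exists [ffun j => v j]; apply/eqP; apply: eq_bigr => j _; by rewrite ffunE.
pose phi f := \sum_j xchoose (hv f) j * w j.
have phiE f v : f = \sum_j v j * q j -> perp F (phi f - \sum_j v j * w j).
  move=> fv; have pf : perp F f by apply/gen; exists v.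
  have /implyP/(_ (introT eqP pf))/eqP fx := xchooseP (hv f).
  have /syz[u hu] : \sum_j (xchoose (hv f) j - v j) * q j = 0.
    by under eq_bigr do rewrite mulrBl; rewrite sumrB -fx -fv subrr.
  rewrite -sumrB; under eq_bigr do rewrite -mulrBl hu mulr_suml.
  rewrite exchange_big /=; apply: ideal_sum => // r.
  by under eq_bigr do rewrite -mulrA; rewrite -mulr_sumr; apply: ideal_mull.
have hphi : hom_neg (perp F) (perp F) phi.
  apply: (@hom_neg_of_degree e); split; first split=> [f h pf ph|s f pf].
  - have [v fv] := (gen f).1 pf; have [u hu] := (gen h).1 ph.
    have p1 := phiE _ _ fv; have p2 := phiE _ _ hu.
    have /phiE p3 : f + h = \sum_j (v j + u j) * q j.
      by rewrite fv hu -big_split; apply: eq_bigr => j _; rewrite mulrDl.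
    have := ideal_sub iJ p3 (ideal_add iJ p1 p2).
    have -> : \sum_j (v j + u j) * w j = \sum_j v j * w j + \sum_j u j * w j.
      by rewrite -big_split; apply: eq_bigr => j _; rewrite mulrDl.
    by congr (perp F _); ring.
  - have [v fv] := (gen f).1 pf; have p1 := phiE _ _ fv.
    have /phiE p3 : s * f = \sum_j (s * v j) * q j.
      by rewrite fv mulr_sumr; apply: eq_bigr => j _; rewrite mulrA.
    have := ideal_sub iJ p3 (ideal_mull s iJ p1).
    have -> : \sum_j s * v j * w j = s * \sum_j v j * w j.
      by rewrite mulr_sumr; apply: eq_bigr => j _; rewrite mulrA.
    by congr (perp F _); ring.
  move=> d f pf hf; have [d2|d2] := ltnP d 2.
    have f0 : f = 0.
      apply: perp_low pf _ => l l2; apply: (dhomog_nemf_coeff hf).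
      by rewrite /= neq_ltn (leq_trans d2 l2) orbT.
    exists 0; last by case: ifP => // _; apply: rpred0.
    have /phiE : f = \sum_j 0 * q j by rewrite f0 big1 // => j _; rewrite mul0r.
    by rewrite big1 // => j _; rewrite mul0r.
  have [v fv] := (gen f).1 pf.
  have /phiE p1 : f = \sum_j pihomog mdeg (d - 2) (v j) * q j.
    rewrite -(pihomog_dE hf) {1}fv raddf_sum; apply: eq_bigr => j _ /=.
    by rewrite -(pihomog_mulr _ _ (hq j)) subnK.
  exists (\sum_j pihomog mdeg (d - 2) (v j) * w j) => //.
  rewrite (leq_trans e2 d2); apply: rpred_sum => j _.
  have -> : (d - e.+1 = (d - 2) + (1 - e))%N by rewrite addnBA // addn1 -subSn // subSS subnS -subn1 subnAC; case: (e) e2 => [|[]].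
  by apply: dhomogM => //; apply: pihomogP.
have [M hM] := fin_all_exists (fun i => span _ (mderiv_hom_neg i)).
pose MM : 'M[k]_6 := \matrix_(i, j) M i j.
have comb (a : 'I_6 -> k) f : perp F f ->
    perp F (\sum_i a i *: f^`M(i) - \sum_j ((\row_i a i) *m MM) 0 j *: theta j f).
  move=> pf; have -> : \sum_j ((\row_i a i) *m MM) 0 j *: theta j f =
      \sum_i a i *: \sum_j M i j *: theta j f.
    under eq_bigr do rewrite mxE scaler_suml.
    rewrite exchange_big; apply: eq_bigr => i _; rewrite scaler_sumr.
    by apply: eq_bigr => j _; rewrite !mxE scalerA.
  rewrite -sumrB; apply: ideal_sum => // i; rewrite -scalerBr.
  by apply: ideal_scale => //; apply: hM.
have dlow (a : 'I_6 -> k) j l : (1 < mdeg l)%N -> (\sum_i a i *: (q j)^`M(i))@_l = 0.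
  move=> l2; rewrite raddf_sum big1 // => i _ /=.
  rewrite mcoeffZ mcoeff_deriv (dhomog_nemf_coeff (hq j)) ?mul0rn ?mulr0 //=.
  by rewrite mdegD mdeg1 addn1 eqSS gtn_eqF.
(* By [no_invariant_direction] the six partial derivatives are linearly
   independent, hence a basis of the homomorphisms of negative degree. *)
have uM : MM \in unitmx.
  rewrite -row_free_unit -kermx_eq0; apply/rowV0P => a /sub_kermxP aM.
  apply/rowP => i; rewrite mxE; apply: (no_invariant_direction (h := a 0)) => // j.
  apply: perp_low (dlow _ _); have := comb (a 0) _ (q_perp j).
  have -> : \row_i a 0 i = a by apply/rowP => l; rewrite mxE.
  by rewrite aM [X in _ - X]big1 ?subr0 // => l _; rewrite mxE scale0r.
have [c hc] := span _ hphi.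
pose a := (\row_j c j) *m invmx MM; exists (a 0) => j.
apply/eqP; rewrite -subr_eq0; apply/eqP; apply: perp_low; last first.
  move=> l l2; rewrite mcoeffB dlow // subr0; apply: (dhomog_nemf_coeff (hw j)).
  by rewrite /= neq_ltn (leq_ltn_trans (leq_subr _ _) l2) orbT.
have /phiE p1 : q j = \sum_l (l == j)%:R * q l.
  rewrite (bigD1 j) //= eqxx mul1r big1 ?addr0 // => l /negPf ->.
  by rewrite mul0r.
have e1 : \sum_l (l == j)%:R * w l = w j.
  rewrite (bigD1 j) //= eqxx mul1r big1 ?addr0 // => l /negPf ->.
  by rewrite mul0r.
rewrite {}e1 in p1; have p2 := hc _ (q_perp j); have := comb (a 0) _ (q_perp j).
have -> : \row_i a 0 i = a by apply/rowP => l; rewrite mxE.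
rewrite mulmxKV // => p3; have := ideal_sub iJ (ideal_sub iJ p2 p1) p3.
have -> : \sum_l (\row_j0 c j0) 0 l *: theta l (q j) = \sum_l c l *: theta l (q j).
  by apply: eq_bigr => l _; rewrite mxE.
by congr (perp F _); ring.
Qed.

End Presented.
End NegativeHoms.

(** * Taylor expansions *)

Section Taylor.
Variable R : comNzRingType.
Implicit Types (h : 'I_6 -> R) (p : {mpoly R[6]}).

Lemma taylor_square_zero h p : (forall i j, h i * h j = 0) ->
  affine 1 h p = p + \sum_i h i *: p^`M(i).
Proof.
move=> hh; elim/mpolyind: p => [|c m p _ _ ih].
  by rewrite rmorph0 big1 ?addr0 // => i _; rewrite raddf0 scaler0.
rewrite raddfD /= ih affineZ; under [X in _ = _ + _ + X]eq_bigr do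
  rewrite mderivD mderivZ scalerDr scalerA mulrC -scalerA.
rewrite big_split /= -scaler_sumr addrACA; congr (_ + _).
rewrite -scalerDr; congr (_ *: _).
pose T q := affine 1 h q = q + \sum_i h i *: q^`M(i).
have TM q r : T q -> T r -> T (q * r).
  rewrite /T rmorphM /= => -> ->.
  under [X in _ = _ + X]eq_bigr do rewrite mderivM scalerDr scalerAl scalerAr.
  rewrite big_split /= -mulr_suml -mulr_sumr mulrDl !mulrDr.
  have -> : (\sum_i h i *: q^`M(i)) * (\sum_i h i *: r^`M(i)) = 0.
    rewrite mulr_suml big1 // => i _; rewrite mulr_sumr big1 // => j _.
    by rewrite -scalerAl -scalerAr scalerA hh scale0r.
  by rewrite addr0; ring.
have T1 : T 1.
  rewrite /T rmorph1 big1 ?addr0 // => i _.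
  by rewrite -mpolyC1 mderivC scaler0.
have TX i : T 'X_i.
  rewrite /T affineX scale1r; congr (_ + _).
  rewrite (bigD1 i) //= big1 => [|j ji]; last first.
    by rewrite mderivX mnm1E eq_sym (negPf ji) scale0r scaler0.
  rewrite addr0 mderivX mnm1E eqxx scale1r.
  have -> : (U_(i) - U_(i) = 0 :> 'X_{1..6})%MM.
    by apply/mnmP => j; rewrite mnmBE mnm0E subnn.
  by rewrite mpolyX0 -mul_mpolyC mulr1.
rewrite mpolyXE_id -/(T _); elim/big_rec: _ => [//|i q _ Tq].
by apply: (TM _ _) => //; elim: (m i) => [|e ihe] //; rewrite exprS; apply: (TM _ _).
Qed.

Lemma mdeg2_split (m : 'X_{1..6}) : mdeg m = 2%N -> exists i j, m = (U_(i) + U_(j))%MM.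
Proof.
move=> m2; have [i mi] : exists i, m i != 0%N.
  apply/existsP; apply: contraTT isT => /existsPn m0; move: m2.
  by rewrite mdegE big1 // => i _; apply/eqP; move: (m0 i); rewrite negbK.
have e : (m - U_(i) + U_(i))%MM = m by apply: submK; rewrite lep1mP.
have /eqP/mdeg1P[j /eqP ej] : mdeg (m - U_(i))%MM = 1%N.
  by move: m2; rewrite -{1}e mdegD mdeg1 addn1 => -[].
by exists j, i; rewrite -ej e.
Qed.

Lemma taylor_quadric h p : p \is 2.-homog ->
  affine 1 h p = p + \sum_i h i *: p^`M(i) + (p.@[h])%:MP.
Proof.
move=> hp; rewrite [p]mpolyE.
have : forall m, m \in msupp p -> mdeg m = 2%N by move=> m /(dhomog_mf hp).
elim: (msupp p) => [_|m s ih s2].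
  rewrite big_nil !rmorph0 addr0 big1 ?addr0 // => i _.
  by rewrite raddf0 scaler0.
rewrite !big_cons; set r := \sum_(_ <- s) _ in ih *.
have {}ih : affine 1 h r = r + \sum_i h i *: r^`M(i) + (r.@[h])%:MP.
  by apply: ih => m' ms; apply: s2; rewrite inE ms orbT.
rewrite rmorphD /= {}ih mevalD mpolyCD affineZ mevalZ mpolyCM mul_mpolyC.
under [X in _ = _ + X + _]eq_bigr do
  rewrite mderivD mderivZ scalerDr scalerA mulrC -scalerA.
rewrite big_split /= -scaler_sumr.
have [i [j ->]] := mdeg2_split (s2 m (mem_head _ _)).
have dX l a : ('X_a : {mpoly R[6]})^`M(l) = (l == a)%:R.
  rewrite mderivX mnm1E eq_sym; case: eqP => [->|_]; last by rewrite scale0r.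
  rewrite scale1r; have -> : (U_(a) - U_(a) = 0 :> 'X_{1..6})%MM.
    by apply/mnmP => b; rewrite mnmBE mnm0E subnn.
  exact: mpolyX0.
have -> : \sum_l h l *: ('X_[U_(i) + U_(j)] : {mpoly R[6]})^`M(l) =
    h i *: 'X_j + h j *: 'X_i.
  rewrite mpolyXD; under eq_bigr do rewrite mderivM !dX scalerDr.
  rewrite big_split /= (bigD1 i) //= eqxx mul1r big1 ?addr0 => [|l /negPf ->].
    rewrite (bigD1 j) //= eqxx mulr1 big1 ?addr0 // => l /negPf ->.
    by rewrite mulr0 scaler0.
  by rewrite mul0r scaler0.
rewrite !mpolyXD rmorphM mevalM !mevalXU /= !affineX !scale1r -!mul_mpolyC mpolyCM.
by ring.
Qed.

End Taylor.

(** * Torsion-freeness of families of finite length *)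

Lemma expr_ideal_sum (R : comNzRingType) (I : R -> Prop) r (w s : 'I_r -> R) :
  is_ideal I -> (forall i, exists n, I (s i ^+ n)) ->
  exists n, I ((\sum_i w i * s i) ^+ n).
Proof.
move=> iI hs; elim/big_rec: _ => [|i x _ [n hx]].
  by exists 1%N; rewrite expr1; case: iI.
have [m hm] := hs i; exists (m + n)%N; rewrite exprDn; apply: ideal_sum => // j.
rewrite -mulr_natl; apply: ideal_mull => //.
have [mj|jm] := leqP m (m + n - j).
  by rewrite mulrC -(subnK mj) exprMn [s i ^+ _]exprD !mulrA; apply: ideal_mull.
have nj : (n <= j)%N by rewrite leqNgt; apply: contraTN jm => jn; rewrite -leqNgt -addnBA ?leq_addr // ltnW.
by rewrite -(subnK nj) exprD mulrA; apply: ideal_mull.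
Qed.

(** On the principal open where [s_i] is invertible, the coordinates of [p] in a
    basis are killed by [x], hence vanish there, so that a power of [s_i] sends
    [p] into [J]. *)
Lemma hilb13_torsion_free (R : comNzRingType) (J : {mpoly R[6]} -> Prop) x p :
  hilb13 J -> (forall c : R, x * c = 0 -> c = 0) -> J (x *: p) -> J p.
Proof.
case=> iJ [r [w [s [ws loc]]]] reg Jxp.
have iI : is_ideal (fun c : R => J (c *: p)).
  split=> [|a b Ja Jb|a b Jb]; first by rewrite scale0r; case: iJ.
    by rewrite scalerDl; apply: ideal_add.
  by rewrite -scalerA; apply: ideal_scale.
have [|n] := expr_ideal_sum w (s := s) iI; last by rewrite ws expr1n scale1r.
move=> i; have [b [gen free]] := loc i; have [n [c hc]] := gen p.
have /free[m hm] : J (\sum_l (x * c l) *: b l).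
  have -> : \sum_l (x * c l) *: b l =
      s i ^+ n *: (x *: p) - x *: (s i ^+ n *: p - \sum_l c l *: b l).
    rewrite scalerBr !scalerA [x * _]mulrC opprB addrC subrK scaler_sumr.
    by apply: eq_bigr => l _; rewrite scalerA.
  by apply: ideal_sub => //; apply: ideal_scale.
exists (m + n)%N.
have -> : s i ^+ (m + n) *: p = s i ^+ m *: (s i ^+ n *: p - \sum_l c l *: b l).
  rewrite scalerBr scalerA -exprD scaler_sumr big1 ?subr0 // => l _.
  by rewrite scalerA (reg (s i ^+ m * c l)) ?scale0r // mulrCA.
exact: ideal_scale.
Qed.

(** * Weight components in [A[t, alpha]] *)

Section Weights.
Variables (k : fieldType) (A : comAlgType k).
Local Notation R := {poly A}.
Local Notation kappa := (polyC_alg A).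
Implicit Types p : {mpoly R[6]}.

(** The component of [c alpha^m] of total degree [d], where [t] and the
    [alpha_i] have degree one. *)
Definition weight_coef (d : nat) (m : 'X_{1..6}) (c : R) : R :=
  if (mdeg m <= d)%N then (c`_(d - mdeg m))%:P * 'X^(d - mdeg m) else 0.

Definition weight_part (d : nat) p : {mpoly R[6]} :=
  \sum_(m <- msupp p) weight_coef d m p@_m *: 'X_[m].

Lemma mcoeff_weight_part d p m : (weight_part d p)@_m = weight_coef d m p@_m.
Proof.
rewrite raddf_sum /=; have [mp|mp] := boolP (m \in msupp p).
  rewrite (bigD1_seq m) ?msupp_uniq //= mcoeffZ mcoeffX eqxx mulr1 big1 ?addr0 //.
  by move=> m' /negPf ne; rewrite mcoeffZ mcoeffX ne mulr0.
rewrite (memN_msupp_eq0 mp) /weight_coef coef0 polyC0 mul0r if_same big_seq big1 //.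
move=> m' m'p; rewrite mcoeffZ mcoeffX; case: eqP => [e|_]; last by rewrite mulr0.
by rewrite -e m'p in mp.
Qed.

Lemma weight_part_sum p :
  exists n, forall N, (n <= N)%N -> p = \sum_(d < N) weight_part d p.
Proof.
exists (\max_(m <- msupp p) (mdeg m + size p@_m))%N => N leN.
apply/mpolyP => m; rewrite raddf_sum /=; apply/polyP => i; rewrite coef_sum.
under eq_bigr do rewrite mcoeff_weight_part.
have E d : (weight_coef d m p@_m)`_i = (d == i + mdeg m)%:R * (p@_m)`_i.
  rewrite /weight_coef; case: leqP => [md|dm].
    rewrite coefCM coefXn mulrC -[d in RHS](subnK md) eqn_add2r eq_sym.
    by case: eqP => [->|_] //; rewrite !mul0r.
  by rewrite coef0 ltn_eqF ?mul0r // (leq_trans dm) ?leq_addl.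
under eq_bigr do rewrite E; rewrite -mulr_suml.
have [mp|mp] := boolP (m \in msupp p); last by rewrite (memN_msupp_eq0 mp) coef0 mulr0.
have [si|ltis] := leqP (size p@_m) i; first by rewrite nth_default ?mulr0.
have lt : (i + mdeg m < N)%N.
  apply: (@leq_trans (mdeg m + size p@_m)); first by rewrite addnC ltn_add2l.
  apply: leq_trans leN.
  exact: (leq_bigmax_seq (F := fun m' => (mdeg m' + size p@_m')%N)).
rewrite (bigD1 (Ordinal lt)) //= eqxx big1 ?addr0 ?mul1r // => d.
by rewrite -val_eqE /= => /negPf ->.
Qed.

(** The action of the scalar [2] of [G_m]; as [2] is not a root of unity, it
    separates the weights. *)
Definition dilate : {mpoly R[6]} -> {mpoly R[6]} :=
  affine 2%:R (fun=> 0) \o map_mpoly (comp_poly (2%:R *: 'X)).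

HB.instance Definition _ := GRing.RMorphism.on dilate.

Lemma mcoeff_dilate p m : (dilate p)@_m = 2%:R ^+ mdeg m * (p@_m \Po (2%:R *: 'X)).
Proof.
rewrite -(extend_coef (idfun : R -> R)) (@extend_homothety _ _ idfun _ (mdeg m)).
  by rewrite extend_coef mcoeff_map_mpoly.
by move=> m'; apply: contraNeq => /eqP; case: eqP => [->|].
Qed.

Lemma dilateZ c p : dilate (kappa c *: p) = kappa c *: dilate p.
Proof.
apply/mpolyP => m; rewrite mcoeffZ !mcoeff_dilate mcoeffZ rmorphM /= comp_polyC.
by rewrite mulrCA.
Qed.

Lemma dilate_weight_part d p : dilate (weight_part d p) = kappa (2%:R ^+ d) *: weight_part d p.
Proof.
apply/mpolyP => m; rewrite mcoeffZ mcoeff_dilate !mcoeff_weight_part /weight_coef.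
case: leqP => md; last by rewrite comp_poly0 !mulr0.
have -> : kappa (2%:R ^+ d) = 2%:R ^+ mdeg m * 2%:R ^+ (d - mdeg m).
  by rewrite -exprD subnKC // rmorphXn rmorph_nat.
rewrite rmorphM /= comp_polyC rmorphXn /= comp_polyX exprZn.
by rewrite -mul_polyC rmorphXn rmorph_nat; ring.
Qed.

(** The dilation multiplies the weight components by the distinct scalars
    [2 ^ d], so each of them is a combination of the iterated transforms of
    [p]. *)
Lemma weight_part_mem (J : {mpoly R[6]} -> Prop) :
  [pchar k] =i pred0 -> is_ideal J -> (forall p, J p -> J (dilate p)) ->
  forall p, J p -> forall d, J (weight_part d p).
Proof.
move=> k0 iJ dJ p Jp d.
have n2 (a b : nat) : (a < b)%N -> (2%:R ^+ a - 2%:R ^+ b : k) != 0.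
  move=> ab; rewrite -!natrX -(opprB _%:R) oppr_eq0 -natrB ?leq_exp2l ?(ltnW ab) //.
  have -> : ((2 ^ b - 2 ^ a)%:R == 0 :> k) = (2 ^ b - 2 ^ a == 0)%N by rewrite ((pcharf0P k).1 k0).
  by rewrite subn_eq0 -ltnNge ltn_exp2l.
have unitJ c q : c != 0 -> J (kappa c *: q) -> J q.
  move=> c0 Jq; rewrite -[q]scale1r -(rmorph1 kappa) -(mulVf c0) rmorphM -scalerA.
  exact: ideal_scale.
(* Subtracting [2 ^ N] times the sum from its transform removes the top
   component and keeps the other coefficients nonzero. *)
have key N : forall c : nat -> k, (forall d, (d < N)%N -> c d != 0) ->
    J (\sum_(d < N) kappa (c d) *: weight_part d p) ->
    forall d, (d < N)%N -> J (weight_part d p).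
  elim: N => [//|N ih] c c0 JS.
  have hlt : forall d, (d < N)%N -> J (weight_part d p).
    apply: (ih (fun d => c d * (2%:R ^+ d - 2%:R ^+ N))) => [e eN|].
      by rewrite mulf_neq0 ?n2 ?c0 // ltnW.
    have := ideal_sub iJ (dJ _ JS) (ideal_scale (kappa (2%:R ^+ N)) iJ JS).
    rewrite (raddf_sum dilate) scaler_sumr -sumrB big_ord_recr /=.
    rewrite dilateZ dilate_weight_part !scalerA [_ * kappa (c N)]mulrC subrr addr0.
    congr (J _); apply: eq_bigr => e _; rewrite dilateZ dilate_weight_part !scalerA.
    by rewrite -scalerBl [_ * kappa (c e)]mulrC -mulrBr -rmorphB -rmorphM.
  move=> e; rewrite ltnS leq_eqVlt => /orP[/eqP ->|]; last exact: hlt.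
  apply: (unitJ (c N)); first exact: c0.
  move: JS; rewrite big_ord_recr /= => /(ideal_sub iJ).
  have JN : J (\sum_(d < N) kappa (c d) *: weight_part d p).
    by apply: ideal_sum => // i; apply: ideal_scale => //; apply: hlt.
  by move=> /(_ _ JN); rewrite addrAC subrr add0r.
have [n pN] := weight_part_sum p.
apply: (key (maxn n d.+1) (fun=> 1)) => [e _||]; first exact: oner_neq0.
  by under eq_bigr do rewrite rmorph1 scale1r; rewrite -pN ?leq_maxl.
exact: leq_maxr.
Qed.

End Weights.

(** * The polynomial ring as an algebra over the ground field *)

(** A copy of [{poly A}] that is an algebra over [k] rather than over [A]. *)
Definition polyalg (k : fieldType) (A : comAlgType k) : Type := {poly A}.

Section PolyAlg.
Variables (k : fieldType) (A : comAlgType k).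

HB.instance Definition _ := GRing.ComNzRing.copy (polyalg A) {poly A}.

Definition polyalg_scale (c : k) (p : polyalg A) : polyalg A := polyC_alg A c * p.

Fact polyalg_scaleA a b v :
  polyalg_scale a (polyalg_scale b v) = polyalg_scale (a * b) v.
Proof. by rewrite /polyalg_scale mulrA -rmorphM. Qed.
Fact polyalg_scale1 : left_id 1 polyalg_scale.
Proof. by move=> v; rewrite /polyalg_scale rmorph1 mul1r. Qed.
Fact polyalg_scaleDr : right_distributive polyalg_scale +%R.
Proof. by move=> a u v; rewrite /polyalg_scale mulrDr. Qed.
Fact polyalg_scaleDl v : {morph polyalg_scale^~ v : a b / a + b}.
Proof. by move=> a b; rewrite /polyalg_scale rmorphD mulrDl. Qed.

HB.instance Definition _ := GRing.Zmodule_isLmodule.Build k (polyalg A)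
  polyalg_scaleA polyalg_scale1 polyalg_scaleDr polyalg_scaleDl.

Fact polyalg_scaleAl (a : k) (u v : polyalg A) : a *: (u * v) = (a *: u) * v.
Proof. exact: mulrA. Qed.
HB.instance Definition _ := GRing.Lmodule_isLalgebra.Build k (polyalg A) polyalg_scaleAl.
HB.instance Definition _ := GRing.Lalgebra_isComAlgebra.Build k (polyalg A).

Definition polyalgC (x : A) : polyalg A := x%:P.

Fact polyalgC_zmod : zmod_morphism polyalgC.
Proof. exact: polyCB. Qed.
Fact polyalgC_monoid : monoid_morphism polyalgC.
Proof. by split; [exact: polyC1 | exact: polyCM]. Qed.
Fact polyalgC_scalable : scalable polyalgC.
Proof.
move=> c x; rewrite -[c *: polyalgC x]/((c%:A)%:P * x%:P) -polyCM.
by rewrite mulr_algl.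
Qed.
HB.instance Definition _ := GRing.isZmodMorphism.Build A (polyalg A) polyalgC polyalgC_zmod.
HB.instance Definition _ :=
  GRing.isMonoidMorphism.Build A (polyalg A) polyalgC polyalgC_monoid.
HB.instance Definition _ :=
  GRing.isScalable.Build k A (polyalg A) *:%R polyalgC polyalgC_scalable.

End PolyAlg.

(** * Reconstructing the point from a spike *)

Section Spikes.
Variables (k : fieldType) (F g : {mpoly k[6]}) (Q : 'I_6 -> {mpoly k[6]}).
Hypothesis frame : apolar_frame F g Q.
Hypothesis k0 : [pchar k] =i pred0.
Variable A : comAlgType k.
Local Notation R := {poly A}.
Local Notation kappa := (polyC_alg A).
Local Notation ev0 := (horner_eval (0 : A)).
Implicit Types (J : {mpoly R[6]} -> Prop) (p : {mpoly R[6]}).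

Let natk (n : nat) : (n%:R == 0 :> k) = (n == 0)%N.
Proof. exact: (pcharf0P k).1. Qed.

Let ev0_kappa : in_alg A =1 ev0 \o kappa.
Proof. by move=> x; rewrite /= /horner_eval hornerC. Qed.

Definition low_ideal : {mpoly A[6]} -> Prop :=
  deformed_ideal F (in_alg A) (fun=> 0) (fun=> 0) 0.

(** The properties of a spike that are used to recover it: it is stable under
    the action of [2], it has no [t]-torsion, and its fibre at [t = 0] is
    [[I]]. Unlike the vanishing of the barycenter, they are preserved by the
    translations [alpha_i |-> alpha_i + a_i t]. *)
Record flat_deformation J : Prop := FlatDeformation {
  fd_ideal : is_ideal J;
  fd_torsion : forall p, J ('X *: p) -> J p;
  fd_dilate : forall p, J p -> J (dilate p);
  fd_fibre : forall p, J p -> low_ideal (map_mpoly ev0 p);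
  fd_lift : forall f, trunc_ideal F f ->
    exists2 p, J p & map_mpoly ev0 p = map_mpoly (in_alg A) f }.

Let X_regular (c : R) : 'X * c = 0 -> c = 0.
Proof.
move=> h; apply/polyP => i; have := congr1 (fun q : {poly A} => q`_i.+1) h.
by rewrite coefXM !coef0.
Qed.

(** Equivariance is tested at the universal point [t] of [A^1] and at the
    scalar [2]. *)
Lemma spike_flat_deformation J : spike F J -> flat_deformation J.
Proof.
case=> [[hJ _] equiv zero]; have iJ : is_ideal J by case: hJ.
have zero' : eq_ideal (base_change ev0 J) low_ideal.
  apply: eq_ideal_trans (eq_ideal_sym (deformed_ideal0 frame (in_alg A))).
  apply: eq_ideal_trans zero; apply: eq_base_change => // p.
  by rewrite map_poly_id.
split=> // [p|p Jp|p Jp|f If].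
- by apply: hilb13_torsion_free hJ _; apply: X_regular.
- (* At the point [t] of [A^1] the family is itself, at [2 t] it is dilated. *)
  have two : (2%:R : polyalg A) * polyC_alg A 2%:R^-1 = 1.
    by rewrite -(rmorph_nat (polyC_alg A)) -rmorphM mulfV ?rmorph1 // natk.
  have val1 : eq_ideal (value_at (@polyalgC k A) ('X : polyalg A) J) J.
    by apply: base_change_id => // q; rewrite -[RHS]comp_polyXr.
  have : scale (2%:R : polyalg A) (value_at (@polyalgC k A) ('X : polyalg A) J)
      (map_mpoly (comp_poly (2%:R *: 'X)) p).
    apply/(equiv (polyalg A) (@polyalgC k A) _ _ 'X two).
    have e : (fun q : {poly A} => (map_poly (@polyalgC k A) q).[(2%:R : polyalg A) * 'X])
        =1 comp_poly (2%:R *: 'X).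
      move=> q; rewrite /comp_poly; congr (_.[_]).
      by rewrite -mul_polyC rmorph_nat.
    have [_ h] := eq_base_change e (fun q => iff_refl (J q)) (map_mpoly (comp_poly (2%:R *: 'X)) p).
    by apply: h; apply: mem_base_change.
  by rewrite scaleE => /val1.
- by apply/zero'; apply: mem_base_change.
have /zero' : low_ideal (map_mpoly (in_alg A) f).
  by apply/(deformed_ideal0 frame); apply: mem_base_change.
case=> r [c [h [Jh ->]]]; have [q hq] := fin_all_exists2 Jh.
exists (\sum_i map_mpoly polyC (c i) * q i).
  by apply: ideal_sum => // i; apply: ideal_mull => //; apply: hq.
rewrite rmorph_sum; apply: eq_bigr => i _; rewrite rmorphM /= -q0; congr (_ * _).
by apply/mpolyP => m; rewrite !mcoeff_map_mpoly /= /horner_eval hornerC.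
Qed.

Lemma flat_deformation_translate J (a : 'I_6 -> A) : flat_deformation J ->
  flat_deformation (translate (fun i => 'X * (a i)%:P) J).
Proof.
case=> iJ torJ dJ fJ lJ; set h := fun i => _ * _.
have ev_affine h' q : (forall i, ev0 (h' i) = 0) ->
    map_mpoly ev0 (affine 1 h' q) = map_mpoly ev0 q.
  by move=> h0; rewrite map_affine1 -[RHS]affine_id; apply: eq_affine.
have evh i : ev0 (h i) = 0 by rewrite /horner_eval hornerM hornerX mul0r.
have dilate_h q : dilate (affine 1 h q) = affine 1 h (dilate q).
  apply: (map_affine_scale (rho := comp_poly (2%:R *: 'X))) => i /=.
  by rewrite comp_polyM comp_polyX comp_polyC -mul_polyC rmorph_nat mulrA.
split=> [|p|p|p|f If]; rewrite ?translateE.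
- exact: translate_ideal.
- by rewrite affineZ; apply: torJ.
- by rewrite -dilate_h; apply: dJ.
- by move=> /fJ; rewrite ev_affine.
have [q Jq eq] := lJ f If; exists (affine 1 (fun i => - h i) q).
  rewrite translateE affine_comp mulr1 (eq_affine _ (h' := fun=> 0)) ?affine_id //.
  by move=> i; rewrite mul1r subrr.
by rewrite ev_affine // => i; rewrite /horner_eval hornerN -[_.[0]]/(ev0 (h i)) evh oppr0.
Qed.

Section Deformation.
Variable J : {mpoly R[6]} -> Prop.
Hypothesis fd : flat_deformation J.
Let iJ : is_ideal J := fd_ideal fd.

Lemma fd_weight p d : J p -> J (weight_part d p).
Proof. by move=> Jp; apply: (weight_part_mem k0 iJ (fd_dilate fd)). Qed.

(** The lift may be replaced by its component of weight [d], where the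
    coefficient of [alpha^m] is a multiple of [t ^ (d - mdeg m)]. *)
Lemma fd_homogeneous_lift d f : trunc_ideal F f -> f \is d.-homog ->
  exists p, [/\ J p, forall m, exists x, p@_m = if (mdeg m <= d)%N
                                               then x%:P * 'X^(d - mdeg m) else 0
     & forall m, mdeg m = d -> p@_m = kappa f@_m].
Proof.
move=> If hf; have [p Jp ep] := fd_lift fd If; exists (weight_part d p).
split=> [|m|m dm]; first exact: fd_weight.
  by rewrite mcoeff_weight_part /weight_coef; exists (p@_m)`_(d - mdeg m).
rewrite mcoeff_weight_part /weight_coef dm leqnn subnn expr0 mulr1.
congr (_%:P); rewrite -horner_coef0 -[LHS]/(ev0 p@_m) -mcoeff_map_mpoly ep.
by rewrite mcoeff_map_mpoly.
Qed.

(** The monomials [1], [alpha_i] and the [Q_i] are independent over [A[t]]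
    modulo [J]: divide a relation by [t] as often as possible and
    specialise. *)
Lemma fd_independent D B C :
  J (combination g Q kappa D C B 0) ->
  [/\ D = 0, forall i, C i = 0 & forall i, B i = 0].
Proof.
have leS (f : 'I_6 -> R) i : (size (f i) <= \sum_j size (f j))%N.
  by rewrite (bigD1 i) //= leq_addr.
have [n] : exists n, [/\ (size D <= n)%N, forall i, (size (C i) <= n)%N
                      & forall i, (size (B i) <= n)%N].
  exists (size D + \sum_i size (C i) + \sum_i size (B i))%N; split=> [|i|i].
  - by rewrite -addnA leq_addr.
  - by apply: leq_trans (leS _ i) _; rewrite addnAC leq_addl.
  - by apply: leq_trans (leS _ i) _; rewrite leq_addl.
elim: n D B C => [|n ih] D B C [sD sC sB] JG.
  by split=> [|i|i]; apply/eqP; rewrite -size_poly_leq0.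
have [h1 hX hQ] := fd_fibre fd JG.
have D0 : ev0 D = 0.
  by move: h1; rewrite (extend_map _ _ ev0_kappa) (coordsE frame) mulr0.
have C0 i : ev0 (C i) = 0.
  by move: (hX i); rewrite (extend_map _ _ ev0_kappa) (coordsE frame) mulr0.
have B0 i : ev0 (B i) = 0.
  by move: (hQ i); rewrite (extend_map _ _ ev0_kappa) (coordsE frame) mulr0.
have div (c : R) : ev0 c = 0 -> (size c <= n.+1)%N ->
    exists2 c', c = 'X * c' & (size c' <= n)%N.
  move=> c0 sc; have [c' e] : exists c', c = c' * 'X.
    have /factor_theorem[c' ->] : root c 0 by apply/eqP.
    by exists c'; rewrite subr0.
  exists c'; first by rewrite e mulrC.
  have [->|c'0] := eqVneq c' 0; first by rewrite size_poly0.
  by move: sc; rewrite e size_mulX.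
have [D' eD sD'] := div _ D0 sD.
have [C' eC sC'] := fin_all_exists2 (fun i => div (C i) (C0 i) (sC i)).
have [B' eB sB'] := fin_all_exists2 (fun i => div (B i) (B0 i) (sB i)).
have [] := ih D' B' C'; first by split.
  apply: (fd_torsion fd); move: JG; rewrite eD (eq_combination _ _ _ _ _ eC eB).
  congr (J _); rewrite /combination !scale0r !addr0 !scalerDr !scaler_sumr.
  rewrite mpolyCM mul_mpolyC; congr (_ + _ + _).
    by apply: eq_bigr => i _; rewrite scalerA.
  by apply: eq_bigr => i _; rewrite scalerA.
move=> D'0 C'0 B'0; split=> [|i|i].
- by rewrite eD D'0 mulr0.
- by rewrite eC C'0 mulr0.
- by rewrite eB B'0 mulr0.
Qed.

(** Modulo [perp F], hence modulo [J], the polynomial [p] is its normal form,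
    to which the independence of [1], [alpha_i], [Q_i] applies. *)
Lemma fd_coords0 p : (forall f, perp F f -> J (map_mpoly kappa f)) ->
  J p -> extend kappa (wtg F) p = 0 ->
  [/\ extend kappa (@wt1 k) p = 0, forall i, extend kappa (@wtX k i) p = 0
    & forall i, extend kappa (wtQ F i) p = 0].
Proof.
move=> perpJ Jp pg; apply: fd_independent.
have : J (normal_form F g Q kappa p).
  rewrite -[normal_form _ _ _ _ _](subKr p); apply: ideal_sub => //.
  exact: base_change_sub iJ perpJ _ (sub_normal_form frame _ _).
by rewrite /normal_form pg.
Qed.

(** The homogeneous lift of a quadric of [perp F] has only terms of degree at
    most two in the [alpha_i]. *)
Lemma fd_quadric q : perp F q -> q \is 2.-homog ->
  exists (l : 'I_6 -> A) (c : A),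
    J (map_mpoly kappa q + 'X *: (map_mpoly polyC (\sum_i l i *: 'X_i)
                                  + ('X * c%:P)%:MP)).
Proof.
move=> pq hq; have Iq : trunc_ideal F q.
  by exists q, 0; rewrite addr0; split=> // m; rewrite mcoeff_msupp mcoeff0 eqxx.
have [p [Jp cp c2]] := fd_homogeneous_lift Iq hq.
have [l hl] : exists l : 'I_6 -> A, forall i, p@_U_(i) = (l i)%:P * 'X.
  apply: (fin_all_exists (P := fun i (x : A) => p@_U_(i) = x%:P * 'X)) => i.
  by have [x] := cp U_(i)%MM; rewrite mdeg1 /= expr1; exists x.
have [c hc] := cp 0%MM; rewrite mdeg0 /= in hc.
have q_0 m : mdeg m != 2%N -> (map_mpoly kappa q)@_m = 0.
  by move=> ne; rewrite mcoeff_map_mpoly (dhomog_nemf_coeff hq) // raddf0.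
pose L : {mpoly A[6]} := \sum_i l i *: 'X_i.
have LU i : L@_U_(i) = l i.
  rewrite raddf_sum (bigD1 i) //= mcoeffZ mcoeffX eqxx mulr1 big1 ?addr0 // => j ji.
  by rewrite mcoeffZ mcoeffX eq_mnm1 (negPf ji) mulr0.
have L0 m : mdeg m != 1%N -> L@_m = 0.
  move=> m1; rewrite raddf_sum big1 // => i _ /=; rewrite mcoeffZ mcoeffX.
  by case: eqP => [e|]; [rewrite -e mdeg1 in m1 | rewrite mulr0].
exists l, c; move: Jp; congr (J _); apply/mpolyP => m; rewrite -/L.
rewrite mcoeffD mcoeffZ mcoeffD [(map_mpoly polyC _)@_m]mcoeff_map_mpoly mcoeffC /=.
have [m0|m0] := eqVneq m 0%MM.
  rewrite m0 hc q_0 ?mdeg0 // add0r mulr1 L0 ?mdeg0 // polyC0 add0r.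
  by rewrite ?subn0; ring.
rewrite mulr0 addr0; have [/eqP/mdeg1P[i /eqP mi]|m1] := eqVneq (mdeg m) 1%N.
  by rewrite mi hl q_0 ?mdeg1 // add0r mulrC LU.
rewrite L0 // polyC0 mulr0 addr0.
have [m2|m2] := eqVneq (mdeg m) 2%N; first by rewrite mcoeff_map_mpoly c2.
have [x ->] := cp m; rewrite q_0 // leqNgt.
suff -> : (2 < mdeg m)%N by [].
by move: m0 m1 m2; rewrite -mdeg_eq0; case: (mdeg m) => [|[|[|]]].
Qed.

(** An ideal containing [perp F] is generated by one further element, whose
    multiples by the [alpha_j] give the equations of a point of the apolar
    algebra. *)
Lemma fd_point : (forall f, perp F f -> J (map_mpoly kappa f)) ->
  exists (b c : 'I_6 -> A) (d : A), apolar_point F (in_alg A) b c d /\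
    eq_ideal J (deformed_ideal F kappa (fun i => 'X * (b i)%:P)
                  (fun i => 'X^2 * (c i)%:P) ('X^3 * d%:P)).
Proof.
move=> perpJ; case: (frame) => _ hg _ hgF _.
have Ig : trunc_ideal F g.
  by exists 0, g; rewrite add0r; split=> [|m /(dhomog_mf hg) /= ->|//]; rewrite ?/perp ?hook0l.
have [p [Jp cp c3]] := fd_homogeneous_lift Ig hg.
have ext e (w : 'X_{1..6} -> k) : (e <= 3)%N -> (forall m, mdeg m != e -> w m = 0) ->
    exists a : A, extend kappa w p = 'X^(3 - e) * a%:P.
  move=> e3 we; rewrite extend.unlock; elim/big_rec: _ => [|m x _ [a ->]].
    by exists 0; rewrite mulr0.
  have [me|/we ->] := eqVneq (mdeg m) e; last by exists a; rewrite rmorph0 mulr0 add0r.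
  have [y] := cp m; rewrite me e3 => ->; exists (y * in_alg A (w m) + a).
  by rewrite rmorphD mulrDr rmorphM /=; congr (_ + _); rewrite mulrAC mulrC.
have [d hd] := ext 0%N _ isT (@wt1_supp k).
have [c hc] := fin_all_exists (fun i => ext 1%N _ isT (@wtX_supp k i)).
have [b hb] := fin_all_exists (fun i => ext 2%N _ isT (wtQ_supp frame i)).
have hg3 : extend kappa (wtg F) p = 1.
  rewrite -(cg_g frame kappa).
  apply/eqP; rewrite -subr_eq0 -extendB extend.unlock big1 // => m _.
  have [m3|m3] := eqVneq (mdeg m) 3%N; last by rewrite (wtg_supp frame) ?rmorph0 ?mulr0.
  by rewrite mcoeffB mcoeff_map_mpoly c3 // subrr mul0r.
pose D := 'X^3 * d%:P; pose C i := 'X^2 * (c i)%:P; pose B i := 'X * (b i)%:P.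
pose G := combination g Q kappa D C B 1.
have JG : J G.
  have -> : G = p - (p - normal_form F g Q kappa p).
    rewrite subKr /normal_form hg3 hd /G; apply: eq_combination => i; first by rewrite hc.
    by rewrite hb.
  apply: ideal_sub => //; exact: base_change_sub iJ perpJ _ (sub_normal_form frame _ _).
(* The coordinate of [alpha_j G - B_j G] on [g] is zero, so its other
   coordinates vanish; these are the equations of a point. *)
have ptR : apolar_point F kappa B C D.
  have rel j : [/\ - (B j * D) = 0, forall i, (j == i)%:R * D - B j * C i = 0
      & forall i, \sum_l kappa (cubic_form F i j l) * C l - B j * B i = 0].
    have [||h1 hX hQ] := @fd_coords0 ('X_j * G - B j *: G) perpJ.
    - by apply: ideal_sub => //; [apply: ideal_mull | apply: ideal_scale].
    - by rewrite extendB extendZ cg_mulX /G !(coordsE frame) mulr1 subrr.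
    split=> [|i|i].
    - by move: h1; rewrite extendB extendZ c1_mulX /G !(coordsE frame) sub0r.
    - by move: (hX i); rewrite extendB extendZ cX_mulX /G !(coordsE frame).
    move: (hQ i); rewrite extendB extendZ (cQ_mulX frame) /G !(coordsE frame).
    by under eq_bigr do rewrite (coordsE frame).
  split=> [i j|i j|j]; have [h1 hX hQ] := rel j.
  - by apply/eqP; rewrite eq_sym -subr_eq0 hQ.
  - by apply/eqP; rewrite eq_sym -subr_eq0 hX.
  by apply/eqP; rewrite -oppr_eq0 h1.
have cancel n (x y : A) : 'X^n * x%:P = 'X^n * y%:P -> x = y.
  move=> /(congr1 (fun q : {poly A} => q`_n)).
  by rewrite !coefXnM ltnn subnn !coefC.
exists b, c, d; split.
  case: ptR => BB BC BD; split=> [i j|i j|j].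
  - apply: (cancel 2%N); move: (BB i j); rewrite /B /C rmorphM rmorph_sum /=.
    rewrite mulr_sumr => e; transitivity ('X * (b j)%:P * ('X * (b i)%:P)); first by ring.
    by rewrite e; apply: eq_bigr => l _; rewrite rmorphM mulrCA.
  - apply: (cancel 3%N); move: (BC i j); rewrite /B /C /D !rmorphM rmorph_nat /= => e.
    transitivity ('X * (b j)%:P * ('X^2 * (c i)%:P)); first by ring.
    by rewrite e mulrCA.
  - apply: (cancel 4%N); move: (BD j); rewrite /B /D rmorphM /= => e.
    by rewrite polyC0 mulr0 -e; ring.
move=> r; split=> [Jr|].
  have [||h1 hX hQ] := @fd_coords0 (r - extend kappa (wtg F) r *: G) perpJ.
  - by apply: ideal_sub => //; apply: ideal_scale.
  - by rewrite extendB extendZ /G (coordsE frame) mulr1 subrr.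
  split=> [|i|i]; apply/eqP; rewrite -subr_eq0; apply/eqP.
  - by move: h1; rewrite extendB extendZ /G (coordsE frame).
  - by move: (hX i); rewrite extendB extendZ /G (coordsE frame).
  - by move: (hQ i); rewrite extendB extendZ /G (coordsE frame).
move/(deformed_idealE frame ptR); apply: ideal_gen_sub => // s [[f pf ->]|->//].
exact: perpJ.
Qed.

End Deformation.
End Spikes.

(** * Classification of the spikes *)

Lemma meval_homog (R : comNzRingType) d (x : R) (y : 'I_6 -> R) (p : {mpoly R[6]}) :
  p \is d.-homog -> p.@[fun i => x * y i] = x ^+ d * p.@[y].
Proof.
move=> hp; rewrite !mevalE mulr_sumr !big_seq; apply: eq_bigr => e /(dhomog_mf hp) /= <-.
rewrite mulrCA mdegE expr_sum -big_split; congr (_ * _).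
by apply: eq_bigr => i _; rewrite exprMn.
Qed.

Lemma meval_map (R S : comNzRingType) (rho : {rmorphism R -> S}) (y : 'I_6 -> R)
    (p : {mpoly R[6]}) : (map_mpoly rho p).@[fun i => rho (y i)] = rho p.@[y].
Proof.
rewrite -[LHS]/((meval (fun i => rho (y i)) \o map_mpoly rho) p).
rewrite -[RHS]/((rho \o meval y) p); apply: mpoly_rmorph_ext p => [c|i] /=.
  by rewrite map_mpolyC !mevalC.
by rewrite map_mpolyX !mevalXU.
Qed.

Lemma mderiv_map (R S : comNzRingType) (rho : {rmorphism R -> S}) i (p : {mpoly R[6]}) :
  (map_mpoly rho p)^`M(i) = map_mpoly rho (p^`M(i)).
Proof.
apply/mpolyP => e; rewrite mcoeff_deriv !mcoeff_map_mpoly mcoeff_deriv.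
by rewrite raddfMn.
Qed.

Section Classification.
Variables (k : fieldType) (F g : {mpoly k[6]}) (Q : 'I_6 -> {mpoly k[6]}).
Hypothesis frame : apolar_frame F g Q.
Hypothesis k0 : [pchar k] =i pred0.
Hypothesis hneg : hom_neg_dim (perp F) (perp F) 6.
Variables (n m : nat) (q : 'I_n -> {mpoly k[6]}) (D : 'I_m -> 'I_n -> {mpoly k[6]}).
Hypothesis pres : linear_presentation F q D.

Let natk (e : nat) : (e%:R == 0 :> k) = (e == 0)%N.
Proof. exact: (pcharf0P k).1. Qed.

Let k2 : 2%:R != 0 :> k. Proof. by rewrite natk. Qed.
Let k13 : 13%:R != 0 :> k. Proof. by rewrite natk. Qed.

(** The condition is a linear system over [k], whose injectivity is preserved by
    extension of scalars. *)
Lemma no_invariant_direction_over (R : comNzRingType) (kappa : {rmorphism k -> R})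
    (h : 'I_6 -> R) :
  (forall j l, \sum_i h i * kappa (((q j)^`M(i))@_U_(l)) = 0) -> forall i, h i = 0.
Proof.
move=> hh; apply: (@injective_transfer _ _ kappa _ ('I_n * 'I_6)%type
    (fun i jl => ((q jl.1)^`M(i))@_U_(jl.2))) => [v hv|jl]; last exact: hh.
apply: (no_invariant_direction frame pres k2) => j; apply/mpolyP => l.
rewrite mcoeff0 raddf_sum /=; under eq_bigr do rewrite mcoeffZ.
have [/eqP/mdeg1P[i /eqP ->]|l1] := eqVneq (mdeg l) 1%N; first exact: (hv (j, i)).
case: pres => hq _ _ _; rewrite big1 // => i _.
rewrite mcoeff_deriv (dhomog_nemf_coeff (hq j)) ?mul0rn ?mulr0 //=.
by rewrite mdegD mdeg1 addn1 eqSS.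
Qed.

Lemma syzygy r : \sum_j D r j * q j = 0.
Proof.
case: pres => _ _ _ syz; apply/syz; exists (fun r' => (r' == r)%:R) => j.
rewrite (bigD1 r) //= eqxx mul1r big1 ?addr0 // => r' /negPf ->.
by rewrite mul0r.
Qed.

Lemma extend_linear_syzygy (R : comNzRingType) (kappa : {rmorphism k -> R}) w
    (x : 'I_n * 'I_6 -> R) r :
  extend kappa w (\sum_j map_mpoly kappa (D r j) * (\sum_l x (j, l) *: 'X_l)) =
  \sum_jl x jl * kappa (extend idfun w (D r jl.1 * 'X_(jl.2))).
Proof.
rewrite [RHS](eq_bigr (fun jl => x (jl.1, jl.2) *
    kappa (extend idfun w (D r jl.1 * 'X_(jl.2))))) => [|[]//].
rewrite -(pair_bigA _ (fun j l => x (j, l) * kappa (extend idfun w (D r j * 'X_l)))) /=.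
rewrite raddf_sum; apply: eq_bigr => j _; rewrite mulr_sumr raddf_sum.
apply: eq_bigr => l _; rewrite /= -scalerAr extendZ; congr (_ * _).
by rewrite -(extend_map (kappa := idfun) (kappa' := kappa)) // rmorphM /= map_mpolyX.
Qed.

Lemma extend_constant_syzygy (R : comNzRingType) (kappa : {rmorphism k -> R}) w
    (x : 'I_n -> R) r :
  extend kappa w (\sum_j map_mpoly kappa (D r j) * (x j)%:MP) =
  \sum_j x j * kappa (extend idfun w (D r j)).
Proof.
rewrite raddf_sum; apply: eq_bigr => j _ /=; rewrite mulrC mul_mpolyC extendZ.
by rewrite (extend_map (kappa := idfun)).
Qed.

(** The linear system over [k] satisfied by the linear parts of the lifts of the
    quadrics; it is stated in coordinates so that its solutions can be
    transferred to any [k]-algebra. *)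
Lemma linear_coeffs (v : 'I_n * 'I_6 -> k) :
  (forall ri : 'I_m * 'I_6,
     \sum_jl v jl * extend idfun (wtQ F ri.2) (D ri.1 jl.1 * 'X_(jl.2)) = 0) ->
  exists a : 'I_6 -> k, forall jl, v jl = \sum_i a i * ((q jl.1)^`M(i))@_U_(jl.2).
Proof.
case: pres => _ hD _ _ hv; have idE f : map_mpoly (idfun : k -> k) f = f :> {mpoly k[6]}.
  by apply/mpolyP => l; rewrite mcoeff_map_mpoly.
pose w j : {mpoly k[6]} := \sum_l v (j, l) *: 'X_l.
have hw j : w j \is 1.-homog.
  by apply: rpred_sum => l _; apply: rpredZ; rewrite dhomogX /= mdeg1.
have [//|//|r|a ha] := @syzygy_compatible _ _ _ _ frame _ _ _ _ pres 0 w k2 hneg.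
  have hom : \sum_j D r j * w j \is 2.-homog.
    by apply: rpred_sum => j _; apply: (@dhomogM _ _ _ 1 _ 1).
  have E e w' : 2%N != e -> (forall m, mdeg m != e -> w' m = 0) ->
      extend (idfun : k -> k) w' (\sum_j D r j * w j) = 0.
    by move=> e2 we; apply: extend_eq0 => l /(dhomog_mf hom) /= l2; apply: we; rewrite l2.
  apply/(perpE frame); split=> [|i|i|].
  - by apply: (E 0%N) => //; apply: wt1_supp.
  - by apply: (E 1%N) => //; apply: wtX_supp.
  - rewrite -[RHS](hv (r, i)) -(extend_linear_syzygy idfun).
    by congr (extend _ _ _); apply: eq_bigr => j _; rewrite idE.
  - by apply: (E 3%N) => //; apply: (wtg_supp frame).
exists a => -[j l] /=; have := congr1 (mcoeff U_(l)) (ha j).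
rewrite !raddf_sum (bigD1 l) //= mcoeffZ mcoeffX eqxx mulr1 big1 ?addr0 => [->|i ne].
  by apply: eq_bigr => i _; rewrite mcoeffZ.
by rewrite mcoeffZ mcoeffX eq_mnm1 (negPf ne) mulr0.
Qed.

(** In degree [-2] a compatible family is again a combination of the partial
    derivatives, which are linear, so it vanishes. *)
Lemma constant_coeffs (v : 'I_n -> k) :
  (forall ri : 'I_m * 'I_6, \sum_j v j * extend idfun (@wtX k ri.2) (D ri.1 j) = 0) ->
  forall j, v j = 0.
Proof.
case: pres => hq hD _ _ hv.
have hw j : (v j)%:MP \is [in k[6], 0.-homog].
  by rewrite -alg_mpolyC; apply: dhomogZ; apply: dhomog1.
have [r|a ha j] := @syzygy_compatible _ _ _ _ frame _ _ _ _ pres 1 _ k2 hneg isT hw.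
  suff -> : \sum_j D r j * (v j)%:MP = 0 by rewrite /perp hook0l.
  apply/mpolyP => l; rewrite mcoeff0.
  have hom : \sum_j D r j * (v j)%:MP \is 1.-homog.
    by apply: rpred_sum => j _; apply: (@dhomogM _ _ _ 1 _ 0).
  have [/eqP/mdeg1P[i /eqP ->]|l1] := eqVneq (mdeg l) 1%N; last first.
    exact: (dhomog_nemf_coeff hom).
  rewrite -[RHS](hv (r, i)) raddf_sum; apply: eq_bigr => j _ /=.
  by rewrite mulrC mul_mpolyC mcoeffZ cXE.
have := congr1 (mcoeff 0%MM) (ha j); rewrite mcoeffC eqxx mulr1 => ->.
rewrite raddf_sum big1 // => i _ /=.
by rewrite mcoeffZ mcoeff_deriv (dhomog_nemf_coeff (hq j)) ?mul0rn ?mulr0 //= add0m mdeg1.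
Qed.

Section OneAlgebra.
Variable A : comAlgType k.
Local Notation R := {poly A}.
Local Notation kappa := (polyC_alg A).
Local Notation ev0 := (horner_eval (0 : A)).

Let ev0_kappa : in_alg A =1 ev0 \o kappa.
Proof. by move=> x; rewrite /= /horner_eval hornerC. Qed.

(** The linear parts of the lifts of the quadrics are compatible with the
    linear syzygies, hence come from a translation; after this translation
    the same argument kills the constant parts. *)
Lemma fd_translate_perp J : flat_deformation F J ->
  exists a : 'I_6 -> A, forall f, perp F f ->
    translate (fun i => 'X * (a i)%:P) J (map_mpoly kappa f).
Proof.
move=> fd; case: (pres) => hq hD gen _; have iJ := fd_ideal fd.
have lift j : exists lc : ('I_6 -> A) * A,
    J (map_mpoly kappa (q j) + 'X *: (map_mpoly polyC (\sum_i lc.1 i *: 'X_i)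
                                  + ('X * lc.2%:P)%:MP)).
  have [l [c h]] := fd_quadric k0 fd (q_perp pres j) (hq j); by exists (l, c).
have [lc hlc] := fin_all_exists lift; pose l j := (lc j).1; pose c j := (lc j).2.
pose L j : {mpoly A[6]} := \sum_i l j i *: 'X_i.
(* A linear syzygy of the quadrics takes on their lifts a value divisible by
   [t]. *)
have red I (fdI : flat_deformation F I) (s : 'I_n -> {mpoly R[6]}) :
    (forall j, I (map_mpoly kappa (q j) + 'X *: s j)) ->
    forall r, I (\sum_j map_mpoly kappa (D r j) * s j).
  move=> Is r; apply: (fd_torsion fdI).
  have -> : 'X *: (\sum_j map_mpoly kappa (D r j) * s j) =
      \sum_j map_mpoly kappa (D r j) * (map_mpoly kappa (q j) + 'X *: s j).
    under [RHS]eq_bigr do rewrite mulrDr -scalerAr.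
    rewrite big_split /= -scaler_sumr [X in _ = X + _](_ : _ = 0) ?add0r //.
    rewrite -[RHS](rmorph0 (map_mpoly kappa)) -(syzygy r) rmorph_sum.
    by apply: eq_bigr => j _; rewrite rmorphM.
  have iI := fd_ideal fdI.
  by apply: ideal_sum => // j; apply: ideal_mull.
have ev_kappa f : map_mpoly ev0 (map_mpoly kappa f) = map_mpoly (in_alg A) f.
  by apply/mpolyP => l'; rewrite !mcoeff_map_mpoly /= /horner_eval hornerC.
have ev_C (p : {mpoly A[6]}) : map_mpoly ev0 (map_mpoly polyC p) = p.
  by apply/mpolyP => l'; rewrite !mcoeff_map_mpoly /= /horner_eval hornerC.
have ev_XC (x : A) : map_mpoly ev0 ('X * x%:P)%:MP_[6] = 0.
  have e : ev0 ('X * x%:P) = 0 by rewrite /horner_eval hornerM hornerX mul0r.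
  by rewrite map_mpolyC [X in X%:MP]e mpolyC0.
have ev_sum (s : 'I_n -> {mpoly R[6]}) r :
    map_mpoly ev0 (\sum_j map_mpoly kappa (D r j) * s j) =
    \sum_j map_mpoly (in_alg A) (D r j) * map_mpoly ev0 (s j).
  by rewrite rmorph_sum; apply: eq_bigr => j _; rewrite rmorphM /= ev_kappa.
have [a ha] : exists a : 'I_6 -> A, forall jl : 'I_n * 'I_6,
    l jl.1 jl.2 = \sum_i a i * in_alg A (((q jl.1)^`M(i))@_U_(jl.2)).
  apply: (kernel_transfer (kappa := in_alg A) linear_coeffs) => -[r i] /=.
  have [_ _ /(_ i)] := fd_fibre fd (red _ fd _ hlc r); rewrite mulr0 ev_sum => h.
  apply: etrans (esym (extend_linear_syzygy (in_alg A) (wtQ F i)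
    (fun jl => l jl.1 jl.2) r)) _; rewrite -[RHS]h.
  congr (extend _ _ _); apply: eq_bigr => j _; congr (_ * _).
  by rewrite rmorphD /= ev_C ev_XC addr0.
exists a; set h := fun i => 'X * (a i)%:P.
have fd' : flat_deformation F (translate h J) by apply: flat_deformation_translate.
(* By Taylor's formula the translation also changes the constant parts. *)
pose c' j := c j - (map_mpoly (in_alg A) (q j)).@[a].
have Jc j : translate h J (map_mpoly kappa (q j) + 'X *: ('X *: ((c' j)%:P)%:MP)).
  rewrite translateE rmorphD /= !affineZ affineC.
  have hkq : map_mpoly kappa (q j) \is 2.-homog.
    apply/dhomogP => l'; rewrite mcoeff_msupp mcoeff_map_mpoly => nz.
    apply: (dhomog_mf (hq j)); rewrite mcoeff_msupp; apply: contraNneq nz => ->.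
    by rewrite raddf0.
  rewrite (taylor_quadric _ hkq).
  have -> : \sum_i h i *: (map_mpoly kappa (q j))^`M(i) = 'X *: map_mpoly polyC (L j).
    apply/mpolyP => e; rewrite mcoeffZ mcoeff_map_mpoly /= raddf_sum /=.
    have E i : (h i *: (map_mpoly kappa (q j))^`M(i))@_e =
        'X * (a i * in_alg A ((q j)^`M(i)@_e))%:P.
      by rewrite mcoeffZ mderiv_map mcoeff_map_mpoly /h polyCM mulrA.
    under eq_bigr do rewrite E; rewrite -mulr_sumr -rmorph_sum; congr (_ * _%:P).
    have [/eqP/mdeg1P[i /eqP ->]|e1] := eqVneq (mdeg e) 1%N.
      rewrite -(ha (j, i)) /= /L raddf_sum (bigD1 i) //= mcoeffZ mcoeffX eqxx mulr1.
      by rewrite big1 ?addr0 // => i' ne; rewrite mcoeffZ mcoeffX eq_mnm1 (negPf ne) mulr0.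
    rewrite big1 => [|i _].
      rewrite /L raddf_sum big1 // => i _ /=; rewrite mcoeffZ mcoeffX.
      by case: eqP => [e'|]; [rewrite -e' mdeg1 in e1 | rewrite mulr0].
    rewrite mcoeff_deriv (dhomog_nemf_coeff (hq j)) ?mul0rn ?raddf0 ?mulr0 //=.
    by rewrite mdegD mdeg1 addn1 eqSS.
  have -> : (map_mpoly kappa (q j)).@[h] = 'X^2 * ((map_mpoly (in_alg A) (q j)).@[a])%:P.
    have em : map_mpoly kappa (q j) = map_mpoly polyC (map_mpoly (in_alg A) (q j)).
      exact: map_mpoly_compE.
    by rewrite (meval_homog 'X (fun i => (a i)%:P) hkq) em (meval_map polyC).
  move: (hlc j); rewrite -/(c j) -/(L j); congr (J _).
  rewrite scalerDr -!mul_mpolyC -!mpolyCM -!addrA; congr (_ + (_ + _)).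
  by rewrite -mpolyCD /c' rmorphB /=; congr (_%:MP); ring.
have c0 j : c' j = 0.
  apply: (injective_transfer (kappa := in_alg A) constant_coeffs) => -[r i] /=.
  have iJ' := fd_ideal fd'.
  have Jr : translate h J (\sum_j map_mpoly kappa (D r j) * ((c' j)%:P)%:MP).
    apply: (fd_torsion fd'); move: (red _ fd' _ Jc r); congr (translate h J _).
    by rewrite scaler_sumr; apply: eq_bigr => j' _; rewrite -scalerAr.
  have [_ /(_ i) + _] := fd_fibre fd' Jr; rewrite mulr0 ev_sum => e.
  apply: etrans (esym (extend_constant_syzygy (in_alg A) _ c' r)) _; rewrite -[RHS]e.
  congr (extend _ _ _); apply: eq_bigr => j' _; congr (_ * _).
  by rewrite map_mpolyC /= /horner_eval hornerC.
move=> f /gen[v ->]; rewrite rmorph_sum; have iJ' := fd_ideal fd'.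
apply: ideal_sum => // j; rewrite rmorphM; apply: ideal_mull => //.
by move: (Jc j); rewrite c0 mpolyC0 !scaler0 addr0.
Qed.

(** Over any base, spikes are exactly the families attached to the points of
    the apolar algebra: the barycenter condition determines the translation. *)
Lemma spike_is_family J : spike F J ->
  exists b c d, apolar_point F (in_alg A) b c d /\ eq_ideal J (spike_family F b c d).
Proof.
move=> spJ; have fd := spike_flat_deformation frame k0 spJ.
have [a perpJ] := fd_translate_perp fd; set h := fun i => 'X * (a i)%:P in perpJ.
have fd' : flat_deformation F (translate h J) by apply: flat_deformation_translate.
have [b [c [d [pt eJ]]]] := fd_point frame k0 fd' perpJ.
exists b, c, d; split=> //.
set B := fun i => 'X * (b i)%:P in eJ.
set C := fun i => 'X^2 * (c i)%:P in eJ; set D' := 'X^3 * d%:P in eJ.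
have ptR : apolar_point F kappa B C D' by apply: family_point.
have eJ' : eq_ideal J (translate (fun i => - h i) (deformed_ideal F kappa B C D')).
  apply: (eq_ideal_trans (J2 := translate (fun i => - h i) (translate h J))); last first.
    exact: eq_translate.
  apply: eq_ideal_sym; apply: eq_ideal_trans (translate_comp _ _ _) _.
  by apply: eq_ideal_trans (translate0 _); apply: eq_translate => // i; rewrite addNr.
(* The trace of [alpha_i], which is zero, is [- 13 h_i - B_i]. *)
have hB i : - h i = kappa 13%:R^-1 * B i.
  have [[_ bar] _ _] := spJ.
  have lb : local_basis J 1 (translated_basis Q kappa (fun i => - h i)).
    have [gen free] := translated_local_basis frame kappa B C (fun i => - h i) D'.
    split=> [p|x /eJ' /free //].
    by have [e [x hx]] := gen p; exists e, x; apply/eJ'.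
  have [T [hT trT]] := translated_mulX frame kappa B C (fun i => - h i) D' i.
  have [|N] := bar 1 _ lb i 0%N T.
    by move=> j; rewrite expr0 scale1r; apply/eJ'.
  rewrite !expr1n !mul1r !mulr0 subr0 trT => /eqP; rewrite subr_eq0 => /eqP <-.
  by rewrite mulrA -(rmorph_nat kappa) -rmorphM mulVf // rmorph1 mul1r.
apply: eq_ideal_trans eJ' _; apply: eq_translate => //.
Qed.

(** The quadrics [q_j] in the ideal of a family remember the translation, and
    hence the point. *)
Lemma family_inj b c d b' c' d' :
  apolar_point F (in_alg A) b c d -> apolar_point F (in_alg A) b' c' d' ->
  eq_ideal (spike_family F b c d) (spike_family F b' c' d') -> b =1 b'.
Proof.
move=> pt pt' e; case: (pres) => hq _ _ _.
pose s : R := kappa 13%:R^-1.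
have kk : kappa 13%:R * s = 1 by rewrite -rmorphM mulfV // rmorph1.
pose h i := s * ('X * (b' i)%:P) - s * ('X * (b i)%:P).
suff h0 i : h i = 0.
  move=> i; apply/eqP; rewrite eq_sym -subr_eq0; apply/eqP.
  have e0 : 'X * (b' i - b i)%:P = 0.
    have hE : s * ('X * (b' i - b i)%:P) = h i by rewrite polyCB !mulrBr.
    by rewrite -[LHS]mul1r -kk -mulrA hE h0 mulr0.
  have := congr1 (fun p : {poly A} => p`_1) e0.
  by rewrite coefXM coef0 coefC.
apply: (no_invariant_direction_over (kappa := kappa)) => j l.
have hk : map_mpoly kappa (q j) \is 2.-homog.
  apply/dhomogP => l'; rewrite mcoeff_msupp mcoeff_map_mpoly => nz.
  apply: (dhomog_mf (hq j)); rewrite mcoeff_msupp; apply: contraNneq nz => ->.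
  by rewrite raddf0.
(* The translated quadric lies in both ideals; untranslating it by the second
   translation leaves its derivative along the difference. *)
have in_b : spike_family F b c d
    (affine 1 (fun i => - (s * ('X * (b i)%:P))) (map_mpoly kappa (q j))).
  rewrite /spike_family /centered_ideal translateE affine_comp mulr1.
  rewrite (eq_affine _ (h' := fun=> 0)) => [|i']; last by rewrite mul1r subrr.
  rewrite affine_id; apply: apolar_over_deformed.
  exact: (perp_apolar_over frame _ (q_perp pres j)).
have /e := in_b; rewrite /spike_family /centered_ideal translateE affine_comp mulr1.
rewrite (eq_affine _ (h' := h)) => [|i']; last by rewrite mul1r.
rewrite (taylor_quadric _ hk) => -[_ /(_ l) + _].
have cg0 p : (forall m', (2 < mdeg m')%N -> p@_m' = 0) -> extend kappa (wtg F) p = 0.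
  move=> p0; rewrite extend.unlock big1 // => m' _.
  have [m3|m3] := eqVneq (mdeg m') 3%N; first by rewrite p0 ?m3 // mul0r.
  by rewrite (wtg_supp frame) // rmorph0 mulr0.
rewrite cg0 => [|m' m2]; last first.
  rewrite !mcoeffD mcoeffC (dhomog_nemf_coeff hk) ?add0r /= ?gtn_eqF //.
  have [m0|_] := eqVneq m' 0%MM; first by rewrite m0 mdeg0 in m2.
  rewrite mulr0 addr0 raddf_sum big1 // => i' _ /=.
  rewrite mcoeffZ mcoeff_deriv (dhomog_nemf_coeff hk) ?mul0rn ?mulr0 //=.
  by rewrite mdegD mdeg1 addn1 eqSS gtn_eqF // ltnW.
rewrite mul0r cXE !mcoeffD mcoeffC mnm1_eq0 mulr0 addr0.
rewrite (dhomog_nemf_coeff hk) /= ?mdeg1 // add0r raddf_sum => e0; rewrite -[RHS]e0.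
by apply: eq_bigr => i' _; rewrite /= mcoeffZ mderiv_map mcoeff_map_mpoly.
Qed.

End OneAlgebra.
End Classification.

(** * Tangent vectors *)

Section Tangent.
Variables (k : fieldType) (F g : {mpoly k[6]}) (Q : 'I_6 -> {mpoly k[6]}).
Hypothesis frame : apolar_frame F g Q.
Variables (n m : nat) (q : 'I_n -> {mpoly k[6]}) (D : 'I_m -> 'I_n -> {mpoly k[6]}).
Hypothesis pres : linear_presentation F q D.

Let idE f : map_mpoly (idfun : k -> k) f = f :> {mpoly k[6]}.
Proof. by apply/mpolyP => l; rewrite mcoeff_map_mpoly. Qed.

Lemma trunc_ideal_deformed f :
  trunc_ideal F f <-> deformed_ideal F (idfun : k -> k) (fun=> 0) (fun=> 0) 0 f.
Proof.
split=> [/(trunc_idealE frame)[f1 fX fQ]|[f1 fX fQ]].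
  by split=> [|i|i]; rewrite mulr0 // ?c1E ?cXE.
apply/(trunc_idealE frame); split=> [|i|i].
- by rewrite -(c1E idfun) f1 mulr0.
- by rewrite -(cXE idfun) fX mulr0.
- by rewrite fQ mulr0.
Qed.

Lemma trunc_ideal_ideal : is_ideal (trunc_ideal F).
Proof.
have [z a mu] := deformed_ideal_ideal frame (apolar_point0 F (idfun : k -> k)).
split=> [|f h|f h]; first exact/trunc_ideal_deformed.
  by move=> /trunc_ideal_deformed If /trunc_ideal_deformed Ih; apply/trunc_ideal_deformed/a.
by move=> /trunc_ideal_deformed If; apply/trunc_ideal_deformed/mu.
Qed.

(** A homomorphism killing the quadrics, which generate [perp F], and sending
    [g] to [Q_j] depends on [f] through its coordinate on [g]. *)
Lemma frakx_mod x j f : is_frakx F g (Q j) x -> trunc_ideal F f ->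
  trunc_ideal F (x f - extend idfun (wtg F) f *: Q j).
Proof.
have iI := trunc_ideal_ideal; have I0 : trunc_ideal F 0 by case: iI.
case=> -[xD xZ] x2 xg If; case: (pres) => hq _ gen _.
have perpI h : perp F h -> trunc_ideal F h.
  by move=> ph; exists h, 0; rewrite addr0; split=> // l; rewrite mcoeff_msupp mcoeff0 eqxx.
case: (frame) => _ hg _ _ _.
have Ig : trunc_ideal F g.
  exists 0, g; rewrite add0r; split=> // [|l /(dhomog_mf hg) /= ->//].
  exact: hook0l.
have x0 : trunc_ideal F (x 0) by have := xZ 0 0 I0; rewrite !mul0r subr0.
have eqI a b : trunc_ideal F (a - b) -> trunc_ideal F b -> trunc_ideal F a.
  by move=> ab ib; rewrite -[a](subrK b); apply: ideal_add.
have xperp h : perp F h -> trunc_ideal F (x h).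
  case/gen=> v ->.
  suff [] : trunc_ideal F (\sum_j v j * q j) /\ trunc_ideal F (x (\sum_j v j * q j)) by [].
  elim/big_rec: _ => [|l p _ [Ip Ixp]]; first by [].
  have Iq : trunc_ideal F (q l) by apply: perpI; apply: (q_perp pres).
  have Ivq : trunc_ideal F (v l * q l) by apply: ideal_mull.
  split; first exact: ideal_add.
  apply: (eqI _ _ (xD _ _ Ivq Ip)); apply: ideal_add => //.
  apply: (eqI _ _ (xZ _ _ Iq)); apply: ideal_mull => //; apply: x2 => //.
  exact: (q_perp pres).
set c := extend _ _ f.
have p0 : perp F (f - c *: g).
  have/trunc_ideal_deformed[f1 fX fQ] := If.
  have eg w : extend idfun w g =
      extend idfun w (combination g Q (idfun : k -> k) 0 (fun=> 0) (fun=> 0) 1).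
    congr (extend _ _ _).
    by rewrite /combination !big1 => [|i _|i _]; rewrite ?scale0r // !add0r scale1r idE.
  apply/(perpE frame); split=> [|i|i|]; rewrite extendB extendZ eg.
  - by rewrite f1 !mulr0 (c1_combination frame) mulr0 subr0.
  - by rewrite fX !mulr0 (cX_combination frame) mulr0 subr0.
  - by rewrite fQ !mulr0 (cQ_combination frame) mulr0 subr0.
  - by rewrite (cg_combination frame) mulr1 subrr.
have Icg : trunc_ideal F (c *: g) by apply: ideal_scale.
apply: (eqI _ (x f - (x (f - c *: g) + x (c *: g)) + (x (c *: g) - c%:MP * x g)
              + c%:MP * (x g - Q j))).
  have -> : x f - c *: Q j - (x f - (x (f - c *: g) + x (c *: g))
      + (x (c *: g) - c%:MP * x g) + c%:MP * (x g - Q j)) = x (f - c *: g).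
    by rewrite -mul_mpolyC; ring.
  exact: xperp.
apply: ideal_add => //; last exact: ideal_mull.
apply: ideal_add => //; last by rewrite -mul_mpolyC; apply: xZ.
by have := xD _ _ (perpI _ p0) Icg; rewrite subrK.
Qed.

(** The tangent vector [fraky_j] is the point [beta_j |-> - eps] of the apolar
    algebra; its part [partial_j / 13] is the first order translation that
    centers the family. *)
Lemma tangent_centered (A : comAlgType k) (eps : A) (x : 'I_6 -> {mpoly k[6]} -> {mpoly k[6]})
    j (toA := map_mpoly (in_alg A)) :
  eps * eps = 0 -> is_frakx F g (Q j) (x j) ->
  eq_ideal
    (centered_ideal F (in_alg A) (fun i => - ((i == j)%:R * eps)) (fun=> 0) 0)
    (ideal_gen (fun p => exists2 f, trunc_ideal F f &
       p = toA f - eps *: toA (fraky x j f))).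
Proof.
move=> ee hx; set B := fun i => - _; set G := fun p => exists2 f, _ & _.
have iI := trunc_ideal_ideal; have iG := ideal_genP G.
have pt : apolar_point F (in_alg A) B (fun=> 0) 0.
  split=> [i l|i l|l]; rewrite ?mulr0 //.
  rewrite big1 => [|l' _]; last by rewrite mulr0.
  by rewrite /B mulrNN mulrACA ee mulr0.
pose s : A := in_alg A 13%:R^-1.
pose h i := s * B i.
have epsh i : eps * h i = 0.
  by rewrite /h /B mulrCA mulrN mulrCA ee !mulr0 oppr0 mulr0.
have hh c i l : c * h i * (c * h l) = 0.
  rewrite /h /B; move: (i == j)%:R (l == j)%:R => u v.
  have -> : c * (s * - (u * eps)) * (c * (s * - (v * eps))) =
      c * c * s * s * u * v * (eps * eps) by ring.
  by rewrite ee mulr0.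
have taylor c f : affine 1 (fun i => c * h i) (toA f) =
    toA f - (c * (s * eps)) *: toA (f^`M(j)).
  rewrite taylor_square_zero; last exact: hh.
  congr (_ + _); rewrite (bigD1 j) //= big1 ?addr0 => [|i /negPf ij].
    by rewrite /h /B eqxx mul1r mderiv_map !mulrN scaleNr.
  by rewrite /h /B ij mul0r oppr0 !mulr0 scale0r.
have taylor1 f : affine 1 (fun i => 1 * h i) (toA f) = toA f - (s * eps) *: toA (f^`M(j)).
  by rewrite taylor mul1r.
have taylorN f : affine 1 (fun i => -1 * h i) (toA f) = toA f + (s * eps) *: toA (f^`M(j)).
  by rewrite taylor mulN1r scaleNr opprK.
have taylor_eps c p : affine 1 (fun i => c * h i) (eps *: p) = eps *: p.
  rewrite affineZ taylor_square_zero; last exact: hh.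
  rewrite scalerDr scaler_sumr big1 ?addr0 // => i _.
  by rewrite scalerA mulrCA epsh mulr0 scale0r.
have toAB : {morph toA : a b / a - b} by move=> a b; rewrite /toA rmorphB.
have toAZ c f : toA (c *: f) = in_alg A c *: toA f by rewrite /toA map_mpolyZ.
have frakyE f : eps *: toA (fraky x j f) = eps *: toA (x j f) - (s * eps) *: toA (f^`M(j)).
  by rewrite /fraky toAB toAZ scalerBr scalerA [eps * _]mulrC.
have epsI i : trunc_ideal F i -> ideal_gen G (eps *: toA i).
  move=> Ii; have : ideal_gen G (eps *: (toA i - eps *: toA (fraky x j i))).
    by apply: ideal_scale => //; apply: mem_ideal_gen; exists i.
  by rewrite scalerBr scalerA ee scale0r subr0.
have h1 p : translate h (deformed_ideal F (in_alg A) B (fun=> 0) 0) p <->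
    deformed_ideal F (in_alg A) B (fun=> 0) 0 (affine 1 (fun i => 1 * h i) p).
  by rewrite translateE (eq_affine 1 (h' := fun i => 1 * h i)) // => i; rewrite mul1r.
have gen0 r : deformed_ideal F (in_alg A) B (fun=> 0) 0 r ->
    ideal_gen G (affine 1 (fun i => -1 * h i) r).
  move=> /(deformed_idealE frame pt); rewrite -translateE.
  apply: ideal_gen_sub; first exact: translate_ideal.
  move=> {}r [[f pf ->]|->]; rewrite translateE.
    have If : trunc_ideal F f.
      by exists f, 0; rewrite addr0; split=> // l; rewrite mcoeff_msupp mcoeff0 eqxx.
    have Ixf : trunc_ideal F (x j f).
      have := frakx_mod hx If; case/(perpE frame): pf => _ _ _ ->.
      by rewrite scale0r subr0.
    have -> : affine 1 (fun i => -1 * h i) (toA f) =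
        (toA f - eps *: toA (fraky x j f)) + eps *: toA (x j f).
      by rewrite taylorN frakyE opprB addrA subrK.
    by apply: ideal_add => //; [apply: mem_ideal_gen; exists f | apply: epsI].
  have -> : combination g Q (in_alg A) 0 (fun=> 0) B 1 = toA g - eps *: toA (Q j).
    rewrite /combination scale1r big1 ?addr0 => [|i _]; last by rewrite scale0r.
    rewrite mpolyC0 !add0r addrC; congr (_ + _); rewrite (bigD1 j) //=.
    rewrite big1 ?addr0 => [|i /negPf ij]; last by rewrite /B ij mul0r oppr0 scale0r.
    by rewrite /B eqxx mul1r scaleNr.
  case: (frame) => _ hg _ _ _.
  have Ig : trunc_ideal F g.
    exists 0, g; rewrite add0r; split=> // [|l /(dhomog_mf hg) /= ->//].
    exact: hook0l.
  have Ixg : trunc_ideal F (x j g - Q j) by case: hx.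
  have -> : affine 1 (fun i => -1 * h i) (toA g - eps *: toA (Q j)) =
      (toA g - eps *: toA (fraky x j g)) + eps *: toA (x j g - Q j).
    by rewrite rmorphB /= taylorN taylor_eps frakyE toAB scalerBr opprB !addrA subrK.
  by apply: ideal_add => //; [apply: mem_ideal_gen; exists g | apply: epsI].
move=> p; split.
  rewrite /centered_ideal translateE => /gen0; rewrite affine_comp mulr1.
  by rewrite (eq_affine _ (h' := fun=> 0)) ?affine_id // => i; rewrite mul1r mulN1r addNr.
move: p; apply: ideal_gen_sub; first exact (centered_ideal_ideal frame pt).
move=> p [f If ->]; apply/h1.
have -> : affine 1 (fun i => 1 * h i) (toA f - eps *: toA (fraky x j f)) =
    toA f - eps *: toA (x j f).
  by rewrite rmorphB /= taylor1 taylor_eps frakyE opprB addrA subrK.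
have [f1 fX fQ] := (trunc_ideal_deformed f).1 If.
have [y1 yX yQ] := (trunc_ideal_deformed _).1 (frakx_mod hx If).
set w := extend idfun (wtg F) f in y1 yX yQ.
have eQ : w *: Q j = combination g Q (idfun : k -> k) 0 (fun=> 0) (fun i => (i == j)%:R * w) 0.
  rewrite /combination scale0r addr0 mpolyC0 add0r big1 ?add0r => [|i _]; last first.
    by rewrite scale0r.
  rewrite (bigD1 j) //= eqxx mul1r idE big1 ?addr0 // => i /negPf ->.
  by rewrite mul0r scale0r.
have eA w' f' : extend (in_alg A) w' (toA f') = in_alg A (extend idfun w' f').
  exact: extend_map.
split=> [|i|i]; rewrite !extendB !extendZ !eA.
- move: y1; rewrite extendB eQ (c1_combination frame) subr0 f1 !mulr0 => ->.
  by rewrite raddf0 mulr0 subr0.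
- move: (yX i); rewrite extendB eQ (cX_combination frame) subr0 (fX i) !mulr0 => ->.
  by rewrite raddf0 mulr0 subr0.
have -> : extend idfun (wtQ F i) (x j f) = (i == j)%:R * w.
  move: (yQ i); rewrite extendB eQ (cQ_combination frame) mulr0 => /eqP.
  by rewrite subr_eq0 => /eqP.
rewrite (fQ i) mulr0 raddf0 sub0r -/w /B mulrN; congr (- _).
have -> : in_alg A ((i == j)%:R * w) = (i == j)%:R * in_alg A w.
  by rewrite rmorphM rmorph_nat.
rewrite mulrBl; move: (in_alg A (extend _ _ (x j f))) => v.
move: (in_alg A w) (i == j)%:R => w' u.
have -> : eps * v * (u * eps) = v * u * (eps * eps) by ring.
by rewrite ee mulr0 subr0; ring.
Qed.

End Tangent.

(** * Dual numbers *)

Section DualNumbers.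
Variable k : fieldType.
Local Notation dual := {poly %/ 'X^2 : {poly k}}.

Lemma mk_monic_X2 : mk_monic ('X^2 : {poly k}) = 'X^2.
Proof. by rewrite /mk_monic size_polyXn monicXn. Qed.

Lemma qX_square : ('qX : dual) * 'qX = 0.
Proof.
rewrite -in_qpolyM; apply/val_inj => /=; rewrite mk_monic_X2 -expr2.
by apply: Pdiv.RingMonic.rmodpp; apply: monicXn.
Qed.

Lemma dual_coef (a b : k) : in_alg dual a - in_alg dual b * 'qX = 0 -> a = 0 /\ b = 0.
Proof.
rewrite !mulr_algl => /(congr1 (fun x : dual => (x : {poly k}))).
have qXE : (('qX : dual) : {poly k}) = 'X by apply: qpolyXE; rewrite ?size_polyXn ?monicXn.
rewrite -[LHS]/(a *: 1%:P - b *: (('qX : dual) : {poly k})) qXE => h.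
move: (congr1 (coefp 0) h) (congr1 (coefp 1) h) => /=.
rewrite !coefB !coefZ !coefX !coefC /= !mulr0 mulr1 subr0 sub0r mulr1.
by move=> -> /eqP; rewrite oppr_eq0 => /eqP ->.
Qed.

End DualNumbers.

Lemma lrmorph_mmap (k : fieldType) (A A' : comAlgType k) (phi : {lrmorphism A -> A'})
    (y : 'I_6 -> A) (h : {mpoly k[6]}) :
  phi (mmap (in_alg A) y h) = mmap (in_alg A') (phi \o y) h.
Proof.
rewrite /mmap raddf_sum; apply: eq_bigr => m _ /=.
rewrite rmorphM /= linearZ /= rmorph1; congr (_ * _).
by rewrite /mmap1 rmorph_prod; apply: eq_bigr => i _; rewrite rmorphXn.
Qed.

Lemma mmap_homothety (k : fieldType) (A : comAlgType k) (c : k) (y : 'I_6 -> A) f :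
  mmap (in_alg A) y (affine c (fun=> 0) f) = mmap (in_alg A) (fun i => in_alg A c * y i) f.
Proof.
rewrite -[LHS]/((mmap (in_alg A) y \o affine c (fun=> 0)) f).
apply: mpoly_rmorph_ext f => [a|i] /=; first by rewrite affineC !mmapC.
by rewrite affineX mpolyC0 addr0 mmapZ !mmapX !mmap1U.
Qed.

Lemma spike_map_comp (k : fieldType) (A B C : comAlgType k) (phi : {lrmorphism A -> B})
    (psi : {lrmorphism B -> C}) J :
  eq_ideal (spike_map psi (spike_map phi J)) (spike_map (psi \o phi) J).
Proof.
apply: eq_ideal_trans (base_change_comp (map_poly phi) (map_poly psi) J) _.
by apply: eq_base_change => // p; rewrite /= map_poly_comp.
Qed.

(** * The apolar algebra represents the spikes *)

Section Main.
Variables (k : fieldType) (F g : {mpoly k[6]}) (Q : 'I_6 -> {mpoly k[6]}).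
Hypothesis frame : apolar_frame F g Q.
Hypothesis k0 : [pchar k] =i pred0.
Hypothesis hneg : hom_neg_dim (perp F) (perp F) 6.
Variables (n m : nat) (q : 'I_n -> {mpoly k[6]}) (D : 'I_m -> 'I_n -> {mpoly k[6]}).
Hypothesis pres : linear_presentation F q D.
Variable F0 : F != 0.
Local Notation R0 := (apolar_algebra F0).
Local Notation pi := (apolar_pi F0).

Let natk (e : nat) : (e%:R == 0 :> k) = (e == 0)%N.
Proof. exact: (pcharf0P k).1. Qed.

Let pow2_inj e d : 2%:R ^+ e = 2%:R ^+ d :> k -> e = d.
Proof.
wlog le : e d / (e <= d)%N => [h e2|].
  by have [le|/ltnW le] := leqP e d; [|symmetry]; apply: h.
move/esym/eqP; rewrite -subr_eq0 -!natrX -natrB ?leq_exp2l // natk subn_eq0.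
by rewrite leq_exp2l // => ge; apply/eqP; rewrite eqn_leq le.
Qed.

Definition universal_spike : {mpoly {poly R0}[6]} -> Prop :=
  spike_family F (fun i => pi 'X_i) (fun i => pi (Q i)) (pi g).

Lemma spike_map_universal (A : comAlgType k) (phi : {lrmorphism R0 -> A}) :
  eq_ideal (spike_map phi universal_spike)
    (spike_family F (fun i => phi (pi 'X_i)) (fun i => phi (pi (Q i))) (phi (pi g))).
Proof. exact: (spike_map_family frame phi (universal_point frame F0)). Qed.

Lemma lrmorph_point (A : comAlgType k) (phi : {lrmorphism R0 -> A}) :
  apolar_point F (in_alg A) (fun i => phi (pi 'X_i)) (fun i => phi (pi (Q i))) (phi (pi g)).
Proof.
apply: (apolar_point_map (rho := phi) _ (universal_point frame F0)).
by move=> x; rewrite /= linearZ /= rmorph1.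
Qed.

(** A spike over [A] is the family of a unique point of the apolar algebra with
    values in [A], and such points are the morphisms from this algebra to [A]. *)
Lemma universal_spike_iso : spike_iso F universal_spike.
Proof.
have k13 : 13%:R != 0 :> k by rewrite natk.
split; first exact: (family_spike frame k13 (universal_point frame F0)).
move=> A J spJ; split=> [|phi phi' e e'].
  have [b [c [d [pt eJ]]]] := spike_is_family frame k0 hneg pres spJ.
  have [phi [phiX phiQ phig]] := apolar_lift_exists frame F0 pt.
  exists phi; apply: eq_ideal_trans (spike_map_universal phi) _.
  apply: eq_ideal_trans (eq_ideal_sym eJ); exact: eq_family.
apply: apolar_lrmorph_ext.
apply: (family_inj frame k0 pres (lrmorph_point phi) (lrmorph_point phi')).
apply: eq_ideal_trans (eq_ideal_sym (spike_map_universal phi)) _.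
apply: eq_ideal_trans e _; apply: eq_ideal_trans (eq_ideal_sym e') _.
exact: spike_map_universal.
Qed.

Lemma apolar_pi_homothety (c : k) f :
  pi (affine c (fun=> 0) f) = mmap (in_alg R0) (fun i => in_alg R0 c * pi 'X_i) f.
Proof.
rewrite -mmap_homothety; apply: (rmorph_mmap (phi := pi)) => a.
by rewrite in_alg_apolar.
Qed.

(** The tangent vector [fraky_j] of the spike is the morphism
    [beta_i |-> - delta_ij eps], whose value at [f] only involves the constant
    term of [f] and its coefficient on [beta_j]. *)
Lemma tangent_point j (x : {mpoly k[6]} -> {mpoly k[6]})
    (dual := {poly %/ 'X^2 : {poly k}}) :
  is_frakx F g (Q j) x ->
  exists chi : {lrmorphism R0 -> dual},
    (forall f, chi (pi f) = in_alg dual f@_0 - in_alg dual f@_U_(j) * 'qX) /\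
    is_tangent F universal_spike chi (fun f => x f - 13%:R^-1 *: f^`M(j)).
Proof.
move=> hx; pose B i : dual := - ((i == j)%:R * 'qX).
have pt : apolar_point F (in_alg dual) B (fun=> 0) 0.
  split=> [i l|i l|l]; rewrite ?mulr0 //.
  rewrite big1 => [|l' _]; last by rewrite mulr0.
  by rewrite /B mulrNN mulrACA qX_square mulr0.
have [chi [chiX chiQ chig]] := apolar_lift_exists frame F0 pt.
exists chi; split=> [f|].
  rewrite apolar_lrmorph_mmap.
  have -> : mmap (in_alg dual) (fun i => chi (pi 'X_i)) f = mmap (in_alg dual) B f.
    by apply: eq_bigr => m0 _; congr (_ * _); apply: mmap1_eq.
  rewrite (apolar_eval frame f pt) c1E mcoeff_map_mpoly mulr0 addr0.
  rewrite [X in _ + X]big1 ?addr0 => [|i _]; last by rewrite mulr0.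
  congr (_ + _); rewrite (bigD1 j) //= big1 ?addr0 => [|i /negPf ij].
    by rewrite cXE mcoeff_map_mpoly /B eqxx mul1r mulrN.
  by rewrite /B ij mul0r oppr0 mulr0.
have -> : (fun f => x f - 13%:R^-1 *: f^`M(j)) = fraky (fun=> x) j by [].
apply: eq_ideal_trans (tangent_centered frame pres (qX_square k) hx).
rewrite /is_tangent; apply: (eq_ideal_trans (J2 := value_at idfun 1 (spike_family F B (fun=> 0) (0 : dual)))).
  apply: eq_base_change => //; apply: eq_ideal_trans (spike_map_universal chi) _.
  exact: eq_family.
apply: eq_ideal_trans (value_at_family frame (idfun : {lrmorphism dual -> dual}) 1 pt) _.
by apply: eq_centered_ideal => [i|i|] /=; rewrite ?expr1n mul1r.
Qed.

Section Presentation.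
Variables (B : comAlgType k) (xi : {mpoly {poly B}[6]} -> Prop).
Hypothesis iso : spike_iso F xi.

(** Two representing objects are isomorphic. *)
Lemma spike_iso_universal : exists phi : {lrmorphism B -> R0},
  injective phi /\ eq_ideal (spike_map phi xi) universal_spike.
Proof.
have [spu iso_u] := universal_spike_iso; have [spx iso_x] := iso.
have [[phi ephi] _] := iso_x _ _ spu; have [[psi epsi] _] := iso_u _ _ spx.
exists phi; split=> //; apply: (can_inj (g := psi)) => x.
have [_ uniq] := iso_x _ _ spx.
rewrite -[RHS]/((idfun : {lrmorphism B -> B}) x) -[LHS]/((psi \o phi) x).
apply: uniq.
  apply: eq_ideal_trans (eq_ideal_sym (spike_map_comp _ _ _)) _.
  apply: eq_ideal_trans epsi; exact: eq_base_change.
apply: base_change_id => [p|]; first by rewrite map_poly_id.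
by case: spx => [[[]]].
Qed.

(** The values of [y_i] on the six tangent vectors show that a representative
    [f] of [y_i] has linear part [- beta_i]. As [y_i] is homogeneous, its weight
    is therefore one, and the components of [f] of degrees two and three vanish
    modulo [perp F]. *)
Lemma coordinate_value (phi : {lrmorphism B -> R0}) (x : 'I_6 -> {mpoly k[6]} -> {mpoly k[6]})
    (y : 'I_6 -> B) i :
  eq_ideal (spike_map phi xi) universal_spike ->
  (forall i, is_frakx F g (Q i) (x i)) ->
  dual_coordinates F xi (fraky x) y -> phi (y i) = - pi 'X_i.
Proof.
move=> ephi hx [weight _ _ tangent]; have [_ [d wd]] := weight i.
have [f ef] := apolar_piP (phi (y i)).
(* The action of the scalar [2] on the apolar algebra. *)
have [sigma [sX sQ sg]] := apolar_lift_exists frame F0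
  (apolar_point_scale (2%:R : R0) (universal_point frame F0)).
have sigmaE : sigma (phi (y i)) = 2%:R ^+ d * phi (y i).
  apply: (wd R0 phi (sigma \o phi) 2%:R).
  apply: eq_ideal_trans (eq_ideal_sym (spike_map_comp _ _ _)) _.
  apply: (eq_ideal_trans (J2 := spike_map sigma universal_spike)).
    exact: eq_base_change.
  apply: eq_ideal_trans (spike_map_universal sigma) _; apply: eq_ideal_sym.
  apply: (eq_ideal_trans (J2 := base_change (comp_poly (2%:R *: 'X)) universal_spike)).
    exact: eq_base_change.
  apply: eq_ideal_trans (rescale_family frame 2%:R (universal_point frame F0)) _.
  exact: eq_family.
have coords e w : (forall l, mdeg l != e -> w l = 0) ->
    (forall h, perp F h -> extend idfun w h = 0) ->
    (2%:R ^+ e - 2%:R ^+ d) * extend (idfun : k -> k) w f = 0.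
  move=> we wperp; rewrite mulrBl -(extend_homothety idfun _ _ we) -extendZ -extendB.
  apply: wperp; apply/(apolar_pi_eq0 F0); rewrite rmorphB; apply/eqP; rewrite subr_eq0.
  rewrite /= apolar_pi_homothety -mul_mpolyC rmorphM /= -in_alg_apolar rmorphXn rmorph_nat -ef -sigmaE.
  rewrite ef apolar_lrmorph_mmap; apply/eqP/eq_bigr => l _; congr (_ * _).
  by apply: mmap1_eq => r; rewrite sX; congr (_ * _); exact: (rmorph_nat (in_alg R0) 2).
have chi_val j : f@_0 = 0 /\ f@_U_(j) = - (i == j)%:R.
  have [chi [chiE chiT]] := tangent_point (hx j).
  have := tangent j (chi \o phi) _ i; rewrite /= ef chiE => chi_y.
  have/dual_coef[] : in_alg {poly %/ 'X^2 : {poly k}} f@_0 -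
      in_alg _ (f@_U_(j) + (i == j)%:R) * 'qX = 0.
    rewrite (rmorphD (in_alg _)) (rmorph_nat (in_alg _)) mulrDl opprD addrA chi_y; last first.
      apply: eq_ideal_trans chiT; apply: eq_base_change => //.
      apply: eq_ideal_trans (eq_ideal_sym (spike_map_comp _ _ _)) _.
      exact: eq_base_change.
    by case: (i == j); rewrite ?mul1r ?mul0r subrr.
  by move=> -> /eqP; rewrite addr_eq0 => /eqP ->.
have d1 : d = 1%N.
  have perpX h : perp F h -> extend idfun (@wtX k i) h = 0 by case/(perpE frame).
  have := coords 1%N (@wtX k i) (@wtX_supp k i) perpX; rewrite cXE (chi_val i).2 eqxx mulrN1 => /eqP; rewrite oppr_eq0 subr_eq0 => /eqP.
  by move/pow2_inj.
have high e w : (1 < e)%N -> (forall l, mdeg l != e -> w l = 0) ->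
    (forall h, perp F h -> extend idfun w h = 0) -> extend (idfun : k -> k) w f = 0.
  move=> e1 we wp; have /eqP := coords e w we wp; rewrite mulf_eq0 subr_eq0 d1.
  by case/orP=> /eqP // /pow2_inj e1'; rewrite e1' in e1.
rewrite ef -rmorphN; apply/eqP; rewrite -subr_eq0 -rmorphB; apply/eqP/apolar_pi_eq0.
rewrite opprK; apply/(perpE frame); split=> [|a|a|]; rewrite extendD.
- by rewrite c1E (chi_val i).1 extend_mon wt1_supp ?mdeg1 ?addr0.
- by rewrite !cXE (chi_val a).2 mcoeffXU addNr.
- rewrite (high 2%N) ?extend_mon ?(wtQ_supp frame) ?mdeg1 ?addr0 //.
    exact: (wtQ_supp frame).
  by move=> h /(perpE frame)[].
rewrite (high 3%N) ?extend_mon ?(wtg_supp frame) ?mdeg1 ?addr0 //.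
  exact: (wtg_supp frame).
by move=> h /(perpE frame)[].
Qed.

End Presentation.
End Main.

(** [perp F] is a homogeneous ideal, hence stable under homotheties. *)
Lemma perp_opp (k : fieldType) (F g : {mpoly k[6]}) (Q : 'I_6 -> {mpoly k[6]}) h :
  apolar_frame F g Q -> perp F (affine (-1) (fun=> 0) h) <-> perp F h.
Proof.
move=> frame.
have neg w e : (forall l, mdeg l != e -> w l = 0) ->
    extend idfun w (affine (-1 : k) (fun=> 0) h) = 0 <-> extend idfun w h = 0.
  move=> we; rewrite (extend_homothety _ _ _ we) -signr_odd.
  by split=> [/eqP|->]; rewrite ?mulr0 // mulf_eq0 signr_eq0 => /eqP.
rewrite !(perpE frame); split=> -[h1 hX hQ hg]; split=> [|i|i|].
all: try by [apply/(neg _ 0%N); [exact: wt1_supp|]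
           | apply/(neg _ 1%N); [exact: wtX_supp|]
           | apply/(neg _ 2%N); [exact: (wtQ_supp frame)|]
           | apply/(neg _ 3%N); [exact: (wtg_supp frame)|]].
Qed.

Theorem theorem3p34 (k : closedFieldType) (hk : [pchar k] =i pred0)
    (F : {mpoly k[6]}) (hF : F \is 3.-homog) (hgen : general_enough F)
    (g : {mpoly k[6]}) (Q : 'I_6 -> {mpoly k[6]})
    (hg : g \is 3.-homog) (hQ : forall i, Q i \is 2.-homog)
    (hgF : hook g F = 1) (hQF : forall i, hook (Q i) F = 'X_i) :
  (exists u : {mpoly {poly (apolar_algebra (general_enough_neq0 hgen))}[6]} -> Prop,
     is_centering (fractal_ideal (general_enough_neq0 hgen) g Q) u /\
     spike_iso F u) /\
  (forall (B : comAlgType k) (xi : {mpoly {poly B}[6]} -> Prop)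
     (frakx : 'I_6 -> {mpoly k[6]} -> {mpoly k[6]}) (y : 'I_6 -> B),
     spike_iso F xi ->
     (forall i, is_frakx F g (Q i) (frakx i)) ->
     dual_coordinates F xi (fraky frakx) y ->
     eq_ideal (presentation_kernel y) (perp F)).
Proof.
have frame : apolar_frame F g Q by [].
have [n [m [q [D pres]]]] := general_enough_presentation hgen.
have [_ _ hneg] := hgen.
have F0 := general_enough_neq0 hgen.
split.
  exists (universal_spike g Q (F0 := general_enough_neq0 hgen)); split.
    by apply: (fractal_centering frame); rewrite ((pcharf0P k).1 hk).
  exact (universal_spike_iso frame hk hneg pres (general_enough_neq0 hgen)).
move=> B xi x y iso hx hy h.
have [phi [inj ephi]] := spike_iso_universal frame hk hneg pres F0 iso.
have ey i : phi (y i) = in_alg _ (-1) * apolar_pi F0 'X_i.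
  rewrite (coordinate_value frame hk pres _ ephi hx hy) rmorphN rmorph1.
  by rewrite mulN1r.
apply: (iff_trans (B := perp F (affine (-1) (fun=> 0) h))); last exact: (perp_opp h frame).
rewrite -(apolar_pi_eq0 F0) apolar_pi_homothety /presentation_kernel.
have -> : mmap (in_alg (apolar_algebra F0)) (fun i => in_alg _ (-1) * apolar_pi F0 'X_i) h =
    phi (mmap (in_alg B) y h).
  rewrite lrmorph_mmap; apply: eq_bigr => l _; congr (_ * _).
  by apply: mmap1_eq => i; rewrite /= ey.
by split=> [->|/eqP]; rewrite ?raddf0 // raddf_eq0 // => /eqP.
Qed.
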